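(* Let $g\in L^\infty(\mathbb T)$ admit a factorization $g=g_-\,\theta^{-N}g_+^{-1}$, where: - $\overline{g_-}$ and $g_+$ are outer functions in $H^2$; - $g_+^2$ is rigid in $H^1$; - $\theta$ is a non-constant inner function; - $N\in\mathbb Z$. Then $\ker T_g\neq\{0\}$ if and only if $N>0$. Moreover, if $N>0$ and $\theta$ is a finite Blaschke product of degree $n$, then $\dim\ker T_g=nN$; if $N>0$ and $\theta$ is not a finite Blaschke product, then $\dim\ker T_g=\infty$.
   Context: $H^p$ denotes the Hardy spaces of the unit disc, identified with boundary functions on $\mathbb T$. $T_g$ is the Toeplitz operator $f\mapsto P(gf)$ on $H^2$, where $P$ is the orthogonal projection of $L^2(\mathbb T)$ onto $H^2$. A function $f\in H^1\setminus\{0\}$ is rigid if, whenever $g\in H^1$ and $g/f>0$ a.e. on $\mathbb T$, one has $g=\lambda f$ for some $\lambda>0$. *)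

(* Defs.v *)
From HB Require Import structures.
From mathcomp Require Import all_boot all_order all_algebra.
From mathcomp Require Import all_classical all_reals all_analysis.
From mathcomp Require Import complex.
Set Implicit Arguments.
Unset Strict Implicit.
Unset Printing Implicit Defensive.
Import Order.TTheory GRing.Theory Num.Theory.
Local Open Scope classical_set_scope.
Local Open Scope ring_scope.


Section HardyDefs.
Variable R : realType.

(* The unit circle T is parametrised by t in [0, 2 pi], z = e^{it}, with
   Lebesgue measure (normalisation constants are irrelevant below except in
   the outer-function formula, where 1/(2 pi) is written explicitly). *)
Definition mu := @lebesgue_measure R.
Definition Tc : set R := `[0, pi *+ 2]%classic.

Definition Cfun := R -> R[i].

Definition cRe (z : R[i]) : R := complex.Re z.
Definition cIm (z : R[i]) : R := complex.Im z.
Definition cmk (a b : R) : R[i] := complex.Complex a b.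
Definition cR (x : R) : R[i] := cmk x 0.
Definition cconj (z : R[i]) : R[i] := cmk (cRe z) (- cIm z).
Definition cabs (z : R[i]) : R := Num.sqrt (cRe z ^+ 2 + cIm z ^+ 2).
Definition cexp (z : R[i]) : R[i] :=
  cmk (expR (cRe z) * cos (cIm z)) (expR (cRe z) * sin (cIm z)).
Definition eit (t : R) : R[i] := cmk (cos t) (sin t).

Definition ae_T (P : R -> Prop) : Prop := {ae mu, forall t, Tc t -> P t}.

Definition cmeasurable (f : Cfun) : Prop :=
  measurable_fun Tc (fun t => cRe (f t)) /\ measurable_fun Tc (fun t => cIm (f t)).

Definition cint (f : Cfun) : R[i] :=
  cmk (Rintegral mu Tc (fun t => cRe (f t))) (Rintegral mu Tc (fun t => cIm (f t))).

Definition Lp (p : nat) (f : Cfun) : Prop :=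
  cmeasurable f /\ (\int[mu]_(t in Tc) ((cabs (f t)) ^+ p)%:E < +oo)%E.
Definition Linf (f : Cfun) : Prop :=
  cmeasurable f /\ exists M : R, ae_T (fun t => cabs (f t) <= M).

Definition fourier (f : Cfun) (k : int) : R[i] :=
  cR (pi *+ 2)^-1 * cint (fun t => f t * eit (- (k%:~R * t))).

Definition Hp (p : nat) (f : Cfun) : Prop :=
  Lp p f /\ forall k : int, (k < 0)%R -> fourier f k = 0.
Definition Hinf (f : Cfun) : Prop := Linf f /\ Hp 1 f.

Definition ae_zero (f : Cfun) : Prop := ae_T (fun t => f t = 0).

(* holomorphic extension of f in H^1 to the disc, via the Cauchy integral:
   F(z) = (1/2pi) int f(t) / (1 - z e^{-it}) dt *)
Definition disc_ext (f : Cfun) (z : R[i]) : R[i] :=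
  cR (pi *+ 2)^-1 * cint (fun t => f t / (1 - z * eit (- t))).

Definition outer (p : nat) (f : Cfun) : Prop :=
  Hp p f /\
  measurable_fun Tc (fun t => ln (cabs (f t))) /\
  (\int[mu]_(t in Tc) (`|ln (cabs (f t))|)%:E < +oo)%E /\
  exists lam : R[i], cabs lam = 1 /\
    forall z : R[i], cabs z < 1 ->
      disc_ext f z =
      lam * cexp (cR (pi *+ 2)^-1 *
        cint (fun t => (eit t + z) / (eit t - z) * cR (ln (cabs (f t))))).

Definition inner (th : Cfun) : Prop :=
  Hinf th /\ ae_T (fun t => cabs (th t) = 1).
Definition nonconstant (f : Cfun) : Prop :=
  ~ exists c : R[i], ae_T (fun t => f t = c).

Definition cpos (z : R[i]) : Prop := cIm z = 0 /\ 0 < cRe z.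
Definition rigid (f : Cfun) : Prop :=
  Hp 1 f /\ ~ ae_zero f /\
  forall g : Cfun, Hp 1 g -> ae_T (fun t => cpos (g t / f t)) ->
    exists lam : R, 0 < lam /\ ae_T (fun t => g t = cR lam * f t).

Definition finite_blaschke (n : nat) (th : Cfun) : Prop :=
  exists (c : R[i]) (a : 'I_n -> R[i]),
    cabs c = 1 /\ (forall k, cabs (a k) < 1) /\
    ae_T (fun t => th t =
      c * \prod_(k < n) ((eit t - a k) / (1 - cconj (a k) * eit t))).

(* kernel of the Toeplitz operator T_g f = P(g f) on H^2:
   P(gf) = 0 iff gf is orthogonal in L^2 to H^2 *)
Definition kerT (g f : Cfun) : Prop :=
  Hp 2 f /\ forall h : Cfun, Hp 2 h -> cint (fun t => g t * f t * cconj (h t)) = 0.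

(* elements of L^2 are identified modulo a.e. equality *)
Definition ae_indep (m : nat) (fs : 'I_m -> Cfun) : Prop :=
  forall c : 'I_m -> R[i],
    ae_T (fun t => \sum_(i < m) c i * fs i t = 0) -> forall i, c i = 0.
Definition kerT_dim_ge (g : Cfun) (m : nat) : Prop :=
  exists fs : 'I_m -> Cfun, (forall i, kerT g (fs i)) /\ ae_indep fs.
Definition kerT_dim_eq (g : Cfun) (d : nat) : Prop :=
  kerT_dim_ge g d /\ ~ kerT_dim_ge g d.+1.
Definition kerT_dim_infinite (g : Cfun) : Prop := forall m, kerT_dim_ge g m.
Definition kerT_nontrivial (g : Cfun) : Prop :=
  exists f, kerT g f /\ ~ ae_zero f.

End HardyDefs.

(* Main.v *)
Require Import Defs.
From HB Require Import structures.
From mathcomp Require Import all_boot all_order all_algebra.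
From mathcomp Require Import all_classical all_reals all_analysis.
From mathcomp Require Import measurable_realfun complex.
From mathcomp Require Import ring lra.
Set Implicit Arguments.
Unset Strict Implicit.
Unset Printing Implicit Defensive.
Import Order.TTheory GRing.Theory Num.Theory.
Import numFieldNormedType.Exports.
Local Open Scope classical_set_scope.
Local Open Scope ring_scope.

(** If [f] is in [ker T_g] and [N <= 0], put [u = theta^(-N) f] and
    [phi = u / g_+]; then [g_- phi] is the conjugate of some [h] in [H^2]
    vanishing at 0.  The function [X = g_+ conj(phi)] has the modulus of [u],
    and [X conj(g_-) = g_+ h] is in [H^1], so [X] is in [H^2] because
    [conj(g_-)] is outer.  Then
    [g_+^2 (1 + |1 + c phi|^2) = g_+^2 + (g_+ + c u) (g_+ + conj(c) X)] is in
    [H^1] for every constant [c], and rigidity of [g_+^2] makes [|1 + c phi|]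
    constant.  Hence [phi] is constant, and it is 0 because [X] vanishes at 0.

    If [N > 0], the kernel contains [g_+ K] for every bounded [K] in the model
    space of [theta^N].  The backward shifts of [theta] are such functions; a
    linear relation between them makes [theta] rational, and a rational inner
    function is a finite Blaschke product.  If [theta] is a Blaschke product of
    degree [n] and denominator [D], the functions [z^j / D^N], [j < n N], give
    the lower bound for the dimension; the upper bound holds because [n N]
    linear conditions on [f] in [ker T_g] make [f / theta^N] analytic, which
    reduces to the case [N = 0].

    Everything takes place on the circle.  Of the formula defining outer
    functions only the value at the origin is used: combined with Fejer
    approximation of [- ln |G|^2] it yields bounded analytic multipliers [P]
    such that [P G] tends to a constant in [L^2]. *)

(** A priori [phi = u / g_+] is not known to be integrable, so it has no Fourier coefficients to
    argue with. The proof therefore works with products of two square integrable functions: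
    [u = g_+ phi] and [X = g_+ conj(phi)] both have modulus |u|, and the competitor for rigidity
    comes from g_+^2 |1 + c phi|^2 = (g_+ + c u)(g_+ + conj(c) X). The extra summand g_+^2 keeps the
    quotient strictly positive where 1 + c phi vanishes. The value of an outer function G at the
    origin says that Jensen's inequality ln |G^(0)| <= mean of ln |G| is an equality. A multiplier P
    = exp(q / 2) has |P|^2 = exp(Re q), and its value at 0 is governed by the mean of Re q. With Re
    q close to - ln |G|^2, both the mean of |P G|^2 and the modulus of (P G)^(0) are close to 1,
    which forces P G to be close to a constant in L^2. The number n N is the degree of the numerator
    of theta^N: multiplication by it makes f / theta^N analytic, and a monic polynomial of degree d
    leaves only d negative coefficients to be killed. *)

(** * Complex numbers and the unit circle *)

Section ComplexAlgebra.
Variable R : realType.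
Local Notation C := R[i].
Implicit Types (z w : C) (t : R).

Lemma complex_ext z w : cRe z = cRe w -> cIm z = cIm w -> z = w.
Proof. by case: z => a b; case: w => c d /= -> ->. Qed.

Lemma cReD z w : cRe (z + w) = cRe z + cRe w. Proof. by case: z; case: w. Qed.
Lemma cImD z w : cIm (z + w) = cIm z + cIm w. Proof. by case: z; case: w. Qed.
Lemma cReN z : cRe (- z) = - cRe z. Proof. by case: z. Qed.
Lemma cImN z : cIm (- z) = - cIm z. Proof. by case: z. Qed.
Lemma cReM z w : cRe (z * w) = cRe z * cRe w - cIm z * cIm w.
Proof. by case: z; case: w. Qed.
Lemma cImM z w : cIm (z * w) = cRe z * cIm w + cIm z * cRe w.
Proof. by case: z; case: w. Qed.
Lemma cReV z : cRe z^-1 = cRe z / (cRe z ^+ 2 + cIm z ^+ 2).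
Proof. by case: z. Qed.
Lemma cImV z : cIm z^-1 = - (cIm z / (cRe z ^+ 2 + cIm z ^+ 2)).
Proof. by case: z => a b /=; rewrite -?mulNr. Qed.

Lemma cconjE z : cconj z = conjc z. Proof. by case: z. Qed.
Lemma cabsE z : cabs z = ComplexField.Normc.normc z. Proof. by case: z. Qed.

Lemma cconjM z w : cconj (z * w) = cconj z * cconj w.
Proof. by rewrite !cconjE rmorphM. Qed.
Lemma cconjD z w : cconj (z + w) = cconj z + cconj w.
Proof. by rewrite !cconjE rmorphD. Qed.
Lemma cconjB z w : cconj (z - w) = cconj z - cconj w.
Proof. by rewrite !cconjE rmorphB. Qed.
Lemma cconjV z : cconj z^-1 = (cconj z)^-1.
Proof. by rewrite !cconjE conjc_inv. Qed.
Lemma cconjX z n : cconj (z ^+ n) = cconj z ^+ n.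
Proof. by rewrite !cconjE rmorphXn. Qed.
Lemma cconj0 : cconj (0 : C) = 0. Proof. by rewrite !cconjE rmorph0. Qed.
Lemma cconj1 : cconj (1 : C) = 1. Proof. by rewrite !cconjE rmorph1. Qed.
Lemma cconjK z : cconj (cconj z) = z.
Proof. by rewrite !cconjE conjcK. Qed.
Lemma cconj_eq0 z : (cconj z == 0) = (z == 0).
Proof. by rewrite cconjE conjc_eq0. Qed.

Lemma cabs_ge0 z : 0 <= cabs z. Proof. exact: sqrtr_ge0. Qed.
Lemma cabs_sqr z : cabs z ^+ 2 = cRe z ^+ 2 + cIm z ^+ 2.
Proof. by rewrite sqr_sqrtr// addr_ge0// sqr_ge0. Qed.
Lemma cabsM z w : cabs (z * w) = cabs z * cabs w.
Proof. by rewrite !cabsE ComplexField.Normc.normcM. Qed.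
Lemma cabsV z : cabs z^-1 = (cabs z)^-1.
Proof. by rewrite !cabsE ComplexField.Normc.normcV. Qed.
Lemma ler_cabsD z w : cabs (z + w) <= cabs z + cabs w.
Proof. rewrite !cabsE; exact: (@le_normcD R). Qed.
Lemma cabsN z : cabs (- z) = cabs z.
Proof. by rewrite /cabs cReN cImN !sqrrN. Qed.
Lemma ler_cabsB z w : cabs (z - w) <= cabs z + cabs w.
Proof. by rewrite -(cabsN w) ler_cabsD. Qed.
Lemma cabs_distC z w : cabs (z - w) = cabs (w - z).
Proof. by rewrite -cabsN opprB. Qed.
Lemma cabs0 : cabs (0 : C) = 0.
Proof. by rewrite !cabsE ComplexField.Normc.normc0. Qed.
Lemma cabs1 : cabs (1 : C) = 1.
Proof. by rewrite !cabsE ComplexField.Normc.normc1. Qed.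
Lemma cabs0_eq0 z : cabs z = 0 -> z = 0.
Proof. by rewrite cabsE => /ComplexField.Normc.eq0_normc. Qed.
Lemma cabs_eq0 z : (cabs z == 0) = (z == 0).
Proof. by apply/eqP/eqP => [/cabs0_eq0//|->]; rewrite cabs0. Qed.
Lemma cabs_gt0 z : (0 < cabs z) = (z != 0).
Proof. by rewrite lt_neqAle cabs_ge0 andbT eq_sym cabs_eq0. Qed.
Lemma cabsX z n : cabs (z ^+ n) = cabs z ^+ n.
Proof. by elim: n => [|n IH]; rewrite ?expr0 ?cabs1// !exprS cabsM IH. Qed.
Lemma cabs_conj z : cabs (cconj z) = cabs z.
Proof. by rewrite /cabs /= sqrrN. Qed.
Lemma cabs_cR (x : R) : cabs (cR x) = `|x|.
Proof. by rewrite /cabs /= expr0n addr0 sqrtr_sqr. Qed.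
Lemma normr_cRe z : `|cRe z| <= cabs z.
Proof. by rewrite -sqrtr_sqr ler_sqrt ?addr_ge0 ?sqr_ge0// lerDl sqr_ge0. Qed.
Lemma normr_cIm z : `|cIm z| <= cabs z.
Proof. by rewrite -sqrtr_sqr ler_sqrt ?addr_ge0 ?sqr_ge0// lerDr sqr_ge0. Qed.
Lemma cRe_le_cabs z : cRe z <= cabs z.
Proof. exact: le_trans (ler_norm _) (normr_cRe z). Qed.
Lemma cabs_le_ReIm z : cabs z <= `|cRe z| + `|cIm z|.
Proof.
rewrite -(@ler_pXn2r _ 2)// ?nnegrE ?cabs_ge0 ?addr_ge0//.
rewrite cabs_sqr sqrrD !real_normK ?num_real// lerD2r lerDl.
by rewrite mulrn_wge0// mulr_ge0.
Qed.
Lemma ler_cabs_sum (I : Type) (s : seq I) (P : pred I) (F : I -> C) :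
  cabs (\sum_(i <- s | P i) F i) <= \sum_(i <- s | P i) cabs (F i).
Proof.
elim/big_rec2: _ => [|i y1 y2 _ h]; first by rewrite cabs0.
by rewrite (le_trans (ler_cabsD _ _))// lerD2l.
Qed.

Lemma cRD (x y : R) : cR (x + y) = cR x + cR y.
Proof. by apply: complex_ext; rewrite ?cReD ?cImD //= addr0. Qed.
Lemma cRM (x y : R) : cR (x * y) = cR x * cR y.
Proof. by apply: complex_ext; rewrite ?cReM ?cImM /=; ring. Qed.
Lemma cR0 : cR (0 : R) = 0. Proof. by []. Qed.
Lemma cR1 : cR (1 : R) = 1. Proof. by []. Qed.
Lemma cR_neq0 (x : R) : x != 0 -> cR x != 0.
Proof. by move=> x0; rewrite -cabs_eq0 cabs_cR normr_eq0. Qed.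
Lemma cRV (x : R) : cR x^-1 = (cR x)^-1.
Proof.
have [->|x0] := eqVneq x 0; first by rewrite invr0 cR0 invr0.
apply: (mulfI (cR_neq0 x0)); rewrite -cRM divff// divff ?cR_neq0//.
Qed.
Lemma cR_nat (n : nat) : cR (n%:R : R) = n%:R.
Proof. by elim: n => // n IH; rewrite -addn1 !natrD cRD IH. Qed.
Lemma cconj_cR (x : R) : cconj (cR x) = cR x.
Proof. by apply: complex_ext; rewrite //= oppr0. Qed.

Lemma mulr_cconj z : z * cconj z = cR (cabs z ^+ 2).
Proof.
by apply: complex_ext; rewrite ?cReM ?cImM cabs_sqr /=; ring.
Qed.
Lemma cconj_unit z : cabs z = 1 -> cconj z = z^-1.
Proof.
move=> z1; have z0 : z != 0 by rewrite -cabs_gt0 z1.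
by apply: (mulfI z0); rewrite mulr_cconj z1 expr1n divff.
Qed.

Lemma cabs_sqrD z w :
  cabs (z + w) ^+ 2 = cabs z ^+ 2 + cabs w ^+ 2 + cRe (z * cconj w) *+ 2.
Proof. by rewrite !cabs_sqr cReD cImD cReM /=; ring. Qed.
Lemma cabs_sqrB z w :
  cabs (z - w) ^+ 2 = cabs z ^+ 2 + cabs w ^+ 2 - cRe (z * cconj w) *+ 2.
Proof. by rewrite !cabs_sqr cReD cImD cReN cImN cReM /=; ring. Qed.

Lemma cabs_eit t : cabs (eit t) = 1.
Proof. by rewrite /cabs /= cos2Dsin2 sqrtr1. Qed.
Lemma eit_neq0 t : eit t != 0.
Proof. by rewrite -cabs_gt0 cabs_eit. Qed.
Lemma eit0 : eit (0 : R) = 1.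
Proof. by rewrite /eit cos0 sin0. Qed.
Lemma eitD s t : eit (s + t) = eit s * eit t.
Proof.
by apply: complex_ext; rewrite ?cReM ?cImM /= ?cosD ?sinD//; ring.
Qed.
Lemma cconj_eit t : cconj (eit t) = eit (- t).
Proof. by rewrite /eit cosN sinN. Qed.
Lemma eitN t : eit (- t) = (eit t)^-1.
Proof. by rewrite -cconj_eit cconj_unit// cabs_eit. Qed.
Lemma eit_nat n t : eit (n%:R * t) = eit t ^+ n.
Proof.
elim: n => [|n IH]; first by rewrite mul0r eit0 expr0.
by rewrite -addn1 natrD mulrDl eitD IH mul1r addn1 exprSr.
Qed.
Lemma eit_int (k : int) t : eit (k%:~R * t) = eit t ^ k.
Proof.
case: k => n; first exact: eit_nat.
by rewrite NegzE mulrNz mulNr eitN -exprnN -eit_nat.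
Qed.
Lemma cabs_eitX (k : int) t : cabs (eit t ^ k) = 1.
Proof. by rewrite -eit_int cabs_eit. Qed.

End ComplexAlgebra.

(** * Integrals over the circle *)

Section RealIntegration.
Variable R : realType.
Implicit Types (f g h : R -> R).

Definition rint f : R := Rintegral (@lebesgue_measure R) (@Tc R) f.
Definition rL1 f : Prop := (@lebesgue_measure R).-integrable (@Tc R) (EFin \o f).

Lemma measurable_Tc : measurable (@Tc R : set (measurableTypeR R)).
Proof. exact: measurable_itv. Qed.
Hint Resolve measurable_Tc : core.

Lemma twopi_gt0 : 0 < pi *+ 2 :> R.
Proof. by rewrite mulrn_wgt0// pi_gt0. Qed.
Hint Resolve twopi_gt0 : core.
Lemma twopi_ge0 : 0 <= pi *+ 2 :> R.
Proof. exact: ltW. Qed.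
Lemma twopi_neq0 : pi *+ 2 != 0 :> R.
Proof. exact: lt0r_neq0. Qed.

Lemma mu_Tc : @lebesgue_measure R (@Tc R) = (pi *+ 2)%:E.
Proof.
rewrite /Tc lebesgue_measure_itv/= lte_fin twopi_gt0.
by rewrite -EFinB subr0.
Qed.

Lemma mu_Tc_lty : (@lebesgue_measure R (@Tc R) < +oo)%E.
Proof. by rewrite mu_Tc ltry. Qed.
Hint Resolve mu_Tc_lty : core.

Lemma rL1_measurable f : rL1 f -> measurable_fun (@Tc R) f.
Proof. by move=> /integrableP[/measurable_EFinP]. Qed.

Lemma ae_lebesgue_filter : Filter (almost_everywhere (@lebesgue_measure R)).
Proof. exact: ae_filter_ringOfSetsType. Qed.

Lemma ae_T_all (P : R -> Prop) : (forall t, Tc t -> P t) -> ae_T P.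
Proof. by move=> h; apply: aeW => t; exact: h. Qed.

Lemma ae_T_sub (P Q : R -> Prop) :
  (forall t, P t -> Q t) -> ae_T P -> ae_T Q.
Proof.
move=> PQ; rewrite /ae_T /mu; apply: (@filterS _ _ ae_lebesgue_filter).
by move=> t h /h /PQ.
Qed.

Lemma ae_T_sub2 (P Q S : R -> Prop) :
  (forall t, P t -> Q t -> S t) -> ae_T P -> ae_T Q -> ae_T S.
Proof.
move=> h; rewrite /ae_T /mu; apply: (@filterS2 _ _ ae_lebesgue_filter).
by move=> t Pt Qt T; exact: h (Pt T) (Qt T).
Qed.

Lemma ae_T_sub3 (P Q S U : R -> Prop) :
  (forall t, P t -> Q t -> S t -> U t) -> ae_T P -> ae_T Q -> ae_T S -> ae_T U.
Proof.
move=> h; rewrite /ae_T /mu; apply: (@filterS3 _ _ ae_lebesgue_filter).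
by move=> t Pt Qt St T; exact: h (Pt T) (Qt T) (St T).
Qed.

(** A null set cannot cover the circle, which has measure 2 pi. This turns contradictory
    almost-everywhere statements into a contradiction at one point. *)
Lemma ae_T_exists (P : R -> Prop) : ae_T P -> exists2 t, Tc t & P t.
Proof.
move=> [N [mN N0 sN]]; apply: contrapT => h.
have : (@lebesgue_measure R (@Tc R) <= @lebesgue_measure R N)%E.
  apply: le_measure; rewrite ?inE// => t Tt; apply: sN => /= /(_ Tt) Pt.
  by apply: h; exists t.
by move: N0; rewrite /mu => ->; rewrite mu_Tc lee_fin leNgt twopi_gt0.
Qed.

Lemma ae_T_neq (a : R) : ae_T (fun t => t <> a).
Proof.
exists [set a]; split; first exact: measurable_set1.
  exact: lebesgue_measure_set1.
by move=> t /= /not_implyP[_ /contrapT].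
Qed.

Lemma rL1_le f g : measurable_fun (@Tc R) f -> rL1 g ->
  ae_T (fun t => `|f t| <= g t) -> rL1 f.
Proof.
move=> mf ig fg; apply/integrableP; split; first exact/measurable_EFinP.
have [mg goo] := integrableP _ _ _ ig; apply: le_lt_trans goo.
apply: ae_ge0_le_integral => //.
- by do 2 apply: measurableT_comp => //.
- exact: measurableT_comp.
- move: fg; rewrite /ae_T /mu; apply: (@filterS _ _ ae_lebesgue_filter) => t h /h /= fgt.
  by rewrite lee_fin (le_trans fgt)// ler_norm.
Qed.

Lemma rL1_cst (c : R) : rL1 (fun=> c).
Proof.
apply: measurable_bounded_integrable => //; exists `|c|; split=> //.
by move=> M cM t _; exact: ltW.
Qed.

Lemma rL1_bounded f (M : R) : measurable_fun (@Tc R) f ->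
  ae_T (fun t => `|f t| <= M) -> rL1 f.
Proof.
move=> mf fM; apply: (@rL1_le f (fun=> M)) => //.
exact: rL1_cst.
Qed.

Lemma rL1D f g : rL1 f -> rL1 g -> rL1 (fun t => f t + g t).
Proof. by move=> fi gi; have := integrableD measurable_Tc fi gi. Qed.
Lemma rL1B f g : rL1 f -> rL1 g -> rL1 (fun t => f t - g t).
Proof. by move=> fi gi; have := integrableB measurable_Tc fi gi. Qed.
Lemma rL1Z f (c : R) : rL1 f -> rL1 (fun t => c * f t).
Proof. by move=> fi; have := integrableZl measurable_Tc c fi. Qed.
Lemma rL1N f : rL1 f -> rL1 (fun t => - f t).
Proof. by move=> fi; have := integrableN fi. Qed.
Lemma rL1_norm f : rL1 f -> rL1 (fun t => `|f t|).
Proof. exact: integrable_norm. Qed.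

Lemma rintD f g : rL1 f -> rL1 g ->
  rint (fun t => f t + g t) = rint f + rint g.
Proof. exact: RintegralD. Qed.
Lemma rintB f g : rL1 f -> rL1 g ->
  rint (fun t => f t - g t) = rint f - rint g.
Proof. exact: RintegralB. Qed.
Lemma rintZ f (c : R) : rL1 f -> rint (fun t => c * f t) = c * rint f.
Proof. by move=> ?; exact: RintegralZl. Qed.
Lemma rintN f : rL1 f -> rint (fun t => - f t) = - rint f.
Proof.
move=> fi; rewrite -mulN1r -rintZ//; congr rint; apply/funext => t.
by rewrite mulN1r.
Qed.
Lemma rint_cst (c : R) : rint (fun=> c) = c * (pi *+ 2).
Proof. by rewrite /rint Rintegral_cst// [X in fine X]mu_Tc. Qed.

Lemma rint_eq f g : (forall t, Tc t -> f t = g t) -> rint f = rint g.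
Proof. by move=> fg; apply: eq_Rintegral => t; rewrite inE => /fg. Qed.

Lemma rint_ae f g : measurable_fun (@Tc R) f -> measurable_fun (@Tc R) g ->
  ae_T (fun t => f t = g t) -> rint f = rint g.
Proof.
move=> mf mg fg; congr fine; apply: ae_eq_integral => //.
- exact/measurable_EFinP.
- exact/measurable_EFinP.
- by move: fg; rewrite /ae_T /mu; apply: (@filterS _ _ ae_lebesgue_filter) => t h /h /= ->.
Qed.

Lemma rint_ge0 f : (forall t, Tc t -> 0 <= f t) -> 0 <= rint f.
Proof. by move=> f0; rewrite fine_ge0// integral_ge0. Qed.

Lemma rint_le f g : rL1 f -> rL1 g -> ae_T (fun t => f t <= g t) ->
  rint f <= rint g.
Proof.
move=> fi gi fg; rewrite -subr_ge0 -rintB//.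
(* The inequality holds only almost everywhere while [rint_ge0] asks for it at every point; the
   absolute value repairs this without changing the integral. *)
have -> : rint (fun t => g t - f t) = rint (fun t => `|g t - f t|).
  have h := rL1_measurable (rL1B gi fi).
  apply: rint_ae => //; first by apply: measurableT_comp.
  by apply: ae_T_sub fg => t fgt; rewrite ger0_norm// subr_ge0.
by apply: rint_ge0.
Qed.

Lemma rint_norm f : rL1 f -> `|rint f| <= rint (fun t => `|f t|).
Proof. exact: le_normr_Rintegral. Qed.

Lemma rint_fin f : rL1 f ->
  (\int[@lebesgue_measure R]_(t in @Tc R) (f t)%:E = (rint f)%:E)%E.
Proof. by move=> fi; rewrite /rint /Rintegral fineK// integrable_fin_num. Qed.

Lemma rint_eq0_ae f : rL1 f -> (forall t, 0 <= f t) -> rint f = 0 ->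
  ae_T (fun t => f t = 0).
Proof.
move=> fi f0 i0.
have mf : measurable_fun (@Tc R) (EFin \o f).
  by apply/measurable_EFinP; exact: rL1_measurable.
have [+ _] := ae_eq_integral_abs (@lebesgue_measure R) measurable_Tc mf.
have -> : (\int[@lebesgue_measure R]_(x in @Tc R) `|(EFin \o f) x| = 0)%E.
  under eq_integral do rewrite /= ger0_norm//.
  by rewrite rint_fin// i0.
by move=> /(_ erefl); rewrite /ae_T /mu; apply: (@filterS _ _ ae_lebesgue_filter) => t h /h /= [].
Qed.

Lemma rint_dominated (F : nat -> R -> R) f g :
  (forall n, measurable_fun (@Tc R) (F n)) -> measurable_fun (@Tc R) f ->
  rL1 g -> (forall n t, Tc t -> `|F n t| <= g t) ->
  ae_T (fun t => F ^~ t @ \oo --> f t) ->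
  rint (F n) @[n --> \oo] --> rint f.
Proof.
move=> mF mf gi Fg Ff.
have [||||fi _ +] := @dominated_convergence _ _ R (@lebesgue_measure R) _ measurable_Tc
  (fun n => EFin \o F n) (EFin \o f) (EFin \o g) _ _ _ gi _.
- by move=> n; apply/measurable_EFinP; exact: mF.
- by apply/measurable_EFinP.
- move: Ff; rewrite /ae_T /mu; apply: (@filterS _ _ ae_lebesgue_filter).
  by move=> t h /h h'; apply: cvg_EFin; first by near=> n.
- by apply: aeW => t n Tt /=; rewrite lee_fin Fg.
have Fi n : rL1 (F n).
  by apply: (rL1_le (mF n) gi); apply: ae_T_all => t Tt; exact: Fg.
rewrite /= rint_fin//; under eq_fun do rewrite /= rint_fin//.
by move=> /fine_cvg.
Unshelve. all: by end_near. Qed.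

End RealIntegration.
#[global] Hint Resolve measurable_Tc mu_Tc_lty : core.

(** * Complex integrals and square integrable functions *)

Section ComplexIntegration.
Variable R : realType.
Local Notation C := R[i].
Implicit Types (f g h : Cfun R) (c : C).

Lemma measurable_inv_nneg (u : R -> R) : measurable_fun (@Tc R) u ->
  (forall t, 0 <= u t) -> measurable_fun (@Tc R) (fun t => (u t)^-1).
Proof.
move=> mu u0.
(* Measurability is inherited from the power function; the two sides agree at 0 as well, where both
   are 0. *)
have -> : (fun t => (u t)^-1) = (fun x => x `^ (-1)) \o u.
  by apply/funext => t /=; rewrite powR_inv1.
by apply: measurableT_comp => //; exact: measurable_powR.
Qed.

Lemma cmeasurable_cst c : cmeasurable (fun=> c : C).
Proof. by split. Qed.
Lemma cmeasurableD f g : cmeasurable f -> cmeasurable g ->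
  cmeasurable (fun t => f t + g t).
Proof.
move=> [f1 f2] [g1 g2]; split.
  under eq_fun do rewrite cReD; exact: measurable_funD.
under eq_fun do rewrite cImD; exact: measurable_funD.
Qed.
Lemma cmeasurableN f : cmeasurable f -> cmeasurable (fun t => - f t).
Proof.
move=> [f1 f2]; split.
  under eq_fun do rewrite cReN; exact: measurable_funN.
under eq_fun do rewrite cImN; exact: measurable_funN.
Qed.
Lemma cmeasurableB f g : cmeasurable f -> cmeasurable g ->
  cmeasurable (fun t => f t - g t).
Proof. by move=> mf mg; apply: cmeasurableD => //; exact: cmeasurableN. Qed.
Lemma cmeasurableM f g : cmeasurable f -> cmeasurable g ->
  cmeasurable (fun t => f t * g t).
Proof.
move=> [f1 f2] [g1 g2]; split.
  under eq_fun do rewrite cReM.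
  by apply: measurable_funB; exact: measurable_funM.
under eq_fun do rewrite cImM.
by apply: measurable_funD; exact: measurable_funM.
Qed.
Lemma cmeasurable_conj f : cmeasurable f -> cmeasurable (fun t => cconj (f t)).
Proof. by move=> [f1 f2]; split => //=; exact: measurable_funN. Qed.
Lemma cmeasurableV f : cmeasurable f -> cmeasurable (fun t => (f t)^-1).
Proof.
move=> [f1 f2].
have m2 : measurable_fun (@Tc R) (fun t => (cRe (f t) ^+ 2 + cIm (f t) ^+ 2)^-1).
  apply: measurable_inv_nneg; last by move=> t; rewrite addr_ge0// sqr_ge0.
  by apply: measurable_funD; exact: measurable_funX.
split.
  by under eq_fun do rewrite cReV; exact: measurable_funM.
by under eq_fun do rewrite cImV; apply: measurable_funN; exact: measurable_funM.
Qed.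
Lemma cmeasurableX f n : cmeasurable f -> cmeasurable (fun t => f t ^+ n).
Proof.
move=> mf; elim: n => [|n IH]; first exact: cmeasurable_cst.
by under eq_fun do rewrite exprS; exact: cmeasurableM.
Qed.
Lemma cmeasurableXz f (k : int) : cmeasurable f -> cmeasurable (fun t => f t ^ k).
Proof.
move=> mf; case: k => n; first exact: cmeasurableX.
by apply: cmeasurableV; exact: cmeasurableX.
Qed.
Lemma cmeasurable_sum (I : Type) (s : seq I) (F : I -> Cfun R) :
  (forall i, cmeasurable (F i)) -> cmeasurable (fun t => \sum_(i <- s) F i t).
Proof.
move=> mF; elim: s => [|i s IH].
  by under eq_fun do rewrite big_nil; exact: cmeasurable_cst.
by under eq_fun do rewrite big_cons; exact: cmeasurableD.
Qed.
Lemma cmeasurable_prod (I : Type) (s : seq I) (F : I -> Cfun R) :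
  (forall i, cmeasurable (F i)) -> cmeasurable (fun t => \prod_(i <- s) F i t).
Proof.
move=> mF; elim: s => [|i s IH].
  by under eq_fun do rewrite big_nil; exact: cmeasurable_cst.
by under eq_fun do rewrite big_cons; exact: cmeasurableM.
Qed.
Lemma cmeasurable_eit : cmeasurable (@eit R).
Proof.
split; apply: (@measurable_funS _ _ _ _ setT) => //.
  by apply: continuous_measurable_fun; exact: continuous_cos.
by apply: continuous_measurable_fun; exact: continuous_sin.
Qed.
Lemma cmeasurable_poly (p : {poly C}) : cmeasurable (fun t => p.[eit t]).
Proof.
under eq_fun do rewrite horner_coef.
apply: cmeasurable_sum => i; apply: cmeasurableM; first exact: cmeasurable_cst.
by apply: cmeasurableX; exact: cmeasurable_eit.
Qed.
Lemma measurable_cabs f : cmeasurable f ->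
  measurable_fun (@Tc R) (fun t => cabs (f t)).
Proof.
move=> [f1 f2]; rewrite /cabs.
have -> : (fun t => Num.sqrt (cRe (f t) ^+ 2 + cIm (f t) ^+ 2)) =
    (fun x => x `^ 2^-1) \o (fun t => cRe (f t) ^+ 2 + cIm (f t) ^+ 2).
  by apply/funext => t /=; rewrite powR12_sqrt// addr_ge0// sqr_ge0.
apply: measurableT_comp; first exact: measurable_powR.
by apply: measurable_funD; exact: measurable_funX.
Qed.

Definition cL1 f : Prop := rL1 (fun t => cRe (f t)) /\ rL1 (fun t => cIm (f t)).

Lemma cL1_measurable f : cL1 f -> cmeasurable f.
Proof. by move=> [/rL1_measurable ? /rL1_measurable ?]; split. Qed.

Lemma cL1_le f (g : R -> R) : cmeasurable f -> rL1 g ->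
  ae_T (fun t => cabs (f t) <= g t) -> cL1 f.
Proof.
move=> [f1 f2] gi fg; split.
  apply: (rL1_le f1 gi); apply: ae_T_sub fg => t; apply: le_trans.
  exact: normr_cRe.
apply: (rL1_le f2 gi); apply: ae_T_sub fg => t; apply: le_trans.
exact: normr_cIm.
Qed.

Lemma rL1_cabs f : cL1 f -> rL1 (fun t => cabs (f t)).
Proof.
move=> fi; have [f1 f2] := fi.
apply: (rL1_le (measurable_cabs (cL1_measurable fi))
  (rL1D (rL1_norm f1) (rL1_norm f2))).
by apply: ae_T_all => t _; rewrite ger0_norm ?cabs_ge0// cabs_le_ReIm.
Qed.

Lemma LpP p f :
  Lp p f <-> cmeasurable f /\ rL1 (fun t => cabs (f t) ^+ p).
Proof.
split=> -[mf h]; split=> //.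
  apply/integrableP; split.
    by apply/measurable_EFinP; apply: measurable_funX; exact: measurable_cabs.
  by under eq_integral do rewrite /= ger0_norm ?exprn_ge0 ?cabs_ge0//.
have /integrableP[_] := h.
by under eq_integral do rewrite /= ger0_norm ?exprn_ge0 ?cabs_ge0//.
Qed.

Lemma Lp1P f : Lp 1 f <-> cL1 f.
Proof.
split=> [/LpP[mf h]|fi]; last first.
  apply/LpP; split; first exact: cL1_measurable.
  by under eq_fun do rewrite expr1; exact: rL1_cabs.
by apply: (cL1_le mf h); apply: ae_T_all => t _; rewrite expr1.
Qed.

Lemma cL1_bounded f (M : R) : cmeasurable f ->
  ae_T (fun t => cabs (f t) <= M) -> cL1 f.
Proof. by move=> mf; apply: cL1_le => //; exact: rL1_cst. Qed.

Lemma cL1M_bounded h f (M : R) : cmeasurable h ->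
  ae_T (fun t => cabs (h t) <= M) -> cL1 f -> cL1 (fun t => h t * f t).
Proof.
move=> mh hM fi; apply: (@cL1_le _ (fun t => M * cabs (f t))).
- by apply: cmeasurableM => //; exact: cL1_measurable.
- by apply: rL1Z; exact: rL1_cabs.
- by apply: ae_T_sub hM => t hM; rewrite cabsM ler_wpM2r// cabs_ge0.
Qed.

Lemma cL1D f g : cL1 f -> cL1 g -> cL1 (fun t => f t + g t).
Proof.
move=> [f1 f2] [g1 g2]; split.
  by under eq_fun do rewrite cReD; exact: rL1D.
by under eq_fun do rewrite cImD; exact: rL1D.
Qed.
Lemma cL1N f : cL1 f -> cL1 (fun t => - f t).
Proof.
move=> [f1 f2]; split.
  by under eq_fun do rewrite cReN; exact: rL1N.
by under eq_fun do rewrite cImN; exact: rL1N.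
Qed.
Lemma cL1B f g : cL1 f -> cL1 g -> cL1 (fun t => f t - g t).
Proof. by move=> fi gi; apply: cL1D => //; exact: cL1N. Qed.
Lemma cL1Z c f : cL1 f -> cL1 (fun t => c * f t).
Proof.
apply: (@cL1M_bounded _ _ (cabs c)); first exact: cmeasurable_cst.
by apply: ae_T_all.
Qed.
Lemma cL1_cst c : cL1 (fun=> c : C).
Proof. by split; exact: rL1_cst. Qed.
Lemma cL1_conj f : cL1 f -> cL1 (fun t => cconj (f t)).
Proof. by move=> [f1 f2]; split => //=; exact: rL1N. Qed.
Lemma cL1_sum (I : Type) (s : seq I) (F : I -> Cfun R) :
  (forall i, cL1 (F i)) -> cL1 (fun t => \sum_(i <- s) F i t).
Proof.
move=> mF; elim: s => [|i s IH].
  by under eq_fun do rewrite big_nil; exact: cL1_cst.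
by under eq_fun do rewrite big_cons; exact: cL1D.
Qed.

Lemma cRe_cint f : cRe (cint f) = rint (fun t => cRe (f t)). Proof. by []. Qed.
Lemma cIm_cint f : cIm (cint f) = rint (fun t => cIm (f t)). Proof. by []. Qed.

Lemma cintD f g : cL1 f -> cL1 g ->
  cint (fun t => f t + g t) = cint f + cint g.
Proof.
move=> [f1 f2] [g1 g2]; apply: complex_ext.
  rewrite cReD !cRe_cint -rintD//; apply: rint_eq => t _; exact: cReD.
rewrite cImD !cIm_cint -rintD//; apply: rint_eq => t _; exact: cImD.
Qed.
Lemma cintZ c f : cL1 f -> cint (fun t => c * f t) = c * cint f.
Proof.
move=> [f1 f2]; apply: complex_ext.
  rewrite cReM !cRe_cint -!rintZ// -rintB; [|exact: rL1Z..].
  apply: rint_eq => t _; exact: cReM.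
rewrite cImM !cIm_cint -!rintZ// -rintD; [|exact: rL1Z..].
apply: rint_eq => t _; exact: cImM.
Qed.
Lemma cint_cst c : cint (fun=> c) = c * cR (pi *+ 2).
Proof.
have e (x : R) : Rintegral (@mu R) (@Tc R) (fun=> x) = x * (pi *+ 2).
  exact: rint_cst.
by apply: complex_ext; rewrite ?cReM ?cImM /= e; ring.
Qed.
Lemma cint_sum (I : Type) (s : seq I) (F : I -> Cfun R) :
  (forall i, cL1 (F i)) ->
  cint (fun t => \sum_(i <- s) F i t) = \sum_(i <- s) cint (F i).
Proof.
move=> mF; elim: s => [|i s IH].
  by under eq_fun do rewrite big_nil; rewrite cint_cst mul0r big_nil.
under eq_fun do rewrite big_cons; rewrite big_cons cintD ?IH//.
exact: cL1_sum.
Qed.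
Lemma cint_conj f : cL1 f -> cint (fun t => cconj (f t)) = cconj (cint f).
Proof.
move=> [f1 f2]; apply: complex_ext => //.
by rewrite cIm_cint rintN.
Qed.
Lemma cint_eq f g : (forall t, Tc t -> f t = g t) -> cint f = cint g.
Proof.
by move=> fg; apply: complex_ext; apply: rint_eq => t /fg ->.
Qed.
Lemma cint_ae f g : cmeasurable f -> cmeasurable g ->
  ae_T (fun t => f t = g t) -> cint f = cint g.
Proof.
move=> [f1 f2] [g1 g2] fg; apply: complex_ext; apply: rint_ae => //.
  by apply: ae_T_sub fg => t ->.
by apply: ae_T_sub fg => t ->.
Qed.
(** The factor 2 comes from treating real and imaginary parts separately. It is harmless: in
    [cabs_fourier] the normalisation 1 / (2 pi) absorbs it. *)
Lemma cabs_cint f : cL1 f -> cabs (cint f) <= 2 * rint (fun t => cabs (f t)).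
Proof.
move=> fi; have [f1 f2] := fi; have fa := rL1_cabs fi.
apply: (le_trans (cabs_le_ReIm _)); rewrite mulr2n mulrDl !mul1r.
apply: lerD.
  rewrite cRe_cint; apply: (le_trans (rint_norm f1)).
  apply: rint_le => //; first exact: rL1_norm.
  by apply: ae_T_all => t _; exact: normr_cRe.
rewrite cIm_cint; apply: (le_trans (rint_norm f2)).
apply: rint_le => //; first exact: rL1_norm.
by apply: ae_T_all => t _; exact: normr_cIm.
Qed.

(** The squared L^2 norm, without the factor 1 / (2 pi). Square roots never appear, because
    [amgm_sqr] takes the place of the Cauchy-Schwarz inequality. *)
Definition n2 f : R := rint (fun t => cabs (f t) ^+ 2).

Lemma n2_ge0 f : 0 <= n2 f.
Proof. by apply: rint_ge0 => t _; rewrite exprn_ge0// cabs_ge0. Qed.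

Lemma L2_measurable f : Lp 2 f -> cmeasurable f. Proof. by case. Qed.

Lemma L2_sqr f : Lp 2 f -> rL1 (fun t => cabs (f t) ^+ 2).
Proof. by move=> /LpP[]. Qed.

Lemma L2_le f (g : R -> R) : cmeasurable f -> rL1 g ->
  ae_T (fun t => cabs (f t) ^+ 2 <= g t) -> Lp 2 f.
Proof.
move=> mf gi fg; apply/LpP; split=> //.
apply: (rL1_le _ gi); first by apply: measurable_funX; exact: measurable_cabs.
by apply: ae_T_sub fg => t; rewrite ger0_norm// exprn_ge0// cabs_ge0.
Qed.

Lemma L2_bounded f (M : R) : cmeasurable f ->
  ae_T (fun t => cabs (f t) <= M) -> Lp 2 f.
Proof.
move=> mf fM; apply: (L2_le mf (rL1_cst (M ^+ 2))).
by apply: ae_T_sub fM => t h; rewrite lerXn2r// nnegrE ?cabs_ge0// (le_trans _ h)// cabs_ge0.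
Qed.

(** The weight e is free: a large e makes the second term small, and then the first one is small as
    soon as the norm of the first factor is. *)
Lemma amgm_sqr (a b e : R) : 0 < e -> a * b <= e * a ^+ 2 + e^-1 * b ^+ 2.
Proof.
move=> e0.
have -> : e * a ^+ 2 + e^-1 * b ^+ 2 = a * b + e^-1 * ((e * a - b / 2) ^+ 2 + 3 / 4 * b ^+ 2).
  by field; rewrite gt_eqF.
rewrite lerDl; apply: mulr_ge0; first by rewrite invr_ge0 ltW.
apply: addr_ge0; first exact: sqr_ge0.
by apply: mulr_ge0; [rewrite divr_ge0|exact: sqr_ge0].
Qed.

Lemma L2_mul f g : Lp 2 f -> Lp 2 g -> cL1 (fun t => f t * g t).
Proof.
move=> f2 g2; apply: (@cL1_le _ (fun t => cabs (f t) ^+ 2 + cabs (g t) ^+ 2)).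
- by apply: cmeasurableM; exact: L2_measurable.
- by apply: rL1D; exact: L2_sqr.
- apply: ae_T_all => t _; rewrite cabsM.
  by have := @amgm_sqr (cabs (f t)) (cabs (g t)) 1 ltr01; rewrite invr1 !mul1r.
Qed.

Lemma L2_cst c : Lp 2 (fun=> c : C).
Proof.
apply: (@L2_bounded _ (cabs c)); first exact: cmeasurable_cst.
by apply: ae_T_all.
Qed.

Lemma L2_cL1 f : Lp 2 f -> cL1 f.
Proof.
move=> f2; have := L2_mul f2 (L2_cst 1).
by under eq_fun do rewrite mulr1.
Qed.

Lemma L2D f g : Lp 2 f -> Lp 2 g -> Lp 2 (fun t => f t + g t).
Proof.
move=> f2 g2.
apply: (@L2_le _ (fun t => 2 * cabs (f t) ^+ 2 + 2 * cabs (g t) ^+ 2)).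
- by apply: cmeasurableD; exact: L2_measurable.
- by apply: rL1D; apply: rL1Z; exact: L2_sqr.
- apply: ae_T_all => t _; rewrite !cabs_sqr cReD cImD -subr_ge0.
  rewrite [X in 0 <= X](_ : _ = (cRe (f t) - cRe (g t)) ^+ 2 +
    (cIm (f t) - cIm (g t)) ^+ 2); last by ring.
  by rewrite addr_ge0// sqr_ge0.
Qed.

Lemma L2M_bounded h f (M : R) : cmeasurable h ->
  ae_T (fun t => cabs (h t) <= M) -> Lp 2 f -> Lp 2 (fun t => h t * f t).
Proof.
move=> mh hM f2; apply: (@L2_le _ (fun t => M ^+ 2 * cabs (f t) ^+ 2)).
- by apply: cmeasurableM => //; exact: L2_measurable.
- by apply: rL1Z; exact: L2_sqr.
- apply: ae_T_sub hM => t hM; rewrite cabsM exprMn ler_wpM2r ?sqr_ge0//.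
  by rewrite lerXn2r// nnegrE ?cabs_ge0// (le_trans _ hM)// cabs_ge0.
Qed.

Lemma L2Z c f : Lp 2 f -> Lp 2 (fun t => c * f t).
Proof.
apply: (@L2M_bounded _ _ (cabs c)); first exact: cmeasurable_cst.
by apply: ae_T_all.
Qed.
Lemma L2N f : Lp 2 f -> Lp 2 (fun t => - f t).
Proof. by move=> /(L2Z (-1)); under eq_fun do rewrite mulN1r. Qed.
Lemma L2B f g : Lp 2 f -> Lp 2 g -> Lp 2 (fun t => f t - g t).
Proof. by move=> f2 g2; apply: L2D => //; exact: L2N. Qed.
Lemma L2_conj f : Lp 2 f -> Lp 2 (fun t => cconj (f t)).
Proof.
move=> /LpP[mf h]; apply/LpP; split; first exact: cmeasurable_conj.
by under eq_fun do rewrite cabs_conj.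
Qed.

Lemma poly_bounded (p : {poly C}) : exists M : R, forall t, cabs p.[eit t] <= M.
Proof.
exists (\sum_(i < size p) cabs p`_i) => t; rewrite horner_coef.
apply: (le_trans (ler_cabs_sum _ _ _)); apply: ler_sum => i _.
by rewrite cabsM cabsX cabs_eit expr1n mulr1.
Qed.

Lemma L2_poly (p : {poly C}) : Lp 2 (fun t => p.[eit t]).
Proof.
have [M pM] := poly_bounded p.
apply: (@L2_bounded _ M); first exact: cmeasurable_poly.
by apply: ae_T_all.
Qed.

End ComplexIntegration.

(** * Fourier coefficients *)

Section Fourier.
Variable R : realType.
Local Notation C := R[i].
Implicit Types (f g h : Cfun R) (c : C) (k m : int).

Lemma cos_2pi_int k : cos (k%:~R * (pi *+ 2) : R) = 1 /\ sin (k%:~R * (pi *+ 2) : R) = 0.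
Proof.
have : eit (k%:~R * (pi *+ 2) : R) = 1.
  by rewrite eit_int /eit cos2pi sin2pi; exact: exp1rz.
by move=> [].
Qed.

Lemma is_derive_mulc (a x : R) : is_derive x (1:R) (fun t => a * t) a.
Proof.
have := @is_deriveZ R R R id a x 1 1 (is_derive_id _ _).
by rewrite /GRing.scale/= mulr1.
Qed.
Lemma is_derive_comp_mulc (F : R -> R) (a x d : R) : is_derive (a * x) (1:R) F d ->
  is_derive x (1:R) (fun t => F (a * t)) (a * d).
Proof.
move=> dF.
have := @is_derive1_comp R F (fun t => a * t) x _ _ dF (is_derive_mulc a x).
by rewrite /comp mulrC.
Qed.
Lemma is_derive_Zl (F : R -> R) (a x d : R) : is_derive x (1:R) F d ->
  is_derive x (1:R) (fun t => a * F t) (a * d).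
Proof.
by move=> dF; exact: (@is_deriveZ R R R F a x 1 d dF).
Qed.

Lemma rint_derive (F f : R -> R) : (forall x, is_derive x (1 : R) F (f x)) ->
  continuous f -> rint f = F (pi *+ 2) - F 0.
Proof.
move=> dF cf; rewrite /rint /Rintegral /Tc.
rewrite (@continuous_FTC2 _ f F 0 (pi *+ 2)) ?twopi_gt0//.
- exact: continuous_subspaceT.
- split; first by move=> x _; have [] := dF x.
  + by apply: cvg_at_right_filter; apply: differentiable_continuous;
      apply/derivable1_diffP; have [] := dF 0.
  + by apply: cvg_at_left_filter; apply: differentiable_continuous;
      apply/derivable1_diffP; have [] := dF (pi *+ 2).
- by move=> x _; rewrite derive1E; have [_ ->] := dF x.
Qed.

Lemma continuous_mulc (a : R) : continuous (fun x : R => a * x).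
Proof. by move=> x; apply: cvgMr; exact: cvg_id. Qed.

Lemma continuous_trig_mulc (F : R -> R) (a : R) : continuous F ->
  continuous (fun x => F (a * x)).
Proof.
move=> cF x; apply: (@continuous_comp _ _ _ (fun x => a * x) F).
  exact: continuous_mulc.
exact: cF.
Qed.

Lemma cint_eitX k : k != 0 -> cint (fun t => eit t ^ k : C) = 0.
Proof.
move=> k0; have k0' : k%:~R != 0 :> R by rewrite intr_eq0.
have [c1 s0] := cos_2pi_int k.
apply: complex_ext.
- rewrite cRe_cint (@rint_eq _ _ (fun t : R => cos (k%:~R * t))); last first.
    by move=> t _; rewrite -eit_int.
  have d (x : R) : is_derive x (1 : R) (fun t => k%:~R^-1 * sin (k%:~R * t))
      (cos (k%:~R * x)).
    rewrite -[X in is_derive _ _ _ X](mulKf k0').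
    by apply: is_derive_Zl; apply: is_derive_comp_mulc.
  rewrite (rint_derive d) ?s0 ?mulr0 ?sin0 ?mulr0 ?subrr//.
  exact: continuous_trig_mulc (@continuous_cos R).
- rewrite cIm_cint (@rint_eq _ _ (fun t : R => sin (k%:~R * t))); last first.
    by move=> t _; rewrite -eit_int.
  have d (x : R) : is_derive x (1 : R) (fun t => - k%:~R^-1 * cos (k%:~R * t))
      (sin (k%:~R * x)).
    rewrite [X in is_derive _ _ _ X](_ : _ = - k%:~R^-1 * (k%:~R * - sin (k%:~R * x))).
      by apply: is_derive_Zl; apply: is_derive_comp_mulc.
    by rewrite mulrN mulNr mulrN opprK mulKf.
  rewrite (rint_derive d) ?c1 ?mulr0 ?cos0 ?mulr1 ?subrr//.
  exact: continuous_trig_mulc (@continuous_sin R).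
Qed.

Lemma cmeasurable_eitX k : cmeasurable (fun t => eit t ^ k : C).
Proof. by apply: cmeasurableXz; exact: cmeasurable_eit. Qed.

Lemma cL1_eitX k f : cL1 f -> cL1 (fun t => eit t ^ k * f t).
Proof.
apply: (@cL1M_bounded _ _ _ 1); first exact: cmeasurable_eitX.
by apply: ae_T_all => t _; rewrite cabs_eitX.
Qed.

Lemma fourierE f k :
  fourier f k = cR (pi *+ 2)^-1 * cint (fun t => eit t ^ (- k) * f t).
Proof.
congr (_ * _); apply: cint_eq => t _.
by rewrite -mulNr -mulrNz eit_int mulrC.
Qed.

Lemma fourierD f g k : cL1 f -> cL1 g ->
  fourier (fun t => f t + g t) k = fourier f k + fourier g k.
Proof.
move=> fi gi; rewrite !fourierE -mulrDr -cintD; [|exact: cL1_eitX..].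
by congr (_ * _); apply: cint_eq => t _; rewrite mulrDr.
Qed.
Lemma fourierZ c f k : cL1 f -> fourier (fun t => c * f t) k = c * fourier f k.
Proof.
move=> fi; rewrite !fourierE mulrCA -(cintZ c); last exact: cL1_eitX.
by congr (_ * _); apply: cint_eq => t _; rewrite mulrCA.
Qed.
Lemma fourierN f k : cL1 f -> fourier (fun t => - f t) k = - fourier f k.
Proof.
move=> fi; rewrite -mulN1r -fourierZ//.
by under [in RHS]eq_fun do rewrite mulN1r.
Qed.
Lemma fourierB f g k : cL1 f -> cL1 g ->
  fourier (fun t => f t - g t) k = fourier f k - fourier g k.
Proof. by move=> fi gi; rewrite fourierD ?fourierN//; exact: cL1N. Qed.
Lemma fourier_sum (I : Type) (s : seq I) (F : I -> Cfun R) k :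
  (forall i, cL1 (F i)) ->
  fourier (fun t => \sum_(i <- s) F i t) k = \sum_(i <- s) fourier (F i) k.
Proof.
move=> mF; elim: s => [|i s IH].
  rewrite big_nil fourierE (@cint_eq _ _ (fun=> 0)) ?cint_cst ?mul0r ?mulr0//.
  by move=> t _; rewrite big_nil mulr0.
under eq_fun do rewrite big_cons; rewrite big_cons fourierD ?IH//.
exact: cL1_sum.
Qed.
Lemma fourier_ae f g k : cmeasurable f -> cmeasurable g ->
  ae_T (fun t => f t = g t) -> fourier f k = fourier g k.
Proof.
move=> mf mg fg; rewrite !fourierE; congr (_ * _).
apply: cint_ae; [by apply: cmeasurableM => //; exact: cmeasurable_eitX..|].
by apply: ae_T_sub fg => t ->.
Qed.
Lemma fourier_conj f k : cL1 f ->
  fourier (fun t => cconj (f t)) k = cconj (fourier f (- k)).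
Proof.
move=> fi; rewrite !fourierE cconjM cconj_cR -cint_conj; last exact: cL1_eitX.
congr (_ * _); apply: cint_eq => t _.
by rewrite opprK cconjM -!eit_int cconj_eit -mulNr -mulrNz.
Qed.
Lemma fourier_shift m f k :
  fourier (fun t => eit t ^ m * f t) k = fourier f (k - m).
Proof.
rewrite !fourierE; congr (_ * _); apply: cint_eq => t _.
by rewrite mulrA -expfzDr ?eit_neq0// opprB addrC.
Qed.
Lemma fourier_eitX m k : fourier (fun t => eit t ^ m : C) k = (m == k)%:R.
Proof.
rewrite fourierE (@cint_eq _ _ (fun t => eit t ^ (m - k))); last first.
  by move=> t _; rewrite -expfzDr ?eit_neq0// addrC.
have [->|mk] := eqVneq m k.
  rewrite (@cint_eq _ _ (fun=> 1)); last by move=> t _; rewrite subrr.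
  by rewrite cint_cst mul1r -cRM mulVf// twopi_neq0.
by rewrite cint_eitX ?mulr0// subr_eq0.
Qed.
Lemma fourier_polyM (p : {poly C}) f k : cL1 f ->
  fourier (fun t => p.[eit t] * f t) k =
  \sum_(i < size p) p`_i * fourier f (k - i%:Z).
Proof.
move=> fi.
rewrite (_ : (fun t => _) =
  (fun t => \sum_(i < size p) p`_i * (eit t ^ i%:Z * f t))); last first.
  apply/funext => t; rewrite horner_coef mulr_suml.
  by apply: eq_bigr => i _; rewrite mulrA.
rewrite fourier_sum; last by move=> i; apply: cL1Z; exact: cL1_eitX.
apply: eq_bigr => i _; rewrite fourierZ ?fourier_shift//; exact: cL1_eitX.
Qed.
Lemma fourier_poly (p : {poly C}) k :
  fourier (fun t => p.[eit t]) k = if k is Posz n then p`_n else 0.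
Proof.
have := @fourier_polyM p (fun=> 1) k (cL1_cst 1).
under eq_fun do rewrite mulr1; move=> ->.
have e (j : int) : fourier (fun=> 1) j = (0 == j)%:R :> C.
  by rewrite -(fourier_eitX 0 j).
under eq_bigr do rewrite e eq_sym subr_eq0.
case: k => n; last by rewrite big1// => i _; rewrite mulr0.
have [np|np] := ltnP n (size p).
  rewrite (bigD1 (Ordinal np))//= eqxx mulr1 big1 ?addr0// => i /eqP ni.
  case: eqP => [[ni']|]; last by rewrite mulr0.
  by case: ni; apply: val_inj.
rewrite nth_default// big1// => i _; case: eqP => [[ni]|]; last by rewrite mulr0.
by move: (ltn_ord i); rewrite -ni ltnNge np.
Qed.

Lemma cabs_fourier f k : cL1 f -> cabs (fourier f k) <= rint (fun t => cabs (f t)).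
Proof.
move=> fi; rewrite fourierE cabsM cabs_cR ger0_norm ?invr_ge0 ?twopi_ge0//.
have h := cabs_cint (cL1_eitX (- k) fi).
have e : rint (fun t => cabs (eit t ^ (- k) * f t)) = rint (fun t => cabs (f t)).
  by apply: rint_eq => t _; rewrite cabsM cabs_eitX mul1r.
rewrite e in h.
rewrite ler_pdivrMl ?twopi_gt0//; apply: (le_trans h); rewrite ler_wpM2r//.
  by apply: rint_ge0 => t _; exact: cabs_ge0.
by rewrite mulr2n lerD// (le_trans _ (pi_ge2 R))// ler1n.
Qed.

Lemma cabs_fourier_mul f g k e : Lp 2 f -> Lp 2 g -> 0 < e ->
  cabs (fourier (fun t => f t * g t) k) <= e * n2 f + e^-1 * n2 g.
Proof.
move=> f2 g2 e0; apply: (le_trans (cabs_fourier _ (L2_mul f2 g2))).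
have f1 := L2_sqr f2; have g1 := L2_sqr g2.
rewrite -!rintZ// -rintD; [|exact: rL1Z..].
apply: rint_le.
- by apply: rL1_cabs; exact: L2_mul.
- by apply: rL1D; exact: rL1Z.
- by apply: ae_T_all => t _; rewrite cabsM; exact: amgm_sqr.
Qed.

End Fourier.

(** * Fejer kernels and the density of trigonometric polynomials *)

Section Fejer.
Variable R : realType.
Local Notation C := R[i].
Implicit Types (s t x : R).

(** On the circle the real part of the l-th summand is the Dirichlet kernel of order l, so the real
    part of the sum is n times the Fejer kernel. Only analytic polynomials are needed in this
    form. *)
Definition fejer (n : nat) : {poly C} :=
  \sum_(l < n) (1 + \sum_(j < l) ('X^(j.+1) *+ 2)).

Lemma fejer_coef0 n : (fejer n)`_0 = n%:R.
Proof.
rewrite coef_sum (eq_bigr (fun=> 1)) ?big_const_ord ?iter_addr_0//.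
move=> l _; rewrite coefD coef1 coef_sum big1 ?addr0// => j _.
by rewrite coefMn coefXn mul0rn.
Qed.

Lemma fejer_coef1 n : (fejer n.+1)`_1 = n%:R *+ 2.
Proof.
rewrite coef_sum big_ord_recl /= big_ord0 addr0 coef1 add0r.
rewrite (eq_bigr (fun=> 2%:R)) => [|l _].
  by rewrite big_const_ord iter_addr_0 -!mulrnA mulnC.
rewrite coefD coef1 add0r coef_sum big_ord_recl coefMn coefXn /=.
by rewrite big1 ?addr0// => j _; rewrite coefMn coefXn /= mul0rn.
Qed.

Lemma cconj_sum (I : Type) (r : seq I) (F : I -> C) :
  cconj (\sum_(i <- r) F i) = \sum_(i <- r) cconj (F i).
Proof. by elim/big_rec2: _ => [|i x y _ <-]; rewrite ?cconj0 ?cconjD. Qed.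

Lemma fejer_Re n x :
  cRe (fejer n).[eit x] = cabs (\sum_(j < n) eit x ^+ j) ^+ 2.
Proof.
elim: n => [|n IH]; first by rewrite /fejer !big_ord0 horner0 cabs0 expr0n.
rewrite /fejer big_ord_recr /= -/(fejer n) hornerD cReD IH big_ord_recr /=.
rewrite cabs_sqrD -addrA; congr (_ + _).
rewrite cabsX cabs_eit !expr1n hornerD hornerC cReD horner_sum; congr (_ + _).
rewrite (eq_bigr (fun j : 'I_n => eit x ^+ j.+1 *+ 2)); last first.
  by move=> j _; rewrite hornerMn hornerXn.
rewrite sumrMnl.
(* The cross term of |S + z^n|^2 is 2 Re (S z^(-n)); conjugating S z^(-n) and reversing the sum
   gives the powers z, ..., z^n. *)
have <- : cconj ((\sum_(j < n) eit x ^+ j) * cconj (eit x ^+ n)) =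
    \sum_(j < n) eit x ^+ j.+1.
  rewrite cconjM cconjK mulrC [RHS](reindex_inj rev_ord_inj) /=.
  rewrite cconj_sum mulr_sumr; apply: eq_bigr => j _ /=.
  rewrite subnSK// cconjX cconj_eit eitN exprVn.
  have ej : eit x ^+ j != 0 by rewrite expf_neq0// eit_neq0.
  by apply: (mulIf ej); rewrite mulfVK// -exprD subnK// ltnW.
by rewrite !mulr2n cReD.
Qed.

Lemma cint_poly_eitB (p : {poly C}) t :
  cint (fun s => p.[eit (t - s)]) = p`_0 * cR (pi *+ 2).
Proof.
rewrite (_ : (fun s => _) =
   fun s => \sum_(j < size p) (p`_j * eit t ^+ j) * (eit s ^ (- j%:Z) * 1)).
  rewrite cint_sum; last by move=> j; apply/cL1Z/cL1_eitX/cL1_cst.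
  rewrite (eq_bigr (fun j : 'I_(size p) => p`_j * eit t ^+ j *
     (if j == 0%N :> nat then cR (pi *+ 2) else 0))); last first.
    move=> j _; rewrite cintZ; last by apply/cL1_eitX/cL1_cst.
    congr (_ * _); case: eqP => [->|/eqP j0].
      rewrite (@cint_eq _ _ (fun=> 1)) ?cint_cst ?mul1r// => s _.
      by rewrite oppr0 mulr1.
    under eq_fun do rewrite mulr1.
    by rewrite cint_eitX// oppr_eq0.
  have [->|p0] := eqVneq p 0; first by rewrite size_poly0 big_ord0 coef0 mul0r.
  have sp : (0 < size p)%N by rewrite size_poly_gt0.
  rewrite (bigD1 (Ordinal sp))//= expr0 mulr1 big1 ?addr0// => j.
  by rewrite -val_eqE /= => /negbTE ->; rewrite mulr0.
apply/funext => s; rewrite horner_coef; apply: eq_bigr => j _.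
by rewrite mulr1 eitD eitN exprMn mulrA exprVn -exprnN.
Qed.

End Fejer.

(** * Fejer means and Korovkin's estimate *)

Section Korovkin.
Variable R : realType.
Local Notation C := R[i].
Implicit Types (s t x : R) (p : {poly C}).

Lemma cL1_poly_eitB p t : cL1 (fun s => p.[eit (t - s)]).
Proof.
have [M pM] := poly_bounded p.
apply: (@cL1_bounded _ _ M); last by apply: ae_T_all => s _.
under eq_fun do rewrite horner_coef.
apply: cmeasurable_sum => i; apply: cmeasurableM; first exact: cmeasurable_cst.
apply: cmeasurableX; under eq_fun do rewrite eitD -cconj_eit.
apply: cmeasurableM; first exact: cmeasurable_cst.
by apply: cmeasurable_conj; exact: cmeasurable_eit.
Qed.

Lemma cRe_cRM x (z : C) : cRe (cR x * z) = x * cRe z.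
Proof. by rewrite cReM /= mul0r subr0. Qed.

Lemma cL1_mul_poly_eitB (b : R -> R) (M : R) p t :
  measurable_fun (@Tc R) b -> (forall s, Tc s -> `|b s| <= M) ->
  cL1 (fun s => cR (b s) * p.[eit (t - s)]).
Proof.
move=> mb bM; apply: (@cL1M_bounded _ _ _ M); last exact: cL1_poly_eitB.
  by split => //=.
by apply: ae_T_all => s Ts; rewrite cabs_cR bM.
Qed.

Lemma poly_drop1 p : exists2 v : {poly C}, p = v * 'X + (p`_0)%:P & v`_0 = p`_1.
Proof.
exists (drop_poly 1 p); last by rewrite coef_drop_poly.
rewrite -{1}(poly_take_drop 1 p) expr1 addrC; congr (_ + _).
by apply/polyP => -[|i]; rewrite coef_take_poly coefC.
Qed.

(** Only the coefficients of order 0 and 1 of the kernel survive. They are n + 1 and 2 n, so the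
    integral is 2 pi ((n + 1) - n), independently of n. *)
Lemma rint_fejer_cos n t :
  rint (fun s => (1 - cos (t - s)) * cRe (fejer R n.+1).[eit (t - s)]) = pi *+ 2.
Proof.
set W := fejer R n.+1.
have mcos : measurable_fun (@Tc R) (fun s => cos (t - s)).
  have [h _] : cmeasurable (fun s => ('X : {poly C}).[eit (t - s)]).
    by apply: cL1_measurable; exact: cL1_poly_eitB.
  by move: h; under eq_fun do rewrite hornerX.
have cosM s : Tc s -> `|cos (t - s)| <= 1 by move=> _; exact: cos_max.
have [i1 _] := cL1_poly_eitB W t.
have [i2 _] := cL1_mul_poly_eitB W t mcos cosM.
transitivity (rint (fun s => cRe W.[eit (t - s)] -
    cRe (cR (cos (t - s)) * W.[eit (t - s)]))).
  by apply: rint_eq => s _; rewrite cRe_cRM mulrBl mul1r.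
rewrite rintB// -cRe_cint cint_poly_eitB fejer_coef0.
have [V WV V0] := poly_drop1 W.
have iXW := cL1_poly_eitB ('X * W) t.
have iV := cL1_poly_eitB V t.
have iX := cL1_conj (cL1_poly_eitB 'X t).
have -> : rint (fun s => cRe (cR (cos (t - s)) * W.[eit (t - s)])) =
    cRe (cint (fun s => cR 2^-1 * (('X * W).[eit (t - s)] +
      (V.[eit (t - s)] + W`_0 * cconj 'X.[eit (t - s)])))).
  rewrite cRe_cint; apply: rint_eq => s _.
  (* On the circle conj(z) = 1 / z, so conj(z) W is the polynomial V plus the constant coefficient
     of W times conj(z). *)
  have -> : V.[eit (t - s)] + W`_0 * cconj 'X.[eit (t - s)] =
      cconj (eit (t - s)) * W.[eit (t - s)].
    rewrite {2}WV !hornerE mulrDr [X in _ = _ + X]mulrC; congr (_ + _).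
    by rewrite mulrCA [cconj _ * _]mulrC mulr_cconj cabs_eit expr1n mulr1.
  rewrite hornerM hornerX -mulrDl !cRe_cRM.
  set a := eit _; rewrite (_ : a + cconj a = cR (cos (t - s) *+ 2)).
    by rewrite cRe_cRM mulrnAl -[X in _ = _ * X]mulr_natl mulKf// pnatr_eq0.
  by apply: complex_ext; rewrite ?cReD ?cImD /= ?subrr ?mulr2n.
rewrite cintZ; last by apply: cL1D => //; apply: cL1D => //; exact: cL1Z.
rewrite cintD//; last by apply: cL1D => //; exact: cL1Z.
rewrite cintD//; last exact: cL1Z.
rewrite cintZ// cint_conj; last exact: cL1_poly_eitB.
rewrite !cint_poly_eitB coefXM coefX /= !mul0r cconj0 mulr0 addr0 add0r V0.
rewrite fejer_coef1 -(mulr_natr n%:R 2) -!cR_nat -!cRM /= -natr1.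
by field.
Qed.

Lemma rint_fejer n t :
  rint (fun s => cRe (fejer R n).[eit (t - s)]) = n%:R * (pi *+ 2).
Proof.
by rewrite -cRe_cint cint_poly_eitB fejer_coef0 -cR_nat cRe_cRM.
Qed.

(** For real c the negative frequencies are conjugate to the positive ones, so the Cesaro mean of c
    is the real part of this analytic polynomial. The weights are 1 for m = 0 and 2 (1 - m / n) for
    m > 0. *)
Definition fejer_mean (c : R -> R) (n : nat) : {poly C} :=
  \poly_(m < size (fejer R n))
    ((fejer R n)`_m * fourier (fun s => cR (c s)) m / n%:R).

Lemma cRe_fejer_mean (c : R -> R) (M : R) n t :
  measurable_fun (@Tc R) c -> (forall s, Tc s -> `|c s| <= M) ->
  cRe (fejer_mean c n).[eit t] =
  (n%:R * (pi *+ 2))^-1 * rint (fun s => c s * cRe (fejer R n).[eit (t - s)]).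
Proof.
move=> mc cM; set W := fejer R n.
have ic : cL1 (fun s => cR (c s)).
  apply: (@cL1_bounded _ _ M); first by split => //=.
  by apply: ae_T_all => s Ts; rewrite cabs_cR cM.
have -> : (fejer_mean c n).[eit t] = cR (n%:R * (pi *+ 2))^-1 *
    cint (fun s => cR (c s) * W.[eit (t - s)]).
  rewrite /fejer_mean horner_poly.
  rewrite (_ : (fun s => cR (c s) * _) = (fun s => \sum_(m < size W)
      (W`_m * eit t ^+ m) * (eit s ^ (- m%:Z) * cR (c s)))); last first.
    apply/funext => s; rewrite horner_coef mulr_sumr; apply: eq_bigr => m _.
    rewrite eitD eitN exprMn exprVn -exprnN; ring.
  rewrite cint_sum; last by move=> m; apply/cL1Z/cL1_eitX.
  rewrite mulr_sumr; apply: eq_bigr => m _.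
  rewrite cintZ; last exact/cL1_eitX.
  rewrite fourierE invfM cRM (cRV n%:R) cR_nat; ring.
rewrite cRe_cRM cRe_cint; congr (_ * _); apply: rint_eq => s _.
exact: cRe_cRM.
Qed.

(** A real constant coefficient makes the exponential of the polynomial positive at the origin;
    [H2_cexp_half] depends on this. *)
Lemma fejer_mean_real (c : R -> R) (M : R) n :
  measurable_fun (@Tc R) c -> (forall s, Tc s -> `|c s| <= M) ->
  cIm (fejer_mean c n)`_0 = 0.
Proof.
move=> mc cM; rewrite coef_poly; case: ifP => // _.
rewrite fejer_coef0 fourierE -cR_nat -cRV.
have -> : cint (fun t : R => eit t ^ (- 0%:Z) * cR (c t)) = cR (rint c).
  apply: complex_ext; rewrite ?cRe_cint ?cIm_cint.
    by apply: rint_eq => t _; rewrite oppr0 expr0z mul1r.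
  rewrite (@rint_eq _ _ (fun=> 0)) ?rint_cst ?mul0r// => t _.
  by rewrite oppr0 expr0z mul1r.
by rewrite -!cRM.
Qed.

(* Korovkin's argument: since the Fejer kernel has mean 1 and integrates
   [1 - cos] to [1 / n], the modulus-of-continuity hypothesis bounds the error
   by [e + D / n]. *)
Lemma fejer_mean_approx (c : R -> R) (M e D : R) :
  measurable_fun (@Tc R) c -> (forall s, Tc s -> `|c s| <= M) ->
  0 < e -> 0 <= D ->
  (forall s t, Tc s -> Tc t -> `|c s - c t| <= e + D * (1 - cos (t - s))) ->
  exists2 q : {poly C}, cIm q`_0 = 0 &
    forall t, Tc t -> `|cRe q.[eit t] - c t| <= e *+ 2.
Proof.
move=> mc cM e0 D0 cD.
(* With n + 1 >= D / e the error term D / (n + 1) is at most e, whence the final bound [e *+ 2]. *)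
pose n := Num.truncn (D / e).
have De : D <= e * n.+1%:R.
  by rewrite -ler_pdivrMl// mulrC ltW// truncnS_gt.
exists (fejer_mean c n.+1); first exact: fejer_mean_real cM.
move=> t Tt; rewrite (cRe_fejer_mean _ _ mc cM).
set W := fejer R n.+1; set N : R := n.+1%:R.
have N0 : 0 < N by rewrite ltr0n.
have NP : 0 < N * (pi *+ 2) by rewrite mulr_gt0// twopi_gt0.
have w0 s : 0 <= cRe W.[eit (t - s)].
  by rewrite fejer_Re exprn_ge0// cabs_ge0.
have [iW _] := cL1_poly_eitB W t.
have [icW _] := cL1_mul_poly_eitB W t mc cM.
have mcos : measurable_fun (@Tc R) (fun s => 1 - cos (t - s)).
  have [h _] : cmeasurable (fun s => (1 - 'X : {poly C}).[eit (t - s)]).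
    by apply: cL1_measurable; exact: cL1_poly_eitB.
  move: h; under eq_fun do rewrite !hornerE cReD cReN; exact.
have cosM s : Tc s -> `|1 - cos (t - s)| <= 2.
  by move=> _; rewrite (le_trans (ler_normB _ _))// normr1 -[2]/(1 + 1) lerD2l cos_max.
have [i1 _] := cL1_mul_poly_eitB W t mcos cosM.
have e1 : (fun s => cRe (cR (1 - cos (t - s)) * W.[eit (t - s)])) =
    (fun s => (1 - cos (t - s)) * cRe W.[eit (t - s)]).
  by apply/funext => s; rewrite cRe_cRM.
have e2 : (fun s => cRe (cR (c s) * W.[eit (t - s)])) =
    (fun s => c s * cRe W.[eit (t - s)]).
  by apply/funext => s; rewrite cRe_cRM.
rewrite e1 in i1; rewrite e2 in icW.
have ct : c t = (N * (pi *+ 2))^-1 * rint (fun s => c t * cRe W.[eit (t - s)]).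
  by rewrite rintZ// rint_fejer mulrCA mulVf ?mulr1// gt_eqF.
rewrite {1}ct -mulrBr -rintB//; last exact: rL1Z.
rewrite normrM normfV (gtr0_norm NP) ler_pdivrMl//.
apply: (@le_trans _ _ (rint (fun s => e * cRe W.[eit (t - s)] +
    D * ((1 - cos (t - s)) * cRe W.[eit (t - s)])))).
  apply: (le_trans (rint_norm _)); first by apply: rL1B => //; exact: rL1Z.
  apply: rint_le.
  - by apply: rL1_norm; apply: rL1B => //; exact: rL1Z.
  - by apply: rL1D; exact: rL1Z.
  - apply: ae_T_all => s Ts; rewrite -mulrBl normrM (ger0_norm (w0 s)).
    by rewrite mulrA -mulrDl ler_wpM2r// cD.
rewrite rintD; [|exact: rL1Z..].
rewrite !rintZ// rint_fejer rint_fejer_cos -/N.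
have := ler_wpM2r (twopi_ge0 R) De; rewrite -/N; lra.
Qed.

End Korovkin.

(** * Density of real trigonometric polynomials, with a uniform bound *)

Section RealTrigDensity.
Variable R : realType.
Local Notation C := R[i].
Implicit Types (s t x y K : R).

(** Truncation to the interval [-K, K] for K >= 0. Written with absolute values, it inherits
    measurability, continuity and the Lipschitz bound from the norm. *)
Definition clip K x : R := (`|x + K| - `|x - K|) / 2.

Lemma clip_bound K x : 0 <= K -> `|clip K x| <= K.
Proof.
move=> K0; rewrite /clip normrM [`|2^-1|]ger0_norm// ler_pdivrMr//.
apply: (le_trans (ler_dist_dist _ _)).
by rewrite opprB addrC addrA subrK ger0_norm ?addr_ge0// mulr_natr mulr2n.
Qed.

Lemma clip_id K x : `|x| <= K -> clip K x = x.
Proof.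
rewrite ler_norml => /andP[xK Kx]; rewrite /clip.
by rewrite ger0_norm ?ler0_norm; lra.
Qed.

Lemma clip_dist K x y : `|clip K x - clip K y| <= `|x - y|.
Proof.
rewrite /clip -mulrBl normrM [`|2^-1|]ger0_norm// ler_pdivrMr//.
have h1 := ler_dist_dist (x + K) (y + K).
have h2 := ler_dist_dist (y - K) (x - K).
rewrite (_ : _ - _ - _ = (`|x + K| - `|y + K|) + (`|y - K| - `|x - K|)); last by ring.
apply: (le_trans (ler_normD _ _)); rewrite mulr_natr mulr2n; apply: lerD.
  by apply: (le_trans h1); rewrite (_ : _ + _ - _ = x - y)//; ring.
by apply: (le_trans h2); rewrite distrC (_ : _ - _ - _ = x - y)//; ring.
Qed.

Lemma clip_norm K x : 0 <= K -> `|clip K x| <= `|x|.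
Proof.
move=> K0; have := clip_dist K x 0.
by rewrite [clip K 0]clip_id ?normr0// !subr0.
Qed.

Lemma measurable_clip K (f : R -> R) : measurable_fun (@Tc R) f ->
  measurable_fun (@Tc R) (fun t => clip K (f t)).
Proof.
move=> mf; apply: measurable_funM => //; apply: measurable_funB.
  by apply: measurableT_comp => //; exact: measurable_funD.
by apply: measurableT_comp => //; exact: measurable_funB.
Qed.

Lemma continuous_clip K (f : R -> R) : continuous f ->
  continuous (fun t => clip K (f t)).
Proof.
move=> cf t; rewrite /clip; apply: cvgMl; apply: cvgB.
  by apply: cvg_norm; apply: cvgD; [exact: cf|exact: cvg_cst].
by apply: cvg_norm; apply: cvgB; [exact: cf|exact: cvg_cst].
Qed.

Lemma cvg_clip x : (clip n%:R x) @[n --> \oo] --> x.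
Proof.
apply: cvg_near_cst; near=> n; apply: clip_id.
apply: ltW; near: n; exact: nbhs_infty_gtr.
Unshelve. all: by end_near. Qed.

Lemma cos_eq1 x : `|x| <= pi *+ 2 -> cos x = 1 -> x = 0 \/ `|x| = pi *+ 2.
Proof.
move=> x2 c1; have := pi_ge0 R => p0.
have [xp|xp] := lerP `|x| pi.
  left; apply/eqP; rewrite -normr_eq0; apply/eqP; apply: (@cos_inj R).
  - by rewrite in_itv /= xp normr_ge0.
  - by rewrite in_itv /= lexx p0.
  - by rewrite cos_norm c1 cos0.
right; apply/eqP; rewrite eq_sym -subr_eq0; apply/eqP; apply: (@cos_inj R).
- by rewrite in_itv /= subr_ge0 x2 /= mulr2n; move: xp; lra.
- by rewrite in_itv /= lexx p0.
- by rewrite cosB cos2pi sin2pi mul0r addr0 mul1r cos_norm c1 cos0.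
Qed.

Lemma Tc_dist s t : Tc s -> Tc t -> `|t - s| <= pi *+ 2.
Proof.
rewrite /Tc /= !in_itv /= => /andP[s0 s1] /andP[t0 t1].
by rewrite ler_norml; lra.
Qed.

(** Where cos (t - s) = 1, either s = t or s and t are the two endpoints; periodicity then gives c s
    = c t, and nearby the difference stays below e. Away from these pairs 1 - cos is bounded below,
    so a large D wins. *)
Lemma periodic_modulus (c : R -> R) (K e : R) : continuous c ->
  c 0 = c (pi *+ 2) -> (forall t, `|c t| <= K) -> 0 < e ->
  exists2 D, 0 <= D &
  forall s t, Tc s -> Tc t -> `|c s - c t| <= e + D * (1 - cos (t - s)).
Proof.
move=> cc c02 cK e0.
have cpt : compact (@Tc R `*` @Tc R).
  by apply: compact_setX; exact: segment_compact.
move/compact_near_coveringP : cpt.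
(* The covering form of compactness, with D tending to infinity as the parameter, produces one D for
   all pairs. *)
move=> /(_ R (pinfty_nbhs R)
  (fun D (p : R * R) => `|c p.1 - c p.2| <= e + D * (1 - cos (p.2 - p.1))) _).
case.
  move=> [s t] [/= Ts Tt].
  have [c1|c1] := eqVneq (cos (t - s)) 1.
    have cst : c s = c t.
      have [/eqP|] := cos_eq1 (Tc_dist Ts Tt) c1.
        by rewrite subr_eq0 => /eqP ->.
      move: Ts Tt; rewrite /Tc /= !in_itv /= => /andP[s0 s1] /andP[t0 t1].
      have [ts|ts] := lerP 0 (t - s).
        rewrite ger0_norm// => h; have -> : s = 0 by lra.
        by have -> : t = pi *+ 2 by lra.
      rewrite ltr0_norm// => h; have -> : t = 0 by lra.
      by have -> : s = pi *+ 2 by lra.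
    exists ([set p : R * R | `|c p.1 - c p.2| <= e], [set D | 0 <= D]) => /=.
      split; last exact: nbhs_pinfty_ge.
      have h : (fun p : R * R => c p.1 - c p.2) p @[p --> (s, t)] --> (0 : R).
        rewrite -[X in _ --> X](subrr (c t)) -{1}cst; apply: cvgB.
          by apply: cvg_comp; [exact: cvg_fst|exact: cc].
        by apply: cvg_comp; [exact: cvg_snd|exact: cc].
      exact: (cvgr0_norm_le _ h e e0).
    move=> [p D] [/= pe D0]; apply: (le_trans pe).
    by rewrite lerDl mulr_ge0// subr_ge0 cos_le1.
  have K0 : 0 <= K by exact: le_trans (normr_ge0 _) (cK 0).
  pose d := 1 - cos (t - s).
  have d0 : 0 < d by rewrite subr_gt0 lt_neqAle c1 cos_le1.
  (* On this neighbourhood D >= 4 K / d gives D (1 - cos) >= 2 K, which dominates any difference of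
     values of c. *)
  exists ([set p : R * R | d / 2 < 1 - cos (p.2 - p.1)],
    [set D | K * 4 / d <= D]) => /=.
    split; last by apply: nbhs_pinfty_ge; rewrite num_real.
    have h : (fun p : R * R => 1 - cos (p.2 - p.1)) p @[p --> (s, t)] --> d.
      apply: cvgB; first exact: cvg_cst.
      apply: (@cvg_comp _ _ _ (fun p : R * R => p.2 - p.1) cos _ (nbhs (t - s : R))).
        by apply: cvgB; [exact: cvg_snd|exact: cvg_fst].
      exact: continuous_cos.
    by apply: (cvgr_gt _ h); rewrite ltr_pdivrMr// mulr_natr mulr2n ltrDl.
  move=> [[s' t'] D] [/= h1 h2].
  have h3 : `|c s' - c t'| <= K + K.
    by rewrite (le_trans (ler_normB _ _))// lerD.
  apply: (le_trans h3).
  have h4 : K * 4 / d * (d / 2) <= D * (1 - cos (t' - s')).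
    apply: ler_pM => //; last exact: ltW.
      by rewrite divr_ge0 ?mulr_ge0// ltW.
    by rewrite divr_ge0// ltW.
  have -> : K + K = K * 4 / d * (d / 2) by field; rewrite gt_eqF.
  by rewrite (le_trans h4)// lerDr ltW.
move=> D0 [_ h]; pose D := Num.max (D0 + 1) 0.
exists D; first by rewrite le_max lexx orbT.
move=> s t Ts Tt; apply: (h D _ (s, t)) => //.
by rewrite lt_max ltrDl ltr01.
Qed.

Lemma cvg_expr_1Dcos t : Tc t -> t <> 0 -> t <> pi *+ 2 ->
  (((1 + cos t) / 2) ^+ n) @[n --> \oo] --> (0 : R).
Proof.
move=> Tt t0 t2; apply: cvg_expr.
have T0 : Tc (0 : R) by rewrite /Tc /= in_itv /= lexx twopi_ge0.
have c1 : cos t != 1.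
  apply/eqP => c1; have := Tc_dist T0 Tt; rewrite subr0 => h.
  case: (cos_eq1 h c1) => // h2; apply: t2; rewrite -h2 ger0_norm//.
  by move: Tt; rewrite /Tc /= in_itv /= => /andP[].
have : cos t < 1 by rewrite lt_neqAle c1 cos_le1.
have := cos_geN1 t => h1 h2.
by rewrite ger0_norm; lra.
Qed.

Lemma measurable_1Dcos n :
  measurable_fun (@Tc R) (fun t => ((1 + cos t) / 2) ^+ n).
Proof.
apply: measurable_funX; apply: measurable_funM => //; apply: measurable_funD => //.
by have [] := cmeasurable_eit R.
Qed.

Lemma expr_1Dcos_ge0 n t : 0 <= ((1 + cos t) / 2) ^+ n.
Proof. by apply: exprn_ge0; have := cos_geN1 t; lra. Qed.
Lemma expr_1Dcos_le1 n t : ((1 + cos t) / 2) ^+ n <= 1.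
Proof.
by apply: exprn_ile1; have := cos_geN1 t; have := cos_le1 t; lra.
Qed.

Lemma cvg_eps (u : nat -> R) (l e : R) : u n @[n --> \oo] --> l -> 0 < e ->
  exists n, `|u n - l| <= e.
Proof.
move=> ul e0; have := cvgr_dist_le _ _ ul _ e0; move=> [n _ h].
by exists n; rewrite distrC; apply: h => /=.
Qed.

Lemma cvg_eps2 (u v : nat -> R) (l m e : R) : u n @[n --> \oo] --> l ->
  v n @[n --> \oo] --> m -> 0 < e ->
  exists n, `|u n - l| <= e /\ `|v n - m| <= e.
Proof.
move=> ul vm e0; have [n _ h] := cvgr_dist_le _ _ ul _ e0.
have [k _ h'] := cvgr_dist_le _ _ vm _ e0; exists (maxn n k); split.
  by rewrite distrC; apply: h => /=; rewrite leq_maxl.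
by rewrite distrC; apply: h' => /=; rewrite leq_maxr.
Qed.

(** Closeness in L^1 and the uniform bound are needed together: the bound later upgrades the
    estimate to L^2 and to exponentials. *)
Lemma real_trig_dense (v : R -> R) (K e : R) : measurable_fun (@Tc R) v ->
  (forall t, Tc t -> `|v t| <= K) -> 0 <= K -> 0 < e ->
  exists q : {poly C}, [/\ cIm q`_0 = 0,
    forall t, Tc t -> `|cRe q.[eit t]| <= K + 1 &
    rint (fun t => `|cRe q.[eit t] - v t|) <= e].
Proof.
move=> mv vK K0 e0.
have vi : rL1 v by apply: (rL1_bounded mv); apply: ae_T_all => t; exact: vK.
have e4 : 0 < e / 4 by rewrite divr_gt0.
have [g [cg gi gle]] : exists g : R -> R, [/\ continuous g, rL1 g &
    rint (fun t => `|v t - g t|) <= e / 4].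
  have [g_ [cg gi gv]] :=
    approximation_continuous_integrable (@measurable_Tc R) (@mu_Tc_lty R) vi.
  have di n : rL1 (fun t => `|v t - g_ n t|).
    by apply: rL1_norm; apply: rL1B => //; exact: gi.
  have {}gv : rint (fun t => `|v t - g_ n t|) @[n --> \oo] --> 0.
    apply: fine_cvg; move: gv; apply: cvg_trans; apply: near_eq_cvg; near=> n.
    by rewrite rint_fin//; exact: di.
  have [n] := cvg_eps gv e4; rewrite subr0 ger0_norm; last by apply: rint_ge0.
  by move=> h; exists (g_ n); split => //; exact: gi.
(* This weight is 1 at both endpoints and tends to 0 in between. The factor 1 - w m makes the
   continuous approximant vanish at 0 and 2 pi, hence periodic, at a small cost in L^1. *)
pose w n (t : R) := ((1 + cos t) / 2) ^+ n.
have [m mle] : exists m, K * rint (w m) <= e / 4.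
  have : rint (w n) @[n --> \oo] --> (0 : R).
    rewrite -[X in _ --> X](_ : rint (fun=> 0) = 0); last by rewrite rint_cst mul0r.
    apply: (@rint_dominated _ _ _ (fun=> 1)) => //.
    - by move=> n; exact: measurable_1Dcos.
    - exact: rL1_cst.
    - by move=> n t _; rewrite ger0_norm ?expr_1Dcos_ge0// expr_1Dcos_le1.
    - have h0 := @ae_T_neq R 0; have h2 := @ae_T_neq R (pi *+ 2).
      have hT : ae_T (@Tc R) by exact: ae_T_all.
      by apply: ae_T_sub3 hT h0 h2 => t; exact: cvg_expr_1Dcos.
  have K1 : 0 < e / 4 / (K + 1) by rewrite divr_gt0// ltr_wpDl.
  move=> /cvg_eps /(_ K1)[n]; rewrite subr0 ger0_norm; last first.
    by apply: rint_ge0 => t _; exact: expr_1Dcos_ge0.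
  rewrite ler_pdivlMr ?ltr_wpDl// => h; exists n; rewrite mulrC.
  apply: le_trans h; rewrite ler_wpM2l ?lerDl//.
  by apply: rint_ge0 => t _; exact: expr_1Dcos_ge0.
pose c t := clip K (g t) * (1 - w m t).
have w01 t : 0 <= 1 - w m t <= 1.
  by rewrite subr_ge0 expr_1Dcos_le1 lerBlDr lerDl expr_1Dcos_ge0.
have cc : continuous c.
  move=> t; apply: cvgM; first exact: continuous_clip.
  apply: cvgB; first exact: cvg_cst.
  have := @exprn_continuous R m.
  move=> /(_ ((1 + cos t) / 2)) h.
  apply: (@cvg_comp _ _ _ (fun t : R => (1 + cos t) / 2) (fun x => x ^+ m) _ (nbhs ((1 + cos t) / 2)) _ _ h).
  apply: cvgMl; apply: cvgD; first exact: cvg_cst.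
  exact: continuous_cos.
have cK t : `|c t| <= K.
  rewrite normrM -[leRHS]mulr1; apply: ler_pM => //; first exact: clip_bound.
  by have /andP[h1 h2] := w01 t; rewrite ger0_norm.
have c02 : c 0 = c (pi *+ 2).
  by rewrite /c /w cos0 cos2pi divff// expr1n subrr !mulr0.
(* The uniform error 2 d must be at most 1 for the bound K + 1, and its integral 2 d (2 pi) at most
   e / 4. *)
pose d := Num.min (2^-1) (e / (pi *+ 2 * 8)).
have d0 : 0 < d.
  by rewrite lt_min invr_gt0 ltr0n /= divr_gt0// mulr_gt0// twopi_gt0.
have [D D0 hD] := periodic_modulus cc c02 cK d0.
have mc : measurable_fun (@Tc R) c.
  by apply: (@measurable_funS _ _ _ _ setT) => //; exact: continuous_measurable_fun.
have [q q0 qc] := fejer_mean_approx mc (fun t _ => cK t) d0 D0 hD.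
have d2 : d *+ 2 <= 1.
  by have : d <= 2^-1 by [rewrite ge_min lexx]; lra.
have d3 : d *+ 2 * (pi *+ 2) <= e / 4.
  have : d <= e / (pi *+ 2 * 8) by rewrite ge_min lexx orbT.
  by rewrite ler_pdivlMr ?mulr_gt0 ?twopi_gt0//; lra.
exists q; split => //.
  move=> t Tt; rewrite -(subrK (c t) (cRe _)).
  rewrite (le_trans (ler_normD _ _))// addrC lerD//.
  exact: le_trans (qc t Tt) d2.
have wi : rL1 (w m).
  apply: (@rL1_bounded _ _ 1); first exact: measurable_1Dcos.
  by apply: ae_T_all => t _; rewrite ger0_norm ?expr_1Dcos_ge0// expr_1Dcos_le1.
have qi : rL1 (fun t => cRe q.[eit t]) by have [] := L2_cL1 (L2_poly q).
have vgi : rL1 (fun t => `|v t - g t|) by apply: rL1_norm; exact: rL1B.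
apply: (@le_trans _ _ (rint (fun t => d *+ 2 + (`|v t - g t| + K * w m t)))).
  apply: rint_le.
  - by apply: rL1_norm; exact: rL1B.
  - by apply: rL1D; [exact: rL1_cst|apply: rL1D => //; exact: rL1Z].
  apply: ae_T_all => t Tt; rewrite -(subrKA (c t)).
  rewrite (le_trans (ler_normD _ _))// lerD ?qc//.
  (* Since |v| <= K, v is its own truncation, so the Lipschitz bound of [clip] compares it with
     g. *)
  rewrite (_ : c t - v t = (clip K (g t) - clip K (v t)) * (1 - w m t) - v t * w m t); last first.
    by rewrite /c [clip K (v t)]clip_id ?vK//; ring.
  rewrite (le_trans (ler_normB _ _))// lerD//.
    have /andP[h1 h2] := w01 t.
    rewrite normrM (ger0_norm h1) -[leRHS]mulr1; apply: ler_pM => //.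
    by rewrite distrC clip_dist.
  by rewrite normrM ler_pM ?vK// ger0_norm ?expr_1Dcos_ge0.
rewrite rintD; [|exact: rL1_cst|apply: rL1D => //; exact: rL1Z].
rewrite rint_cst rintD//; last exact: rL1Z.
by rewrite rintZ//; lra.
Unshelve. all: by end_near. Qed.

End RealTrigDensity.

(** * Products of Hardy functions *)

Section HardyProducts.
Variable R : realType.
Local Notation C := R[i].
Implicit Types (f g h F G : Cfun R) (c : C) (k m : int) (e : R).

Lemma cabs_le_eps (z : C) : (forall e, 0 < e -> cabs z <= e) -> z = 0.
Proof.
move=> h; apply: cabs0_eq0; apply/eqP; rewrite eq_le cabs_ge0 andbT.
by apply/ler_addgt0Pl => e e0; rewrite addr0 h.
Qed.

Lemma sqrD_le (x y : R) : (x + y) ^+ 2 <= 2 * x ^+ 2 + 2 * y ^+ 2.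
Proof.
rewrite -subr_ge0 (_ : _ - _ = (x - y) ^+ 2) ?sqr_ge0//; ring.
Qed.

(** After truncation at K, the difference d of the approximant and the truncated function satisfies
    |d| <= 2 K + 1, so d^2 <= (2 K + 1) |d| and L^1 density gives L^2 density. *)
Lemma real_trig_dense_sqr (a : R -> R) e : measurable_fun (@Tc R) a ->
  rL1 (fun t => a t ^+ 2) -> 0 < e ->
  exists q : {poly C}, rL1 (fun t => (cRe q.[eit t] - a t) ^+ 2) /\
    rint (fun t => (cRe q.[eit t] - a t) ^+ 2) <= e.
Proof.
move=> ma ai e0.
have dn n t : (clip n%:R (a t) - a t) ^+ 2 <= 4 * a t ^+ 2.
  rewrite -real_normK ?num_real// -[a t ^+ 2]real_normK ?num_real//.
  rewrite -[4](_ : 2 ^+ 2 = _) -?exprMn; last by ring.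
  rewrite ler_sqr ?nnegrE ?mulr_ge0// (le_trans (ler_normB _ _))//.
  by rewrite mulr2n mulrDl mul1r lerD// clip_norm.
have mn (n : nat) : measurable_fun (@Tc R) (fun t => (clip n%:R (a t) - a t) ^+ 2).
  by apply: measurable_funX; apply: measurable_funB => //; exact: measurable_clip.
have : rint (fun t => (clip n%:R (a t) - a t) ^+ 2) @[n --> \oo] --> (0 : R).
  rewrite -[X in _ --> X](_ : rint (fun=> 0) = 0); last by rewrite rint_cst mul0r.
  apply: (@rint_dominated _ _ _ (fun t => 4 * a t ^+ 2)) => //.
  - exact: rL1Z.
  - by move=> n t _; rewrite ger0_norm ?sqr_ge0.
  - apply: ae_T_all => t _; rewrite -[X in _ --> X](expr0n _ 2).
    apply: (@cvg_comp _ _ _ (fun n : nat => clip n%:R (a t) - a t) (fun x => x ^+ 2) _ (nbhs (0 : R))).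
      by rewrite -(subrr (a t)); apply: cvgB; [exact: cvg_clip|exact: cvg_cst].
    exact: exprn_continuous.
have e4 : 0 < e / 4 by rewrite divr_gt0.
move=> /cvg_eps /(_ e4)[n]; rewrite subr0 ger0_norm; last first.
  by apply: rint_ge0 => t _; exact: sqr_ge0.
move=> h; set K : R := n%:R; have K0 : 0 <= K by rewrite ler0n.
have K1 : 0 < K *+ 2 + 1 by rewrite ltr_wpDl// mulrn_wge0.
have mc := measurable_clip K ma.
have [||q [_ qK qe]] := real_trig_dense (e := e / 4 / (K *+ 2 + 1)) mc _ K0 _.
  by move=> t _; exact: clip_bound.
  by rewrite divr_gt0.
have mq : measurable_fun (@Tc R) (fun t => cRe q.[eit t]).
  by have [] := cmeasurable_poly q.
have ci : rL1 (fun t => clip K (a t)).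
  by apply: (@rL1_bounded _ _ K) => //; apply: ae_T_all => t _; exact: clip_bound.
have i1 : rL1 (fun t => (clip K (a t) - a t) ^+ 2).
  apply: (@rL1_le _ _ (fun t => 4 * a t ^+ 2)); [exact: mn|exact: rL1Z|].
  by apply: ae_T_all => t _; rewrite ger0_norm ?sqr_ge0//; exact: dn.
have i2 : rL1 (fun t => `|cRe q.[eit t] - clip K (a t)|).
  by apply: rL1_norm; apply: rL1B => //; have [] := L2_cL1 (L2_poly q).
pose b t := 2 * ((K *+ 2 + 1) * `|cRe q.[eit t] - clip K (a t)|) +
   2 * (clip K (a t) - a t) ^+ 2.
have bi : rL1 b by exact: (rL1D (rL1Z _ (rL1Z _ i2)) (rL1Z _ i1)).
have qb t : Tc t -> (cRe q.[eit t] - a t) ^+ 2 <= b t.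
  move=> Tt; rewrite -(subrKA (clip K (a t))) (le_trans (sqrD_le _ _))// lerD2r.
  rewrite ler_pM2l// -real_normK ?num_real// expr2 ler_wpM2r//.
  rewrite (le_trans (ler_normB _ _))// (_ : K *+ 2 + 1 = K + 1 + K); last by ring.
  by rewrite lerD// ?qK// clip_bound.
have qi : rL1 (fun t => (cRe q.[eit t] - a t) ^+ 2).
  apply: (@rL1_le _ _ b) => //.
    by apply: measurable_funX; exact: measurable_funB.
  by apply: ae_T_all => t Tt; rewrite ger0_norm ?sqr_ge0// qb.
exists q; split => //.
apply: (@le_trans _ _ (rint b)); first by apply: rint_le => //; exact: ae_T_all.
rewrite (rintD (rL1Z _ (rL1Z _ i2)) (rL1Z _ i1)).
rewrite (rintZ _ (rL1Z _ i2)) !rintZ//.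
move: qe; rewrite ler_pdivlMr// mulrC => qe.
by move: h; rewrite -/K; lra.
Qed.

Lemma L2_trig_dense f e : Lp 2 f -> 0 < e -> exists A B : {poly C}, B`_0 = 0 /\
  n2 (fun t => f t - (A.[eit t] + cconj B.[eit t])) <= e.
Proof.
move=> f2 e0; have [m1 m2] := L2_measurable f2.
have e2 : 0 < e / 2 by rewrite divr_gt0.
have i1 : rL1 (fun t => cRe (f t) ^+ 2).
  apply: (rL1_le _ (L2_sqr f2)); first exact: measurable_funX.
  by apply: ae_T_all => t _; rewrite ger0_norm ?sqr_ge0// cabs_sqr lerDl sqr_ge0.
have i2 : rL1 (fun t => cIm (f t) ^+ 2).
  apply: (rL1_le _ (L2_sqr f2)); first exact: measurable_funX.
  by apply: ae_T_all => t _; rewrite ger0_norm ?sqr_ge0// cabs_sqr lerDr sqr_ge0.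
have [q1 [j1 q1e]] := real_trig_dense_sqr m1 i1 e2.
have [q2 [j2 q2e]] := real_trig_dense_sqr m2 i2 e2.
(* Re q1 + i Re q2 = (q1 + i q2) / 2 + conj((q1 - i q2) / 2). The constant of the second polynomial
   is then moved into the first. *)
pose iu : C := cmk 0 1; pose h : C := cR 2^-1.
pose A0 := h *: (q1 + iu *: q2); pose B0 := h *: (q1 - iu *: q2).
exists (A0 + (cconj B0`_0)%:P), (B0 - (B0`_0)%:P); split.
  by rewrite coefB coefC subrr.
have -> : n2 (fun t => f t - ((A0 + (cconj B0`_0)%:P).[eit t] +
    cconj (B0 - (B0`_0)%:P).[eit t])) =
    rint (fun t => (cRe q1.[eit t] - cRe (f t)) ^+ 2 +
                   (cRe q2.[eit t] - cIm (f t)) ^+ 2).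
  apply: rint_eq => t _.
  rewrite hornerD hornerC hornerD hornerN hornerC cconjB.
  rewrite (_ : _ + _ + _ = A0.[eit t] + cconj B0.[eit t]); last by ring.
  rewrite /A0 /B0 !hornerE cabs_sqr.
  case: (q1.[eit t]) => a b; case: (q2.[eit t]) => c d; case: (f t) => u v /=.
  by field.
by rewrite rintD//; lra.
Qed.

Lemma fourier_mul_small G e : 0 < e -> exists2 d, 0 < d & forall f k,
  Lp 2 G -> Lp 2 f -> n2 f <= d -> cabs (fourier (fun t => f t * G t) k) <= e.
Proof.
move=> e0; have n0 := n2_ge0 G.
(* The weight in [amgm_sqr]: the term with [n2 G] becomes at most e / 2, and d is chosen to make the
   other one so. The bound is thus uniform in f and k. *)
pose b := (2 * (n2 G + 1)) / e.
have n1 : 0 < n2 G + 1 by apply: ltr_wpDl.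
have b0 : 0 < b by apply: divr_gt0 => //; exact: mulr_gt0.
exists (e / 2 / b); first by apply: divr_gt0 => //; exact: divr_gt0.
move=> f k G2 f2 fd; apply: (le_trans (cabs_fourier_mul k f2 G2 b0)).
have h1 : b * n2 f <= e / 2 by rewrite -ler_pdivlMl// mulrC.
have h2 : b^-1 * n2 G <= e / 2.
  rewrite ler_pdivrMl// /b (_ : _ * (e / 2) = n2 G + 1) ?lerDl//.
  by field; rewrite gt_eqF.
lra.
Qed.

Lemma Hp_L2 F : Hp 2 F -> Lp 2 F. Proof. by case. Qed.

(** Pythagoras: F - A is analytic and conj(B) has only negative frequencies, so they are orthogonal
    and dropping conj(B) does not increase the distance. *)
Lemma n2_orth F (A B : {poly C}) : Hp 2 F -> B`_0 = 0 ->
  n2 (fun t => F t - A.[eit t]) <=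
  n2 (fun t => F t - (A.[eit t] + cconj B.[eit t])).
Proof.
move=> [F2 F0] B0.
have d2 : Lp 2 (fun t => F t - A.[eit t]) by apply: L2B => //; exact: L2_poly.
have B2 := L2_poly B.
have p1 : cL1 (fun t => B.[eit t] * (F t - A.[eit t])) by exact: L2_mul.
have z : cint (fun t => B.[eit t] * (F t - A.[eit t])) = 0.
  have : fourier (fun t => B.[eit t] * (F t - A.[eit t])) 0 = 0.
    rewrite fourier_polyM; last exact: L2_cL1.
    apply: big1 => -[[|i] ib] _ /=; first by rewrite B0 mul0r.
    rewrite sub0r fourierB; [|exact: L2_cL1..|exact/L2_cL1/L2_poly].
    by rewrite F0// fourier_poly subrr mulr0.
  rewrite fourierE => /eqP; rewrite mulf_eq0 => /orP[|/eqP h].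
    by move=> /eqP [] /eqP; rewrite invr_eq0 (negbTE (twopi_neq0 R)).
  by rewrite -h; apply: cint_eq => t _; rewrite oppr0 expr0z mul1r.
have e : n2 (fun t => F t - (A.[eit t] + cconj B.[eit t])) =
    rint (fun t => cabs (F t - A.[eit t]) ^+ 2 + cabs B.[eit t] ^+ 2 +
      (-2) * cRe (B.[eit t] * (F t - A.[eit t]))).
  apply: rint_eq => t _; rewrite opprD addrA cabs_sqrB cabs_conj cconjK.
  by rewrite [_ * B.[_]]mulrC mulNr mulr_natl.
have [r1 _] := p1; have [r2 r3] := (L2_sqr d2, L2_sqr B2).
rewrite e rintD; [|exact: rL1D|exact: rL1Z].
by rewrite rintD// rintZ// -cRe_cint z mulr0 addr0 lerDl n2_ge0.
Qed.

Lemma H2_poly_dense F e : Hp 2 F -> 0 < e ->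
  exists A : {poly C}, n2 (fun t => F t - A.[eit t]) <= e.
Proof.
move=> FH e0; have [A [B [B0 h]]] := L2_trig_dense (Hp_L2 FH) e0.
by exists A; apply: le_trans h; exact: n2_orth.
Qed.

(** Beyond the degrees of an approximating trigonometric polynomial, the coefficients are those of
    the small remainder. *)
Lemma riemann_lebesgue f e : Lp 2 f -> 0 < e ->
  exists n : nat, forall k, (n <= `|k|)%N -> cabs (fourier f k) <= e.
Proof.
move=> f2 e0.
have [d d0 h] := @fourier_mul_small (fun=> 1) e e0.
have [A [B [B0 AB]]] := L2_trig_dense f2 d0.
have T1 : cL1 (fun t => A.[eit t] + cconj B.[eit t]).
  by apply: cL1D; [exact/L2_cL1/L2_poly|exact/cL1_conj/L2_cL1/L2_poly].
have T2 : Lp 2 (fun t => f t - (A.[eit t] + cconj B.[eit t])).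
  by apply: L2B => //; apply: L2D; [exact: L2_poly|exact/L2_conj/L2_poly].
exists (maxn (size A) (size B)) => k; rewrite geq_max => /andP[kA kB].
have := h _ k (L2_cst 1) T2 AB; under eq_fun do rewrite mulr1.
rewrite fourierB//; last exact: L2_cL1.
rewrite fourierD; [|exact/L2_cL1/L2_poly|exact/cL1_conj/L2_cL1/L2_poly].
rewrite fourier_conj; last exact/L2_cL1/L2_poly.
suff -> : fourier (fun t => A.[eit t]) k + cconj (fourier (fun t => B.[eit t]) (- k)) = 0.
  by rewrite subr0.
rewrite !fourier_poly; case: k kA kB => [[|n]|n] kA kB.
- by rewrite oppr0 /= B0 cconj0 addr0 nth_default.
- by rewrite nth_default// -NegzE /= cconj0 addr0.
- by rewrite NegzE opprK /= add0r nth_default// cconj0.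
Qed.

Lemma fourier_polyM_lead (A : {poly C}) G m k : cL1 G ->
  (forall k, k < m -> fourier G k = 0) -> k <= m ->
  fourier (fun t => A.[eit t] * G t) k = A`_0 * fourier G k.
Proof.
move=> G1 Gm km; rewrite fourier_polyM//.
have [->|A0] := eqVneq A 0; first by rewrite size_poly0 big_ord0 coef0 mul0r.
have sA : (0 < size A)%N by rewrite size_poly_gt0.
rewrite (bigD1 (Ordinal sA))//= subr0 big1 ?addr0// => -[[|i] iA] //= _.
by rewrite Gm ?mulr0// ltrBlDr (le_lt_trans km)// ltrDl.
Qed.

(** An analytic factor cannot create frequencies below m, and it acts on the lowest one through its
    value at 0. This is plain for polynomials and passes to the limit by [H2_poly_dense]. The case m
    = 1 carries vanishing at the origin through products. *)
Lemma fourier_mul_H2 F G m : Hp 2 F -> Lp 2 G ->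
  (forall k, k < m -> fourier G k = 0) ->
  (forall k, k < m -> fourier (fun t => F t * G t) k = 0) /\
  fourier (fun t => F t * G t) m = fourier F 0 * fourier G m.
Proof.
move=> FH G2 Gm; have F2 := Hp_L2 FH.
have AG A k := fourier_polyM_lead (k := k) A (L2_cL1 G2) Gm.
have key k e : k <= m -> 0 < e -> exists A : {poly C},
    cabs (fourier (fun t => F t * G t) k - A`_0 * fourier G k) <= e /\
    cabs (fourier F 0 - A`_0) <= e.
  move=> km e0; have [d1 d10 h1] := @fourier_mul_small G e e0.
  have [d2 d20 h2] := @fourier_mul_small (fun=> 1) e e0.
  have d0 : 0 < Num.min d1 d2 by rewrite lt_min d10.
  have [A hA] := H2_poly_dense FH d0; exists A.
  have A2 := L2_poly A.
  have FA2 : Lp 2 (fun t => F t - A.[eit t]) by exact: L2B.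
  move: hA; rewrite le_min => /andP[hA1 hA2]; split.
    rewrite -(AG _ _ km) -fourierB; [|exact: L2_mul..].
    rewrite (_ : (fun t => F t * G t - A.[eit t] * G t) =
        (fun t => (F t - A.[eit t]) * G t)); first exact: h1.
    by apply/funext => t; rewrite mulrBl.
  have := h2 _ 0 (L2_cst 1) FA2 hA2; under eq_fun do rewrite mulr1.
  by rewrite fourierB ?fourier_poly//; exact: L2_cL1.
split.
  move=> k km; apply: cabs_le_eps => e e0.
  have [A [+ _]] := key k e (ltW km) e0.
  by rewrite Gm// mulr0 subr0.
apply/eqP; rewrite -subr_eq0; apply/eqP; apply: cabs_le_eps => e e0.
set w := fourier G m.
have c0 : 0 < cabs w + 1 by rewrite ltr_wpDl// cabs_ge0.
have d0 : 0 < e / 2 / (cabs w + 1) by rewrite !divr_gt0.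
have [A [h1 h2]] := key m _ (lexx _) d0.
rewrite (_ : _ - _ = (fourier (fun t => F t * G t) m - A`_0 * w) -
    (fourier F 0 - A`_0) * w); last by ring.
apply: (le_trans (ler_cabsB _ _)); rewrite cabsM.
set d := e / 2 / (cabs w + 1) in h1 h2.
have : d * (cabs w + 1) = e / 2 by rewrite divfK// gt_eqF.
have := ler_wpM2r (cabs_ge0 w) h2; rewrite -/w in h1 *; lra.
Qed.

Lemma Hp1_mul F G : Hp 2 F -> Hp 2 G -> Hp 1 (fun t => F t * G t).
Proof.
move=> FH GH; split; first by apply/Lp1P; apply: L2_mul; exact: Hp_L2.
by have [] := fourier_mul_H2 FH (Hp_L2 GH) GH.2.
Qed.

Lemma Linf_L2 f : Linf f -> Lp 2 f.
Proof. by move=> [mf [M fM]]; exact: L2_bounded fM. Qed.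

Lemma Hinf_H2 f : Hinf f -> Hp 2 f.
Proof. by move=> [fi [_ f0]]; split => //; exact: Linf_L2. Qed.

Lemma L2M_Linf F B : Lp 2 F -> Linf B -> Lp 2 (fun t => B t * F t).
Proof. by move=> F2 [mB [M BM]]; exact: L2M_bounded BM F2. Qed.

Lemma Hp2_mul_Hinf F B : Hinf B -> Hp 2 F -> Hp 2 (fun t => B t * F t).
Proof.
move=> BH FH; split; first by apply: L2M_Linf; [exact: Hp_L2|have [] := BH].
by have [] := fourier_mul_H2 (Hinf_H2 BH) (Hp_L2 FH) FH.2.
Qed.

Lemma Hinf_mul (A B : Cfun R) : Hinf A -> Hinf B -> Hinf (fun t => A t * B t).
Proof.
move=> AH BH; split; last by apply: Hp1_mul; exact: Hinf_H2.
have [[mA [M AM]] _] := AH; have [[mB [K BK]] _] := BH; split.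
  exact: cmeasurableM.
exists (M * K); apply: ae_T_sub2 AM BK => t h1 h2.
by rewrite cabsM; apply: ler_pM => //; exact: cabs_ge0.
Qed.

Lemma Hinf_poly (p : {poly C}) : Hinf (fun t => p.[eit t]).
Proof.
have [M pM] := poly_bounded p; split.
  by split; [exact: cmeasurable_poly|exists M; exact: ae_T_all].
split; first by apply/Lp1P; exact/L2_cL1/L2_poly.
by case=> // n _; rewrite fourier_poly.
Qed.

End HardyProducts.

(** * Exponentials of polynomials *)

Section ComplexExponential.
Variable R : realType.
Local Notation C := R[i].
Implicit Types (z w : C) (x y : R) (k m : int) (e : R).

Lemma cexpD z w : cexp (z + w) = cexp z * cexp w.
Proof.
apply: complex_ext; rewrite ?cReM ?cImM /= cReD cImD expRD ?cosD ?sinD; ring.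
Qed.
Lemma cexp0 : cexp (0 : C) = 1.
Proof. by rewrite /cexp /= expR0 cos0 sin0 mulr1 mulr0. Qed.
Lemma cexp_nat n z : cexp (n%:R * z) = cexp z ^+ n.
Proof.
elim: n => [|n IH]; first by rewrite mul0r cexp0 expr0.
by rewrite -natr1 mulrDl mul1r cexpD IH exprSr.
Qed.
Lemma cabs_cexp z : cabs (cexp z) = expR (cRe z).
Proof.
rewrite /cabs /= !exprMn -mulrDr cos2Dsin2 mulr1 sqrtr_sqr.
by rewrite ger0_norm// expR_ge0.
Qed.
Lemma cexp_cR x : cexp (cR x) = cR (expR x).
Proof. by rewrite /cexp /= cos0 sin0 mulr1 mulr0. Qed.

Lemma sin_norm_le x : `|sin x| <= `|x|.
Proof.
wlog x0 : x / 0 <= x.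
  move=> h; have [/h//|/ltW x0] := lerP 0 x.
  by rewrite -normrN -sinN -(normrN x) h// oppr_ge0.
have [|c _] := @MVT_segment R sin cos 0 x x0.
- by apply: continuous_subspaceT; exact: continuous_sin.
rewrite sin0 !subr0 => ->; rewrite normrM ler_piMl//; exact: cos_max.
Qed.

Lemma cos_ge_sqr x : 1 - cos x <= x ^+ 2 / 2.
Proof.
have -> : cos x = 1 - sin (x / 2) ^+ 2 *+ 2.
  rewrite {1}(_ : x = x / 2 *+ 2); last by rewrite -mulr_natr divfK.
  by rewrite cos_mulr2n cos2sin2; ring.
have : sin (x / 2) ^+ 2 <= (x / 2) ^+ 2.
  rewrite -real_normK ?num_real// -[leRHS]real_normK ?num_real//.
  by rewrite ler_sqr ?nnegrE// sin_norm_le.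
have -> : (x / 2) ^+ 2 = x ^+ 2 / 4 by field.
lra.
Qed.

Lemma sin_sub_le x : `|x| <= 1 -> `|sin x - x| <= x ^+ 2 / 2.
Proof.
wlog x0 : x / 0 <= x.
  move=> h x1; have [/h//|/ltW x0] := lerP 0 x; first exact.
  have -> : `|sin x - x| = `|sin (- x) - (- x)| by rewrite sinN -opprD normrN.
  by rewrite -sqrrN h ?oppr_ge0 ?normrN.
move=> x1; have {x1} x1 : x <= 1 by rewrite (le_trans (ler_norm _)).
have [|c] := @MVT_segment R (fun y => sin y - y) (fun y => cos y - 1) 0 x x0.
- by apply: continuous_subspaceT => y; apply: cvgB; [exact: continuous_sin|exact: cvg_id].
rewrite in_itv /= => /andP[c0 cx].
rewrite sin0 !subr0 => ->; rewrite normrM (ger0_norm x0).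
have h1 := cos_ge_sqr c; have h2 := cos_le1 c.
rewrite -normrN opprB ger0_norm ?subr_ge0//.
have : c ^+ 2 <= x ^+ 2 by rewrite ler_sqr ?nnegrE.
nra.
Qed.

Lemma expR_sub_le x : `|x| <= 2^-1 -> 0 <= expR x - 1 - x <= 2 * x ^+ 2.
Proof.
rewrite ler_norml => /andP[x1 x2]; have h := expR_ge1Dx x.
have h2 := expR_ge1Dx (- x); have h3 := expRxMexpNx_1 x; have h4 := expR_gt0 x.
apply/andP; split; first by lra.
have : expR x * (1 - x) <= expR x * expR (- x) by rewrite ler_wpM2l// ltW.
rewrite h3.
nra.
Qed.

(** A first-order Taylor bound, obtained from those of [expR], [cos] and [sin]; a quadratic
    remainder is all that the limit (1 + z / n)^n requires. *)
Lemma cexp_sub_le z : cabs z <= 2^-1 -> cabs (cexp z - (1 + z)) <= 3 * cabs z ^+ 2.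
Proof.
move=> z2; apply: (le_trans (cabs_le_ReIm _)).
have x2 := le_trans (normr_cRe z) z2; have y2 := le_trans (normr_cIm z) z2.
rewrite cReD cImD cReN cImN cReD cImD cabs_sqr /= add0r.
move: x2 y2; set x := cRe z; set y := cIm z => x2 y2.
have /andP[e1 e2] := expR_sub_le x2.
have c1 := cos_ge_sqr y; have c2 := cos_le1 y.
have y1 : `|y| <= 1 by apply: (le_trans y2); lra.
have s1 := sin_sub_le y1; have s2 := sin_norm_le y.
have xx := sqr_ge0 x; have yy := sqr_ge0 y.
have eb : expR x <= 2.
  by move: x2; rewrite ler_norml => /andP[? ?]; nra.
have hre : `|expR x * cos y - (1 + x)| <= 2 * x ^+ 2 + y ^+ 2.
  rewrite (_ : _ - _ = (expR x - 1 - x) - expR x * (1 - cos y)); last by ring.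
  apply: (le_trans (ler_normB _ _)); apply: lerD; first by rewrite ger0_norm.
  rewrite ger0_norm; last by rewrite mulr_ge0 ?expR_ge0// subr_ge0.
  by have := expR_ge0 x; nra.
have hex : `|expR x - 1| <= 2 * `|x|.
  rewrite (_ : _ - 1 = (expR x - 1 - x) + x); last by ring.
  rewrite (le_trans (ler_normD _ _))// ger0_norm// mulr2n mulrDl mul1r lerD2r.
  apply: (le_trans e2); rewrite -real_normK ?num_real// expr2 mulrA ler_piMl//.
  by rewrite mulrC -ler_pdivlMr// mul1r.
have him : `|expR x * sin y - y| <= x ^+ 2 + y ^+ 2 + y ^+ 2 / 2.
  rewrite (_ : _ - y = (expR x - 1) * sin y + (sin y - y)); last by ring.
  rewrite (le_trans (ler_normD _ _))// lerD// normrM.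
  apply: (@le_trans _ _ (2 * `|x| * `|y|)); first exact: ler_pM.
  have := sqr_ge0 (`|x| - `|y|); rewrite sqrrB !real_normK ?num_real//.
  by rewrite -mulrA mulr_natl; lra.
lra.
Qed.

Lemma cabs_exprB n z w (M : R) : cabs z <= M -> cabs w <= M -> 1 <= M ->
  cabs (z ^+ n - w ^+ n) <= n%:R * M ^+ n * cabs (z - w).
Proof.
move=> zM wM M1; have M0 : 0 <= M by rewrite (le_trans ler01).
elim: n => [|n IH]; first by rewrite !expr0 subrr cabs0 !mul0r.
rewrite (_ : _ - _ = z * (z ^+ n - w ^+ n) + (z - w) * w ^+ n); last first.
  by rewrite !exprS; ring.
rewrite (le_trans (ler_cabsD _ _))// !cabsM cabsX.
have h1 : cabs z * cabs (z ^+ n - w ^+ n) <= M * (n%:R * M ^+ n * cabs (z - w)).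
  by apply: ler_pM => //; exact: cabs_ge0.
have h2 : cabs w ^+ n <= M ^+ n by rewrite lerXn2r// nnegrE// cabs_ge0.
have h3 : M ^+ n <= M ^+ n.+1 by rewrite exprS ler_peMl// exprn_ge0.
have h4 : cabs (z - w) * cabs w ^+ n <= cabs (z - w) * M ^+ n.+1.
  by rewrite ler_wpM2l ?cabs_ge0// (le_trans h2).
have -> : n.+1%:R * M ^+ n.+1 * cabs (z - w) =
   M * (n%:R * M ^+ n * cabs (z - w)) + cabs (z - w) * M ^+ n.+1.
  by rewrite -natr1 !exprS; ring.
exact: lerD.
Qed.

Lemma cexp_limit (K e : R) : 0 <= K -> 0 < e -> exists n : nat,
  forall z, cabs z <= K -> cabs (cexp z - (1 + n.+1%:R^-1 * z) ^+ n.+1) <= e.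
Proof.
move=> K0 e0.
(* The first entry ensures |z / N| <= 1 / 2 for [cexp_sub_le]; the second makes the accumulated
   error 3 K^2 exp(K) / N at most e. *)
pose B := Num.max (2 * K) (3 * K ^+ 2 * expR K / e).
pose n := Num.truncn B; exists n => z zK.
have nB : B < n.+1%:R by exact: truncnS_gt.
set N : R := n.+1%:R in nB; have N0 : 0 < N by rewrite ltr0n.
have NC : n.+1%:R^-1 = cR N^-1 :> C by rewrite cRV cR_nat.
move: nB; rewrite gt_max => /andP[N1 N2].
rewrite NC; set w := cR N^-1 * z.
have zw : z = n.+1%:R * w.
  by rewrite /w -NC mulrA divff ?mul1r// pnatr_eq0.
have wK : cabs w <= K / N.
  by rewrite cabsM cabs_cR normfV gtr0_norm// mulrC ler_wpM2r// invr_ge0 ltW.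
have w2 : cabs w <= 2^-1.
  by apply: (le_trans wK); rewrite ler_pdivrMr// ler_pdivlMl// ltW.
have h := cexp_sub_le w2.
rewrite {1}zw cexp_nat; set M := expR (K / N).
have M1 : 1 <= M.
  by rewrite /M -expR0 ler_expR divr_ge0// ltW.
have hM1 : cabs (cexp w) <= M.
  by rewrite cabs_cexp ler_expR (le_trans _ wK)// cRe_le_cabs.
have hM2 : cabs (1 + w) <= M.
  rewrite (le_trans (ler_cabsD _ _))// cabs1 (le_trans _ (expR_ge1Dx _))//.
  by rewrite lerD2l.
apply: (le_trans (cabs_exprB n.+1 hM1 hM2 M1)).
have -> : M ^+ n.+1 = expR K.
  by rewrite /M -expRM_natl -/N mulrC divfK// gt_eqF.
have h2 : cabs (cexp w - (1 + w)) <= 3 * (K / N) ^+ 2.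
  apply: (le_trans h); rewrite ler_pM2l// lerXn2r// nnegrE ?cabs_ge0//.
  by rewrite divr_ge0// ltW.
apply: (@le_trans _ _ (N * expR K * (3 * (K / N) ^+ 2))).
  by rewrite ler_wpM2l// mulr_ge0 ?expR_ge0// ltW.
have -> : N * expR K * (3 * (K / N) ^+ 2) = 3 * K ^+ 2 * expR K / N.
  by field; rewrite gt_eqF.
by rewrite ler_pdivrMr// -ler_pdivrMl// mulrC ltW.
Qed.

Definition cexp_poly (q : {poly C}) : Cfun R := fun t => cexp q.[eit t].

Lemma cmeasurable_cexp (f : Cfun R) : cmeasurable f ->
  cmeasurable (fun t => cexp (f t)).
Proof.
move=> [f1 f2]; split => /=; apply: measurable_funM.
- by apply: measurableT_comp => //; exact: measurable_expR.
- apply: measurableT_comp => //.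
  by apply: continuous_measurable_fun; exact: continuous_cos.
- by apply: measurableT_comp => //; exact: measurable_expR.
- apply: measurableT_comp => //.
  by apply: continuous_measurable_fun; exact: continuous_sin.
Qed.

Lemma Linf_cexp_poly q : Linf (cexp_poly q).
Proof.
split; first by apply: cmeasurable_cexp; exact: cmeasurable_poly.
have [M qM] := poly_bounded q; exists (expR M); apply: ae_T_all => t _.
by rewrite cabs_cexp ler_expR (le_trans (cRe_le_cabs _)).
Qed.

Lemma cL1_Linf (B F : Cfun R) : Linf B -> cL1 F -> cL1 (fun t => B t * F t).
Proof. by move=> [mB [M BM]] Fi; exact: cL1M_bounded BM Fi. Qed.

(** The polynomials (1 + q / n)^n converge uniformly to exp(q) on the circle and at the origin, so
    [fourier_polyM_lead] passes to the limit. F is only integrable here, because in [outer0_div] it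
    will be a product of two L^2 functions. *)
Lemma fourier_cexp_polyM (q : {poly C}) (F : Cfun R) m k : cL1 F ->
  (forall k, k < m -> fourier F k = 0) -> k <= m ->
  fourier (fun t => cexp_poly q t * F t) k = cexp q`_0 * fourier F k.
Proof.
move=> F1 Fm km.
apply/eqP; rewrite -subr_eq0; apply/eqP; apply: cabs_le_eps => e e0.
have [M qM] := poly_bounded q.
(* The same n must serve the values on the circle and the value at the origin, hence the maximum. *)
pose K := Num.max (cabs q`_0) M.
have K0 : 0 <= K by rewrite le_max cabs_ge0.
have qK t : cabs q.[eit t] <= K by rewrite le_max qM orbT.
have q0K : cabs q`_0 <= K by rewrite le_max lexx.
pose b := rint (fun t => cabs (F t)) + cabs (fourier F k) + 1.
have r0 : 0 <= rint (fun t => cabs (F t)) by apply: rint_ge0 => t _; exact: cabs_ge0.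
have b0 : 0 < b by rewrite ltr_wpDl// addr_ge0// cabs_ge0.
have [n hn] := cexp_limit K0 (divr_gt0 e0 b0).
pose P := (1 + n.+1%:R^-1 *: q) ^+ n.+1.
have PE z : P.[z] = (1 + n.+1%:R^-1 * q.[z]) ^+ n.+1.
  by rewrite /P horner_exp hornerD hornerZ hornerC.
have P0 : P`_0 = (1 + n.+1%:R^-1 * q`_0) ^+ n.+1.
  by rewrite -!horner_coef0 PE.
have [mE [ME EM]] := Linf_cexp_poly q.
have [mP [MP PM]] := (Hinf_poly P).1.
have i1 := cL1_Linf (Linf_cexp_poly q) F1.
have i2 := cL1_Linf (Hinf_poly P).1 F1.
have h1 : cabs (fourier (fun t => cexp_poly q t * F t) k - P`_0 * fourier F k) <=
    e / b * rint (fun t => cabs (F t)).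
  rewrite -(fourier_polyM_lead P F1 Fm km) -fourierB//.
  apply: (le_trans (cabs_fourier _ (cL1B i1 i2))).
  rewrite -rintZ; last exact: rL1_cabs.
  apply: rint_le; [exact/rL1_cabs/cL1B|exact/rL1Z/rL1_cabs|].
  apply: ae_T_all => t _; rewrite -mulrBl cabsM ler_wpM2r ?cabs_ge0//.
  by rewrite PE hn.
have h2 : cabs (P`_0 * fourier F k - cexp q`_0 * fourier F k) <=
    e / b * cabs (fourier F k).
  by rewrite -mulrBl cabsM ler_wpM2r ?cabs_ge0// P0 cabs_distC hn.
rewrite -(subrKA (P`_0 * fourier F k)) (le_trans (ler_cabsD _ _))//.
have eb : e / b * b = e by rewrite divfK// gt_eqF.
have := divr_gt0 e0 b0; rewrite -[leRHS]eb /b.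
set d := e / _ in h1 h2 *; lra.
Qed.

Lemma Hp2_cexp_polyM (q : {poly C}) F : Hp 2 F ->
  Hp 2 (fun t => cexp_poly q t * F t).
Proof.
move=> [F2 F0]; split; first by apply: L2M_Linf => //; exact: Linf_cexp_poly.
move=> k k0; rewrite (fourier_cexp_polyM q (L2_cL1 F2) F0 (ltW k0)).
by rewrite F0// mulr0.
Qed.

End ComplexExponential.

(** * Outer functions *)

Section Szego.
Variable R : realType.
Local Notation C := R[i].
Implicit Types (f g F G X : Cfun R) (c lam : C) (k m : int) (e : R).

Lemma expR_lip (x y B : R) : x <= B -> y <= B ->
  `|expR x - expR y| <= expR B * `|x - y|.
Proof.
wlog xy : x y / y <= x.
  move=> h xB yB; have /orP[yx|yx] := le_total y x; first exact: (h x y yx xB yB).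
  by rewrite distrC [`|x - y|]distrC; exact: (h y x yx yB xB).
move=> xB yB; rewrite !ger0_norm ?subr_ge0 ?ler_expR//.
apply: (@le_trans _ _ (expR x * (x - y))); last first.
  by rewrite ler_wpM2r ?subr_ge0// ler_expR.
have h := expR_ge1Dx (y - x); have p := expR_gt0 x.
have -> : expR y = expR x * expR (y - x) by rewrite -expRD; congr expR; ring.
by nra.
Qed.

Lemma clip_nneg (K x : R) : 0 <= K -> 0 <= x -> 0 <= clip K x <= x.
Proof.
move=> K0 x0; rewrite /clip ger0_norm ?addr_ge0//.
by have [h|h] := lerP 0 (x - K); [rewrite ger0_norm|rewrite ltr0_norm]; lra.
Qed.

Lemma clip_ge (K x : R) : 0 <= K -> x <= K -> x <= clip K x.
Proof.
move=> K0 xK; rewrite /clip [`|x - K|]ler0_norm ?subr_le0//.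
by have := ler_norm (x + K); lra.
Qed.

Lemma clip_eq (K x : R) : 0 <= K -> K <= x -> clip K x = K.
Proof.
by move=> K0 Kx; rewrite /clip !ger0_norm ?subr_ge0 ?addr_ge0//; lra.
Qed.

Lemma measurable_expR_comp (f : R -> R) : measurable_fun (@Tc R) f ->
  measurable_fun (@Tc R) (fun t => expR (f t)).
Proof. by move=> mf; apply: measurableT_comp => //; exact: measurable_expR. Qed.

Lemma fourier0 F : fourier F 0 = cR (pi *+ 2)^-1 * cint F.
Proof.
by rewrite fourierE; congr (_ * _); apply: cint_eq => t _; rewrite oppr0 expr0z mul1r.
Qed.

(** The weight may be unbounded, so it is split at a level l: below l the L^1 closeness of Re q to v
    suffices, and on the integrable excess above l the uniform bound K + 1 on both exponents
    does. *)
Lemma exp_weight_approx (w v : R -> R) (K e : R) : rL1 w ->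
  (forall t, 0 <= w t) -> measurable_fun (@Tc R) v ->
  (forall t, Tc t -> `|v t| <= K) -> 0 <= K -> 0 < e ->
  exists q : {poly C}, [/\ cIm q`_0 = 0,
    `|cRe q`_0 * (pi *+ 2) - rint v| <= e &
    rint (fun t => expR (cRe q.[eit t]) * w t) <= rint (fun t => expR (v t) * w t) + e].
Proof.
move=> wi w0 mv vK K0 e0; have mw := rL1_measurable wi.
set B := expR (K + 1); have B0 : 0 < B by exact: expR_gt0.
have ci (L : nat) : rL1 (fun t => w t - clip L%:R (w t)).
  apply: rL1B => //; apply: (rL1_le (measurable_clip _ mw) wi).
  by apply: ae_T_all => t _; rewrite -[leRHS](ger0_norm (w0 t)) clip_norm.
have [L hL] : exists L : nat, 2 * B * rint (fun t => w t - clip L%:R (w t)) <= e / 2.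
  have : rint (fun t => w t - clip n%:R (w t)) @[n --> \oo] --> (0 : R).
    rewrite -[X in _ --> X](_ : rint (fun=> 0) = 0); last by rewrite rint_cst mul0r.
    apply: (@rint_dominated _ _ _ w) => //.
    - by move=> n; exact: rL1_measurable (ci n).
    - move=> n t _; have /andP[h1 h2] := clip_nneg (ler0n R n) (w0 t).
      by rewrite ger0_norm ?subr_ge0// lerBlDr lerDl.
    - apply: ae_T_all => t _; rewrite -[X in _ --> X](subrr (w t)).
      by apply: cvgB; [exact: cvg_cst|exact: cvg_clip].
  have d0 : 0 < e / 2 / (2 * B) by rewrite !divr_gt0// mulr_gt0.
  move=> /cvg_eps /(_ d0)[n]; rewrite subr0 ger0_norm; last first.
    apply: rint_ge0 => t _; rewrite subr_ge0.
    by have /andP[] := clip_nneg (ler0n R n) (w0 t).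
  by rewrite ler_pdivlMr ?mulr_gt0// mulrC => h; exists n.
set l : R := L%:R in hL; have l0 : 0 <= l by exact: ler0n.
(* The first entry controls the mean of v, the second the error on the truncated weight. The
   denominator has l + 1 because l may be 0. *)
pose d := Num.min e (e / 2 / (B * (l + 1))).
have l1 : 0 < l + 1 by exact: ltr_wpDl.
have d0 : 0 < d by rewrite lt_min e0 !divr_gt0// mulr_gt0.
have [q [q0 qK qd]] := real_trig_dense mv vK K0 d0.
have mq : measurable_fun (@Tc R) (fun t => cRe q.[eit t]).
  by have [] := cmeasurable_poly q.
have qi : rL1 (fun t => cRe q.[eit t]) by have [] := L2_cL1 (L2_poly q).
have vi : rL1 v by apply: (rL1_bounded mv); apply: ae_T_all => t; exact: vK.
have di : rL1 (fun t => `|cRe q.[eit t] - v t|) by apply: rL1_norm; exact: rL1B.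
have qle t : Tc t -> cRe q.[eit t] <= K + 1.
  by move=> /qK; apply: le_trans; exact: ler_norm.
have vle t : Tc t -> v t <= K + 1.
  move=> /vK h; rewrite (le_trans (ler_norm _))// (le_trans h)//.
  by rewrite lerDl.
have ewi (u : R -> R) : measurable_fun (@Tc R) u -> (forall t, Tc t -> u t <= K + 1) ->
    rL1 (fun t => expR (u t) * w t).
  move=> mu ule; apply: (@rL1_le _ _ (fun t => B * w t)).
  - by apply: measurable_funM => //; exact: measurable_expR_comp.
  - exact: rL1Z.
  - apply: ae_T_all => t Tt; rewrite normrM !ger0_norm ?expR_ge0//.
    by rewrite ler_wpM2r// ler_expR ule.
exists q; split => //.
  have -> : cRe q`_0 * (pi *+ 2) = rint (fun t => cRe q.[eit t]).
    rewrite -[q`_0](fourier_poly q 0) fourier0 cRe_cRM mulrC mulrA.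
    by rewrite divff ?twopi_neq0// mul1r.
  rewrite -rintB// (le_trans (rint_norm (rL1B qi vi)))// (le_trans qd)//.
  by rewrite ge_min lexx.
have c1 := ci L.
apply: (@le_trans _ _ (rint (fun t => expR (v t) * w t +
  (B * l * `|cRe q.[eit t] - v t| + 2 * B * (w t - clip l (w t)))))).
  apply: rint_le; [exact: ewi| |].
    by apply: rL1D; [exact: ewi|apply: rL1D; exact: rL1Z].
  apply: ae_T_all => t Tt; rewrite -lerBlDl -mulrBl.
  have /andP[h1 h2] := clip_nneg l0 (w0 t).
  have h3 : clip l (w t) <= l by rewrite (le_trans (ler_norm _))// clip_bound.
  have h4 := expR_lip (qle t Tt) (vle t Tt).
  have h5 : expR (cRe q.[eit t]) <= B by rewrite ler_expR qle.
  have h6 := expR_ge0 (v t); have h7 := expR_ge0 (cRe q.[eit t]).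
  have h8 := ler_norm (expR (cRe q.[eit t]) - expR (v t)).
  rewrite -/B in h4; move: h4 h5 h6 h7 h8; set x := expR (cRe _); set y := expR (v t).
  set dd := `|cRe _ - v t| => h4 h5 h6 h7 h8.
  have dd0 : 0 <= dd by exact: normr_ge0.
  rewrite -[w t in leLHS](subrK (clip l (w t))) mulrDr addrC; apply: lerD.
    apply: (@le_trans _ _ (B * dd * clip l (w t))).
      by rewrite ler_wpM2r// (le_trans h8).
    rewrite [leRHS]mulrAC ler_wpM2l//; apply: mulr_ge0 => //; exact: ltW.
  rewrite ler_wpM2r ?subr_ge0//; have := B0; lra.
rewrite rintD; [|exact: ewi|by apply: rL1D; exact: rL1Z].
rewrite rintD; [|exact: rL1Z..].
rewrite !rintZ// lerD2l.
have : rint (fun t => `|cRe q.[eit t] - v t|) <= e / 2 / (B * (l + 1)).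
  by rewrite (le_trans qd)// ge_min lexx orbT.
rewrite ler_pdivlMr ?mulr_gt0//.
have : 0 <= rint (fun t => `|cRe q.[eit t] - v t|) by apply: rint_ge0.
move: hL; set r1 := rint _; set r2 := rint _ => hL r20 h.
have : 0 <= r2 * B by rewrite mulr_ge0// ltW.
lra.
Qed.

Lemma n2_sub_cst F c : Lp 2 F ->
  n2 (fun t => F t - c) = n2 F + cabs c ^+ 2 * (pi *+ 2) -
    cRe (fourier F 0 * cconj c) * (pi *+ 2) *+ 2.
Proof.
move=> F2; have F1 := L2_cL1 F2; have Fs := L2_sqr F2.
have [r1 _] := cL1Z (cconj c) F1.
transitivity (rint (fun t => cabs (F t) ^+ 2 + cabs c ^+ 2 +
   (-2) * cRe (cconj c * F t))).
  by apply: rint_eq => t _; rewrite cabs_sqrB [F t * _]mulrC mulNr mulr_natl.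
rewrite rintD; [|by apply: rL1D => //; exact: rL1_cst|exact: rL1Z].
rewrite rintD//; last exact: rL1_cst.
rewrite rint_cst rintZ// -cRe_cint cintZ// mulNr mulr_natl; congr (_ - _ *+ 2).
rewrite [RHS]mulrC -cRe_cRM; congr cRe.
rewrite fourier0 -mulrA [cint _ * _]mulrC mulrA -cRM divff ?twopi_neq0//.
by rewrite mul1r.
Qed.

Lemma cabs_fourier0_sqr F : Lp 2 F -> cabs (fourier F 0) ^+ 2 * (pi *+ 2) <= n2 F.
Proof.
move=> F2; have := n2_ge0 (fun t => F t - fourier F 0).
rewrite n2_sub_cst// mulr_cconj /=; lra.
Qed.

(** The half is there because |exp(q / 2)|^2 = exp(Re q), the weight treated by
    [exp_weight_approx]. *)
Lemma H2_cexp_half (q : {poly C}) G : Hp 2 G -> cIm q`_0 = 0 ->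
  [/\ Hp 2 (fun t => cexp_poly (cR 2^-1 *: q) t * G t),
   fourier (fun t => cexp_poly (cR 2^-1 *: q) t * G t) 0 =
     cR (expR (cRe q`_0 / 2)) * fourier G 0 &
   n2 (fun t => cexp_poly (cR 2^-1 *: q) t * G t) =
     rint (fun t => expR (cRe q.[eit t]) * cabs (G t) ^+ 2)].
Proof.
move=> GH q0; split; first exact: Hp2_cexp_polyM.
  rewrite (fourier_cexp_polyM _ (L2_cL1 (Hp_L2 GH)) GH.2 (lexx _)).
  rewrite coefZ -cexp_cR; congr (cexp _ * _).
  by apply: complex_ext; rewrite ?cRe_cRM ?cImM /= ?q0 ?mulr0 ?mul0r ?addr0// mulrC.
apply: rint_eq => t _; rewrite cabsM exprMn cabs_cexp hornerZ cRe_cRM.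
by rewrite -expRM_natl mulrA divff ?mul1r.
Qed.

(** If G vanished on a set U of positive measure, a multiplier exp(q / 2) with Re q close to K on U
    and to 0 elsewhere would hardly change the norm of G, while it multiplies the value at 0 by an
    arbitrarily large factor; [cabs_fourier0_sqr] forbids this. *)
Lemma H2_neq0_ae G : Hp 2 G -> fourier G 0 != 0 -> ae_T (fun t => G t != 0).
Proof.
move=> GH G0; have G2 := Hp_L2 GH; have wi := L2_sqr G2.
pose U : set R := @Tc R `&` (fun t => cabs (G t)) @^-1` [set 0].
have mU : measurable (U : set (measurableTypeR R)).
  have := measurable_cabs (L2_measurable G2).
  by move=> /(_ (@measurable_Tc R) _ (measurable_set1 0)).
have mI : measurable_fun (@Tc R) (\1_U : R -> R) by exact: measurable_indic.
have I01 t : 0 <= (\1_U t : R) <= 1 by rewrite indicE; case: (t \in U); rewrite /= lexx ler01.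
have iI : rL1 (\1_U : R -> R).
  apply: (@rL1_bounded _ _ 1) => //; apply: ae_T_all => t _.
  by have /andP[h1 h2] := I01 t; rewrite ger0_norm.
have Iw t : Tc t -> (\1_U t : R) != 0 -> cabs (G t) ^+ 2 = 0.
  move=> Tt; rewrite indicE; case: (boolP (t \in U)) => [|_]; last by rewrite eqxx.
  by rewrite inE => -[_ /= ->]; rewrite expr0n.
set a := rint (\1_U : R -> R).
have a0 : 0 <= a by apply: rint_ge0 => t _; have /andP[] := I01 t.
have az : a = 0.
  apply/eqP; rewrite eq_le a0 andbT leNgt; apply/negP => apos.
  set W := rint (fun t => cabs (G t) ^+ 2).
  have W0 : 0 <= W by apply: rint_ge0 => t _; rewrite exprn_ge0// cabs_ge0.
  set g2 := cabs (fourier G 0) ^+ 2.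
  have g0 : 0 < g2 by rewrite exprn_gt0// cabs_gt0.
  (* Then K |U| = (W + 1) / g2 + 1. The final 1 covers the error in the mean, and exp(x) >= 1 + x
     already exceeds the bound W + 1. *)
  pose K := ((W + 1) / g2 + 1) / a.
  have K0 : 0 <= K.
    by rewrite divr_ge0// addr_ge0// divr_ge0 ?addr_ge0// ltW.
  have mv : measurable_fun (@Tc R) (fun t => K * \1_U t) by exact: measurable_funM.
  have vK t : Tc t -> `|K * \1_U t| <= K.
    move=> _; have /andP[h1 h2] := I01 t.
    rewrite ger0_norm; last exact: mulr_ge0.
    by rewrite -[leRHS]mulr1 ler_wpM2l.
  have [q [q0 qm qe]] := exp_weight_approx wi (fun t => sqr_ge0 _) mv vK K0 ltr01.
  have [PH Pf Pn] := H2_cexp_half GH q0.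
  have := cabs_fourier0_sqr (Hp_L2 PH).
  rewrite Pn Pf cabsM exprMn cabs_cR ger0_norm ?expR_ge0// -expRM_natl.
  rewrite (_ : 2 * (cRe q`_0 / 2) = cRe q`_0) -/g2; last by field.
  move=> h1.
  have h2 : rint (fun t => expR (K * \1_U t) * cabs (G t) ^+ 2) = W.
    apply: rint_eq => t Tt; have [->|/(Iw _ Tt) ->] := eqVneq (\1_U t : R) 0.
      by rewrite mulr0 expR0 mul1r.
    by rewrite mulr0.
  rewrite h2 in qe.
  rewrite rintZ// -/a /K divfK ?gt_eqF// in qm.
  have h3 := expR_ge1Dx (cRe q`_0).
  have p := twopi_gt0 R.
  have h4 : (1 + cRe q`_0) * (pi *+ 2) * g2 <= W + 1.
    apply: le_trans (le_trans h1 qe).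
    rewrite [leRHS]mulrAC; apply: ler_wpM2r; first exact: ltW.
    by apply: ler_wpM2r => //; exact: ltW.
  move: qm; rewrite ler_norml => /andP[qm _].
  have h5 : (W + 1) / g2 < (1 + cRe q`_0) * (pi *+ 2) by lra.
  have : (W + 1) / g2 * g2 < W + 1 by apply: lt_le_trans h4; rewrite ltr_pM2r.
  by rewrite divfK ?ltxx// gt_eqF.
have /rint_eq0_ae : rL1 (\1_U : R -> R) by [].
move=> /(_ (fun t => proj1 (andP (I01 t))) az).
have hT : ae_T (@Tc R) by exact: ae_T_all.
apply: ae_T_sub2 hT => t Tt; rewrite indicE; case: (boolP (t \in U)) => [_ /eqP|+ _].
  by rewrite oner_eq0.
apply: contra => /eqP Gt; rewrite inE; split => //=.
by rewrite Gt cabs0.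
Qed.

(** The last clause is the case of equality in Jensen's inequality, with a free unimodular
    constant. *)
Definition outer0 G : Prop := [/\ Hp 2 G, rL1 (fun t => ln (cabs (G t))) &
  exists2 lam : C, cabs lam = 1 &
    fourier G 0 = lam * cR (expR (rint (fun t => ln (cabs (G t))) / (pi *+ 2)))].

Lemma outer_outer0 G : outer 2 G -> outer0 G.
Proof.
move=> [GH [mln [iln [lam [lam1 h]]]]]; split => //.
  by apply/integrableP; split => //; apply/measurable_EFinP.
exists lam => //; have := h 0; rewrite cabs0 ltr01 => /(_ isT).
rewrite /disc_ext fourier0.
rewrite (@cint_eq _ _ G); last by move=> t _; rewrite mul0r subr0 divr1.
move=> ->; congr (_ * _).
rewrite (@cint_eq _ _ (fun t => cR (ln (cabs (G t))))); last first.
  by move=> t _; rewrite addr0 subr0 divff ?eit_neq0// mul1r.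
rewrite (_ : cint _ = cR (rint (fun t => ln (cabs (G t))))).
  by rewrite -cRM cexp_cR mulrC.
apply: complex_ext => //.
by rewrite cIm_cint /= rint_cst mul0r.
Qed.

Lemma outer0_neq0 G : outer0 G -> ae_T (fun t => G t != 0).
Proof.
move=> [GH _ [lam lam1 G0]]; apply: H2_neq0_ae => //.
rewrite G0 mulf_neq0//; first by rewrite -cabs_gt0 lam1.
by apply: cR_neq0; rewrite gt_eqF// expR_gt0.
Qed.

(* Szego's theorem for outer functions: approximating [- ln |G|^2] by real
   trigonometric polynomials produces multipliers for which Jensen's
   inequality for [cexp_poly q * G] is nearly an equality. *)
Lemma outer0_cyclic G e : outer0 G -> 0 < e -> exists lam, cabs lam = 1 /\
  exists q : {poly C}, n2 (fun t => cexp_poly q t * G t - lam) <= e.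
Proof.
move=> Go e0; have := outer0_neq0 Go.
have [GH li [lam lam1 G0]] := Go => Gn0; exists lam; split => //.
have G2 := Hp_L2 GH; have wi := L2_sqr G2.
pose u t := 2 * ln (cabs (G t)).
have ui : rL1 u by exact: rL1Z.
have mu := rL1_measurable ui.
have eu : ae_T (fun t => expR (u t) = cabs (G t) ^+ 2).
  apply: ae_T_sub Gn0 => t G0t; rewrite /u expRM_natl lnK// posrE cabs_gt0//.
set W := rint (fun t => cabs (G t) ^+ 2).
have W0 : 0 <= W by apply: rint_ge0 => t _; rewrite exprn_ge0// cabs_ge0.
have mv (n : nat) : measurable_fun (@Tc R) (fun t => - clip n%:R (u t)).
  by apply: measurable_funN; exact: measurable_clip.
have e1 : 0 < e / (4 * (W + 1)) by rewrite divr_gt0// mulr_gt0// ltr_wpDl.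
(* Truncating u = ln |G|^2 at n costs |G|^2 / (n + 1) in the weighted integral and a small amount in
   the mean; one n must make both small. *)
have [n [n1 n2e]] : exists n : nat, `|n.+1%:R^-1 - 0| <= e / (4 * (W + 1)) :> R /\
    `|rint (fun t => - clip n%:R (u t)) - - rint u| <= e / 4.
  have c1 : (fun n : nat => n.+1%:R^-1 : R) n @[n --> \oo] --> (0 : R).
    exact: cvg_harmonic.
  have c2 : rint (fun t => - clip n%:R (u t)) @[n --> \oo] --> - rint u.
    rewrite -rintN//; apply: (@rint_dominated _ _ _ (fun t => `|u t|)) => //.
    - exact: measurable_funN.
    - exact: rL1_norm.
    - by move=> n t _; rewrite normrN clip_norm.
    - by apply: ae_T_all => t _; apply: cvgN; exact: cvg_clip.
  have m0 : 0 < Num.min (e / (4 * (W + 1))) (e / 4) by rewrite lt_min e1 divr_gt0.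
  have [n [h1 h2]] := cvg_eps2 c1 c2 m0; exists n; split.
    by apply: (le_trans h1); rewrite ge_min lexx.
  by apply: (le_trans h2); rewrite ge_min lexx orbT.
set K : R := n%:R; have K0 : 0 <= K by exact: ler0n.
have vK t : Tc t -> `|- clip K (u t)| <= K by move=> _; rewrite normrN clip_bound.
have e4 : 0 < e / 4 by rewrite divr_gt0.
have [q [q0 qm qe]] := exp_weight_approx wi (fun t => sqr_ge0 _) (mv n) vK K0 e4.
exists (cR 2^-1 *: q); have [PH Pf Pn] := H2_cexp_half GH q0.
rewrite n2_sub_cst; last exact: Hp_L2.
rewrite Pn Pf G0 lam1 expr1n mul1r.
have -> : cR (expR (cRe q`_0 / 2)) * (lam * cR (expR (rint (fun t => ln (cabs (G t))) /
    (pi *+ 2)))) * cconj lam =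
    cR (expR (cRe q`_0 / 2 + rint (fun t => ln (cabs (G t))) / (pi *+ 2))).
  rewrite expRD cRM -mulrA; congr (_ * _).
  by rewrite mulrAC mulr_cconj lam1 expr1n mul1r.
(* exp(x) is the modulus of the multiplied function at 0. Jensen equality makes x nearly 0, and
   exp(x) >= 1 + x bounds the cross term of the squared distance. *)
set x := cRe q`_0 / 2 + _; have hx := expR_ge1Dx x.
have p := twopi_gt0 R.
have xE : x * (pi *+ 2) *+ 2 = cRe q`_0 * (pi *+ 2) + rint u.
  rewrite /x mulrDl divfK ?gt_eqF// rintZ//; by field.
have bnd : rint (fun t => expR (- clip K (u t)) * cabs (G t) ^+ 2) <=
    pi *+ 2 + n.+1%:R^-1 * W.
  rewrite -[pi *+ 2]mul1r -rint_cst -rintZ// -rintD; [|exact: rL1_cst|exact: rL1Z].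
  apply: rint_le.
  - apply: (@rL1_le _ _ (fun t => expR K * cabs (G t) ^+ 2)).
    + apply: measurable_funM; first exact: (measurable_expR_comp (mv n)).
      exact: rL1_measurable.
    + exact: rL1Z.
    + apply: ae_T_all => t _; rewrite normrM !ger0_norm ?expR_ge0 ?sqr_ge0//.
      rewrite ler_wpM2r ?sqr_ge0// ler_expR (le_trans (ler_norm _))//.
      by rewrite normrN clip_bound.
  - by apply: rL1D; [exact: rL1_cst|exact: rL1Z].
  apply: ae_T_sub eu => t <-; rewrite -expRD.
  (* Up to K the truncation is at least u, so the product is at most 1. Above K it is exp(-K) |G|^2,
     with exp(-K) <= 1 / (K + 1). *)
  have [uK|/ltW uK] := lerP (u t) K.
    rewrite -[leLHS]addr0 lerD ?mulr_ge0 ?expR_ge0 ?invr_ge0//.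
    by rewrite expR_le1 addrC subr_le0 clip_ge.
  rewrite clip_eq// expRD expRN -[leLHS]add0r lerD// ler_wpM2r ?expR_ge0//.
  rewrite lef_pV2 ?posrE ?expR_gt0// (le_trans _ (expR_ge1Dx _))//.
  by rewrite /K -natr1 addrC.
have nW : n.+1%:R^-1 * W <= e / 4.
  move: n1; rewrite subr0 ger0_norm ?invr_ge0// => n1.
  apply: (@le_trans _ _ (e / (4 * (W + 1)) * W)); first exact: ler_wpM2r.
  rewrite (_ : e / (4 * (W + 1)) = e / 4 / (W + 1)); last by rewrite invfM mulrA.
  rewrite mulrAC ler_pdivrMr ?ltr_wpDl// ler_wpM2l ?lerDl// ltW//.
move: n2e; rewrite opprK ler_norml => /andP[n2a _].
move: qm; rewrite ler_norml => /andP[qm _].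
have : (1 + x) * (pi *+ 2) <= expR x * (pi *+ 2) by rewrite ler_wpM2r// ltW.
rewrite mulrDl mul1r => hx2; rewrite -/K in n2a.
have qm' : - (e / 4) <= cRe q`_0 * (pi *+ 2) - rint (fun t : R => - clip K (u t)).
  exact: qm.
have qe' : rint (fun t : R => expR (cRe q.[eit t]) * cabs (G t) ^+ 2) <=
    rint (fun t : R => expR (- clip K (u t)) * cabs (G t) ^+ 2) + e / 4.
  exact: qe.
rewrite /=; move: hx2 xE bnd nW n2a qm' qe'.
move: (n.+1%:R^-1 * W) (x * (pi *+ 2)) (expR x * (pi *+ 2)) (cRe q`_0 * (pi *+ 2)).
move: (rint u) (rint (fun t => - clip K (u t))) (pi *+ 2) => U V P nW xp E Q.
move: (rint _) (rint _) => r1 r2; lra.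
Qed.

(* Smirnov's theorem: with the multipliers [P] of [outer0_cyclic], [X] is the
   [L^1] limit of multiples of the analytic functions [P F = X (P G)]. *)
Lemma outer0_div G X F m : outer0 G -> Lp 2 X -> cL1 F ->
  (forall k, k < m -> fourier F k = 0) ->
  ae_T (fun t => X t * G t = F t) -> forall k, k < m -> fourier X k = 0.
Proof.
move=> Go X2 F1 Fm XG k km; apply: cabs_le_eps => e e0.
have [GH _ _] := Go; have G2 := Hp_L2 GH.
have [d d0 hd] := @fourier_mul_small _ X e e0.
have [lam [lam1 [q hq]]] := outer0_cyclic Go d0.
have PG2 : Lp 2 (fun t => cexp_poly q t * G t).
  by apply: L2M_Linf => //; exact: Linf_cexp_poly.
have PGl : Lp 2 (fun t => cexp_poly q t * G t - lam) by apply: L2B => //; exact: L2_cst.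
have := hd _ k X2 PGl hq.
rewrite (_ : (fun t => _) =
  fun t => cexp_poly q t * G t * X t - lam * X t); last first.
  by apply/funext => t; rewrite mulrBl.
rewrite fourierB; [|exact: L2_mul|exact/cL1Z/L2_cL1].
rewrite (@fourier_ae _ _ (fun t => cexp_poly q t * F t)).
- rewrite (fourier_cexp_polyM q F1 Fm (ltW km)) Fm// mulr0 sub0r cabsN.
  by rewrite fourierZ ?cabsM ?lam1 ?mul1r//; exact: L2_cL1.
- by apply: cmeasurableM; exact: L2_measurable.
- by apply: cmeasurableM; [have [] := Linf_cexp_poly q|exact: cL1_measurable].
- by apply: ae_T_sub XG => t <-; rewrite -mulrA [G t * _]mulrC.
Qed.

End Szego.

(** * Rigidity and the trivial kernel *)

Section RigidKernel.
Variable R : realType.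
Local Notation C := R[i].
Implicit Types (f g u h X : Cfun R) (c : C) (k m : int).

Lemma Hp1D f g : Hp 1 f -> Hp 1 g -> Hp 1 (fun t => f t + g t).
Proof.
move=> [/Lp1P f1 f0] [/Lp1P g1 g0]; split; first by apply/Lp1P; exact: cL1D.
by move=> k k0; rewrite fourierD// f0// g0// addr0.
Qed.
Lemma Hp2D f g : Hp 2 f -> Hp 2 g -> Hp 2 (fun t => f t + g t).
Proof.
move=> [f2 f0] [g2 g0]; split; first exact: L2D.
move=> k k0; rewrite fourierD ?f0// ?g0// ?addr0//; exact: L2_cL1.
Qed.
Lemma Hp2Z c f : Hp 2 f -> Hp 2 (fun t => c * f t).
Proof.
move=> [f2 f0]; split; first exact: L2Z.
by move=> k k0; rewrite fourierZ ?f0// ?mulr0//; exact: L2_cL1.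
Qed.

Lemma outer0_fourier0 g : outer0 g -> fourier g 0 != 0.
Proof.
move=> [_ _ [lam lam1 ->]]; rewrite mulf_neq0//.
  by rewrite -cabs_gt0 lam1.
by apply: cR_neq0; rewrite gt_eqF// expR_gt0.
Qed.

(* Rigidity applied to [gp^2 (1 + |1 + c phi|^2)], where [phi = u / gp] and
   both [u] and [gp * conj phi] are analytic, forces [|1 + c phi|] to be
   constant for every [c], hence [phi] itself. *)
Lemma rigid_quotient_const gp u X : outer0 gp -> rigid (fun t => gp t ^+ 2) ->
  Hp 2 u -> Hp 2 X -> ae_T (fun t => X t = gp t * cconj (u t / gp t)) ->
  exists c, ae_T (fun t => u t / gp t = c).
Proof.
move=> gpo [gp1 [_ rig]] uH XH Xu; have gp0 := outer0_neq0 gpo.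
have [gpH _ _] := gpo.
have key c : exists l : R, ae_T (fun t => cabs (1 + c * (u t / gp t)) ^+ 2 = l).
  pose gc : Cfun R := fun t => gp t ^+ 2 + (gp t + c * u t) * (gp t + cconj c * X t).
  have gcH : Hp 1 gc.
    by apply: Hp1D => //; apply: Hp1_mul; apply: Hp2D => //; exact: Hp2Z.
  have gcE : ae_T (fun t => gc t = cR (1 + cabs (1 + c * (u t / gp t)) ^+ 2) * gp t ^+ 2).
    apply: ae_T_sub2 gp0 Xu => t g0 Xt; rewrite /gc Xt.
    have : u t = gp t * (u t / gp t) by rewrite mulrCA divff ?mulr1.
    move: (u t / gp t) => phi ->.
    rewrite cRD cR1 -mulr_cconj cconjD cconj1 cconjM; ring.
  have [|l [l0 hl]] := rig gc gcH.
    apply: ae_T_sub2 gp0 gcE => t g0 ->.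
    rewrite mulfK ?expf_neq0//; split => //=.
    by rewrite ltr_wpDr// sqr_ge0.
  exists (l - 1); apply: ae_T_sub3 gp0 gcE hl => t g0 -> h.
  have := mulIf (expf_neq0 2 g0) h; move=> [] <-.
  by rewrite addrAC subrr add0r.
have [l1 h1] := key 1; have [l2 h2] := key (-1).
have [l3 h3] := key (cmk 0 1); have [l4 h4] := key (cmk 0 (-1)).
(* Polarisation: |1 + phi|^2 - |1 - phi|^2 = 4 Re phi and |1 - i phi|^2 - |1 + i phi|^2 = 4 Im
   phi. *)
exists (cmk ((l1 - l2) / 4) ((l4 - l3) / 4)).
have h12 := ae_T_sub2 (fun t a b => conj a b) h1 h2.
have h34 := ae_T_sub2 (fun t a b => conj a b) h3 h4.
apply: ae_T_sub2 h12 h34 => t [] <- <- [] <- <-.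
case: (u t / gp t) => a b; rewrite !cabs_sqr.
by apply: complex_ext; rewrite !(cReD, cImD, cReM, cImM, cReN, cImN) /=; field.
Qed.

(** Stated for an analytic u in place of a kernel element, so that it serves both [theta^(-N) f]
    when N <= 0 and [f / theta^N] in the upper bound for the dimension. *)
Lemma rigid_kernel_trivial gm gp u h : outer 2 (fun t => cconj (gm t)) ->
  outer 2 gp -> rigid (fun t => gp t ^+ 2) -> Hp 2 u ->
  Lp 2 h -> (forall k, k < 1 -> fourier h k = 0) ->
  ae_T (fun t => gm t * (u t / gp t) = cconj (h t)) -> ae_zero u.
Proof.
move=> /outer_outer0 gmo /outer_outer0 gpo rig uH h2 h0 guh.
have gp0 := outer0_neq0 gpo; have [gpH _ _] := gpo.
pose X : Cfun R := fun t => gp t * cconj (u t / gp t).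
have mu := L2_measurable (Hp_L2 uH); have mgp := L2_measurable (Hp_L2 gpH).
have mX : cmeasurable X.
  apply: cmeasurableM => //; apply: cmeasurable_conj.
  by apply: cmeasurableM => //; exact: cmeasurableV.
have X2 : Lp 2 X.
  apply: (L2_le mX (L2_sqr (Hp_L2 uH))); apply: ae_T_sub gp0 => t g0.
  rewrite /X cabsM cabs_conj -cabsM mulrCA divff// mulr1//.
have XG : ae_T (fun t => X t * cconj (gm t) = gp t * h t).
  apply: ae_T_sub guh => t e; rewrite /X -mulrA; congr (_ * _).
  by rewrite -cconjM mulrC e cconjK.
have [F0 _] := fourier_mul_H2 gpH h2 h0.
have X0 := outer0_div gmo X2 (L2_mul (Hp_L2 gpH) h2) F0 XG.
have XH : Hp 2 X by split => // k k0; apply: X0; exact: lt_trans k0 _.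
have [|c hc] := rigid_quotient_const gpo rig uH XH; first exact: ae_T_all.
(* Now X = conj(c) g_+, and an outer function does not vanish at the origin. *)
have c0 : c = 0.
  have e : fourier X 0 = cconj c * fourier gp 0.
    rewrite -fourierZ; last exact/L2_cL1/Hp_L2.
    apply: fourier_ae => //; first by apply: cmeasurableM => //; exact: cmeasurable_cst.
    by apply: ae_T_sub hc => t; rewrite /X => ->; rewrite mulrC.
  move: e; rewrite X0// => /esym/eqP; rewrite mulf_eq0 cconj_eq0.
  by rewrite (negbTE (outer0_fourier0 gpo)) orbF => /eqP.
apply: ae_T_sub2 gp0 hc => t g0 /eqP; rewrite c0 mulf_eq0 invr_eq0.
by rewrite (negbTE g0) orbF => /eqP.
Qed.

End RigidKernel.

(** * Toeplitz kernels and analyticity criteria *)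

Section ToeplitzKernel.
Variable R : realType.
Local Notation C := R[i].
Implicit Types (f g u h w X Y : Cfun R) (c s : C) (k m : int).

Lemma HinfD f g : Hinf f -> Hinf g -> Hinf (fun t => f t + g t).
Proof.
move=> [[mf [M fM]] f1] [[mg [K gK]] g1]; split; last exact: Hp1D.
split; first exact: cmeasurableD.
exists (M + K); apply: ae_T_sub2 fM gK => t h1 h2.
by rewrite (le_trans (ler_cabsD _ _))// lerD.
Qed.

Lemma Hinf_cst c : Hinf (fun=> c : C).
Proof. by have := Hinf_poly c%:P; under eq_fun do rewrite hornerC. Qed.

Lemma HinfX f n : Hinf f -> Hinf (fun t => f t ^+ n).
Proof.
move=> fH; elim: n => [|n IH]; first exact: Hinf_cst.
by under eq_fun do rewrite exprS; exact: Hinf_mul.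
Qed.

Lemma Hinf_sub f g : Hinf f -> Hinf g -> Hinf (fun t => f t - g t).
Proof.
move=> fH gH; apply: HinfD => //.
have := Hinf_mul (Hinf_cst (-1)) gH.
by under eq_fun do rewrite mulN1r.
Qed.

Lemma fourier_cint0 f : fourier f 0 = 0 -> cint f = 0.
Proof.
rewrite fourier0 => /eqP; rewrite mulf_eq0 => /orP[|/eqP//].
by rewrite (negbTE (cR_neq0 _))// invr_eq0 twopi_neq0.
Qed.

Lemma kerT_fourier g f k : kerT g f -> 0 <= k ->
  fourier (fun t => g t * f t) k = 0.
Proof.
case: k => // n [fH h] _.
have := h (fun t => ('X^n : {poly C}).[eit t]) (Hinf_H2 (Hinf_poly _)) => e.
rewrite fourierE -[RHS](mulr0 (cR (pi *+ 2)^-1)) -e; congr (_ * _).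
apply: cint_eq => t _; rewrite hornerXn cconjX cconj_eit eitN exprVn -exprnN.
by rewrite mulrC.
Qed.

(** The conjugate is taken so that the product lemmas for analytic functions apply; the threshold 1
    instead of 0 records that it vanishes at the origin. *)
Lemma kerT_antianalytic g f : Linf g -> kerT g f ->
  Lp 2 (fun t => cconj (g t * f t)) /\
  forall k, k < 1 -> fourier (fun t => cconj (g t * f t)) k = 0.
Proof.
move=> gi kf; have [[f2 _] _] := kf.
have gf2 : Lp 2 (fun t => g t * f t) by exact: L2M_Linf.
split; first exact: L2_conj.
move=> k k1; rewrite fourier_conj; last exact: L2_cL1.
rewrite kerT_fourier ?cconj0// oppr_ge0; move: k1; by rewrite -[1]add0r ltzD1.
Qed.

Lemma kerT_intro g f w : Linf g -> Hp 2 f -> Lp 2 w ->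
  (forall k, k < 1 -> fourier w k = 0) ->
  ae_T (fun t => g t * f t = cconj (w t)) -> kerT g f.
Proof.
move=> gi fH w2 w0 gfw; split => // h hH.
have [hw _] := fourier_mul_H2 hH w2 w0.
have mh := L2_measurable (Hp_L2 hH).
have hw1 := L2_mul (Hp_L2 hH) w2.
rewrite (@cint_ae _ _ (fun t => cconj (h t * w t))).
- by rewrite cint_conj// (fourier_cint0 (hw 0 ltr01)) cconj0.
- apply: cmeasurableM; last exact: cmeasurable_conj.
  by apply: cmeasurableM; [case: gi|exact: L2_measurable (Hp_L2 fH)].
- by apply: cmeasurable_conj; exact: cL1_measurable.
- by apply: ae_T_sub gfw => t ->; rewrite cconjM mulrC.
Qed.

(** Such an f is analytic and its conjugate vanishes at the origin, so the product |f|^2 has mean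
    0. *)
Lemma L2_fourier_unique f : Lp 2 f -> (forall k, fourier f k = 0) -> ae_zero f.
Proof.
move=> f2 f0; have fH : Hp 2 f by [].
have c0 k : k < 1 -> fourier (fun t => cconj (f t)) k = 0.
  by move=> _; rewrite fourier_conj ?f0 ?cconj0//; exact: L2_cL1.
have [h _] := fourier_mul_H2 fH (L2_conj f2) c0.
have := fourier_cint0 (h 0 ltr01) => /(congr1 (@cRe R)); rewrite cRe_cint => n0.
have : ae_T (fun t => cabs (f t) ^+ 2 = 0).
  apply: rint_eq0_ae; [exact: L2_sqr|by move=> t; exact: sqr_ge0|].
  by apply: etrans n0; apply: rint_eq => t _; rewrite mulr_cconj.
by apply: ae_T_sub => t /eqP; rewrite expf_eq0 /= cabs_eq0 => /eqP.
Qed.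

Lemma Hinf_conj_const f : Hinf f -> (forall k, k < 0 -> fourier (fun t => cconj (f t)) k = 0) ->
  ae_T (fun t => f t = fourier f 0).
Proof.
move=> fH f0; have f2 := Hp_L2 (Hinf_H2 fH); have f1 := L2_cL1 f2.
have d2 : Lp 2 (fun t => f t - fourier f 0) by apply: L2B => //; exact: L2_cst.
have : ae_zero (fun t => f t - fourier f 0).
  apply: L2_fourier_unique => // k.
  rewrite fourierB//; last exact: cL1_cst.
  have -> : fourier (fun=> fourier f 0) k = if k == 0 then fourier f 0 else 0.
    have := fourier_poly (fourier f 0)%:P k.
    under eq_fun do rewrite hornerC; move=> ->.
    by case: k => [[|n]|n] //=; rewrite coefC.
  have [->|k0] := eqVneq k 0; first by rewrite subrr.
  rewrite subr0; have [kn|kp] := ltP k 0; first by have [_ [_ ->]] := fH.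
  have : 0 < k by rewrite lt_neqAle eq_sym k0.
  rewrite -oppr_lt0 => /f0; rewrite fourier_conj// opprK => /eqP.
  by rewrite cconj_eq0 => /eqP.
by apply: ae_T_sub => t /eqP; rewrite subr_eq0 => /eqP.
Qed.

(* The coefficients satisfy [Y^(k) = s Y^(k-1)] for [k < 0], so their moduli
   do not decrease towards -oo, while the Riemann-Lebesgue lemma makes them
   tend to 0. *)
Lemma fourier_div_linear Y s : Lp 2 Y -> cabs s <= 1 ->
  (forall k, k < 0 -> fourier (fun t => (1 - s * eit t) * Y t) k = 0) ->
  forall k, k < 0 -> fourier Y k = 0.
Proof.
move=> Y2 s1 h; have Y1 := L2_cL1 Y2.
have rec k : k < 0 -> fourier Y k = s * fourier Y (k - 1).
  move=> /h; rewrite (_ : (fun t => _) = fun t => Y t - s * (eit t ^ 1 * Y t)).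
    rewrite fourierB//; last by apply: cL1Z; exact: cL1_eitX.
    rewrite fourierZ; last exact: cL1_eitX.
    by rewrite fourier_shift => /eqP; rewrite subr_eq0 => /eqP.
  by apply/funext => t; rewrite expr1z mulrBl mul1r mulrA.
have mono (n : nat) k : k < 0 -> cabs (fourier Y k) <= cabs (fourier Y (k - n%:Z)).
  move=> k0; elim: n => [|n IH]; first by rewrite subr0.
  apply: (le_trans IH).
  have kn : k - n%:Z < 0 by rewrite ltrBlDr add0r (lt_le_trans k0).
  rewrite rec// cabsM -addn1 PoszD opprD addrA ler_piMl// cabs_ge0//.
move=> k k0; apply: cabs_le_eps => e e0.
have [n hn] := riemann_lebesgue Y2 e0.
apply: (le_trans (mono n k k0)); apply: hn.
case: k k0 => // j _; rewrite NegzE -opprD abszN -PoszD /=.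
by rewrite leq_addl.
Qed.

(** For b != 0 this is an instance of [H2_neq0_ae], the value at the origin being -b. *)
Lemma ae_eit_lin_neq0 (b : C) : ae_T (fun t => eit t - b != 0).
Proof.
have [->|b0] := eqVneq b 0.
  by apply: ae_T_all => t _; rewrite subr0 eit_neq0.
have H : Hp 2 (fun t => ('X - b%:P).[eit t]) by apply: Hinf_H2; exact: Hinf_poly.
have := H2_neq0_ae H; rewrite fourier_poly /= coefB coefX coefC /= sub0r oppr_eq0.
by move=> /(_ b0); apply: ae_T_sub => t; rewrite !hornerE.
Qed.

Lemma poly_roots (p : {poly C}) : p != 0 ->
  exists rs : seq C, p = lead_coef p *: \prod_(z <- rs) ('X - z%:P).
Proof. by move=> p0; have [rs] := closed_field_poly_normal p; exists rs. Qed.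

Lemma ae_poly_neq0 (p : {poly C}) : p != 0 -> ae_T (fun t => p.[eit t] != 0).
Proof.
move=> p0; have [rs pE] := poly_roots p0.
have l0 : lead_coef p != 0 by rewrite lead_coef_eq0.
have : ae_T (fun t => \prod_(z <- rs) (eit t - z) != 0).
  elim: rs {pE} => [|z rs IH].
    by apply: ae_T_all => t _; rewrite big_nil oner_neq0.
  by apply: ae_T_sub2 IH (ae_eit_lin_neq0 z) => t h1 h2; rewrite big_cons mulf_neq0.
apply: ae_T_sub => t h; rewrite pE hornerZ mulf_neq0// horner_prod.
by under eq_bigr do rewrite !hornerE.
Qed.

Lemma ae_poly_eq0 (p : {poly C}) : ae_T (fun t => p.[eit t] = 0) -> p = 0.
Proof.
move=> h; apply/eqP; apply: contrapT => /negP /ae_poly_neq0 p0.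
have [t _ []] := ae_T_exists (ae_T_sub2 (fun t a b => conj a b) h p0).
by move=> ->; rewrite eqxx.
Qed.

End ToeplitzKernel.

(** * Rational inner functions *)

Section RationalInner.
Variable R : realType.
Local Notation C := R[i].
Implicit Types (f g th Y : Cfun R) (a b c s : C) (k : int) (p q : {poly C}).

Lemma fourier_div_prod (I : Type) (r : seq I) (s : I -> C) Y : Lp 2 Y ->
  (forall i, cabs (s i) <= 1) ->
  (forall k, k < 0 -> fourier (fun t => (\prod_(i <- r) (1 - s i * eit t)) * Y t) k = 0) ->
  forall k, k < 0 -> fourier Y k = 0.
Proof.
move=> Y2 s1; elim: r Y Y2 => [|i r IH] Y Y2 h.
  by move: h; under eq_fun do rewrite big_nil mul1r.
apply: (fourier_div_linear Y2 (s1 i)); apply: IH.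
  have := L2M_Linf Y2 (Hinf_poly (1 - s i *: 'X)).1.
  by under eq_fun do rewrite !hornerE.
move=> k /h <-; under [in RHS]eq_fun do rewrite big_cons -mulrA.
by under [in LHS]eq_fun do rewrite mulrCA.
Qed.

Lemma cabs_blaschke a t : cabs (eit t - a) = cabs (1 - cconj a * eit t).
Proof.
rewrite -[RHS]cabs_conj cconjB cconjM cconjK cconj1 cconj_eit.
rewrite -[LHS]mul1r -(cabs_eit (- t)) -cabsM mulrBr -eitD addNr eit0.
by rewrite [a * _]mulrC.
Qed.

Lemma blaschke_denom_neq0 a t : cabs a < 1 -> 1 - cconj a * eit t != 0.
Proof.
move=> a1; apply/eqP => /eqP; rewrite subr_eq0 => /eqP /(congr1 (@cabs R)).
by rewrite cabs1 cabsM cabs_conj cabs_eit mulr1 => e; rewrite -e ltxx in a1.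
Qed.

(** A Bezout relation shows that 1 / q is bounded and analytic. Removing the Blaschke factors of the
    zeros of p in the disc leaves a unimodular analytic [th'] whose conjugate 1 / [th'] is a
    polynomial over factors without zeros in the disc. Both are analytic, so [th'] is constant. *)
Lemma inner_coprime_blaschke th p q : inner th -> q != 0 -> coprimep p q ->
  ae_T (fun t => th t * q.[eit t] = p.[eit t]) ->
  exists n, finite_blaschke n th.
Proof.
move=> [thH th1] q0 cpq thq.
have q0ae := ae_poly_neq0 q0.
have p0 : p != 0.
  apply/eqP => p0; have [t _ [h1 [h2 h3]]] := ae_T_exists
    (ae_T_sub3 (fun t x y z => conj x (conj y z)) th1 thq q0ae).
  move: h2; rewrite p0 horner0 => /eqP; rewrite mulf_eq0 (negbTE h3) orbF.
  by rewrite -cabs_eq0 h1 oner_eq0.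
have [u [v uv]] : exists u v : {poly C}, u * p + v * q = 1.
  have /Bezout_coprimepP[[u v] /= e] := cpq.
  move: e; rewrite -size_poly_eq1 => /size_poly1P[c c0 e].
  exists (c^-1%:P * u), (c^-1%:P * v).
  by rewrite -!mulrA -mulrDr e -polyCM mulVf.
(* On the circle h q = u p + v q = 1, so h is 1 / q, yet visibly bounded and analytic. *)
pose h : Cfun R := fun t => u.[eit t] * th t + v.[eit t].
have hH : Hinf h.
  by apply: HinfD; [apply: Hinf_mul => //|]; exact: Hinf_poly.
have uve t : u.[eit t] * p.[eit t] + v.[eit t] * q.[eit t] = 1.
  by rewrite -!hornerM -hornerD uv hornerC.
have hq : ae_T (fun t => h t * q.[eit t] = 1).
  apply: ae_T_sub thq => t e; rewrite /h mulrDl -mulrA e; exact: uve.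
have hp : ae_T (fun t => h t * p.[eit t] = th t).
  apply: ae_T_sub thq => t e; rewrite /h mulrDl -[RHS]mulr1 -(uve t) -e; ring.
have [rs pE] := poly_roots p0.
set lc := lead_coef p in pE; have lc0 : lc != 0 by rewrite lead_coef_eq0.
pose ins := [seq z <- rs | cabs z < 1]; pose outs := [seq z <- rs | ~~ (cabs z < 1)].
have pe t : p.[eit t] =
    lc * ((\prod_(z <- ins) (eit t - z)) * \prod_(z <- outs) (eit t - z)).
  rewrite pE hornerZ horner_prod; congr (_ * _).
  rewrite !big_filter (bigID (fun z => cabs z < 1)) /=.
  by congr (_ * _); apply: eq_bigr => z _; rewrite !hornerE.
(* The polynomial p with each factor z - a, |a| < 1, replaced by its reflection 1 - conj(a) z of
   equal modulus on the circle. *)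
pose rp : {poly C} := lc *: ((\prod_(z <- ins) (1 - cconj z *: 'X)) *
   \prod_(z <- outs) ('X - z%:P)).
have rpe t : rp.[eit t] = lc * ((\prod_(z <- ins) (1 - cconj z * eit t)) *
    \prod_(z <- outs) (eit t - z)).
  rewrite /rp hornerZ hornerM !horner_prod; congr (_ * (_ * _)).
    by apply: eq_bigr => z _; rewrite !hornerE.
  by apply: eq_bigr => z _; rewrite !hornerE.
pose th' : Cfun R := fun t => h t * rp.[eit t].
have th'H : Hinf th' by apply: Hinf_mul => //; exact: Hinf_poly.
pose B : Cfun R := fun t => \prod_(z <- ins) ((eit t - z) / (1 - cconj z * eit t)).
have insP z : z \in ins -> cabs z < 1 by rewrite mem_filter => /andP[].
have den0 t : \prod_(z <- ins) (1 - cconj z * eit t) != 0.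
  by rewrite prodf_seq_neq0; apply/allP => z /insP z1; rewrite blaschke_denom_neq0.
have thB : ae_T (fun t => th t = th' t * B t).
  apply: ae_T_sub hp => t <-; rewrite /th' pe rpe /B big_split /= prodfV.
  rewrite -!mulrA; congr (_ * (_ * _)).
  rewrite mulrCA; set P := \prod_(_ <- ins) (eit t - _).
  set Q := \prod_(_ <- ins) (1 - _) in den0 *.
  by rewrite [_ * (P / Q)]mulrC -!mulrA; field; exact: den0.
have B1 t : cabs (B t) = 1.
  rewrite /B big_seq; elim/big_rec: _ => [|z x zi IH]; first exact: cabs1.
  rewrite cabsM IH mulr1 cabsM cabsV cabs_blaschke divff// cabs_eq0.
  by rewrite blaschke_denom_neq0// insP.
have th'1 : ae_T (fun t => cabs (th' t) = 1).
  by apply: ae_T_sub2 thB th1 => t ->; rewrite cabsM B1 mulr1.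
have th'm : cmeasurable th' by case: th'H => -[].
have Y2 : Lp 2 (fun t => cconj (th' t)) by apply/L2_conj/Hp_L2/Hinf_H2.
(* All factors of [rp] become 1 - s z with |s| <= 1, up to constants. Zeros of p on the circle give
   |s| = 1, which [fourier_div_linear] admits. *)
pose s z : C := if cabs z < 1 then cconj z else z^-1.
have s1 z : cabs (s z) <= 1.
  rewrite /s; case: ifP => [/ltW|/negbT]; first by rewrite cabs_conj.
  by rewrite -leNgt cabsV => z1; rewrite invf_le1// (lt_le_trans ltr01).
pose K : C := lc * \prod_(z <- outs) (- z).
have outs0 z : z \in outs -> z != 0.
  rewrite mem_filter -leNgt => /andP[z1 _].
  by rewrite -cabs_gt0 (lt_le_trans ltr01).
have K0 : K != 0.
  rewrite /K mulf_neq0// prodf_seq_neq0; apply/allP => z /outs0 z0.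
  by rewrite oppr_eq0.
have rps t : rp.[eit t] = K * \prod_(z <- ins ++ outs) (1 - s z * eit t).
  rewrite rpe /K -mulrA; congr (_ * _); rewrite big_cat /= mulrCA; congr (_ * _).
    rewrite big_seq [RHS]big_seq; apply: eq_bigr => z /insP z1.
    by rewrite /s z1.
  rewrite -big_split /= big_seq [RHS]big_seq; apply: eq_bigr => z zo.
  have z0 := outs0 _ zo; move: zo; rewrite mem_filter => /andP[z1 _].
  by rewrite /s (negbTE z1) mulrBr mulr1 mulrA mulNr divff//; ring.
have Ya : forall k, k < 0 -> fourier (fun t => cconj (th' t)) k = 0.
  apply: (@fourier_div_prod _ (ins ++ outs) s _ Y2 s1) => k k0.
  rewrite (@fourier_ae _ _ (fun t => (K^-1 *: q).[eit t])).
  - by rewrite fourier_poly; case: k k0.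
  - apply: cmeasurableM; last exact: cmeasurable_conj.
    apply: cmeasurable_prod => z; apply: cmeasurableB; first exact: cmeasurable_cst.
    by apply: cmeasurableM; [exact: cmeasurable_cst|exact: cmeasurable_eit].
  - exact: cmeasurable_poly.
  - apply: ae_T_sub2 th'1 hq => t t1 e; rewrite (cconj_unit t1) hornerZ.
    have t0 : th' t != 0 by rewrite -cabs_gt0 t1.
    apply: (mulIf t0); rewrite mulfVK//.
    rewrite /th' rps; set P := \prod_(_ <- _ ++ _) _.
    rewrite -[LHS]mul1r -e; field; exact: K0.
have th'c := Hinf_conj_const th'H Ya.
set c := fourier th' 0 in th'c.
have c1 : cabs c = 1.
  by have [t _ []] := ae_T_exists (ae_T_sub2 (fun t x y => conj x y) th'c th'1) => ->.
exists (size ins), c, (fun j : 'I_(size ins) => nth 0 ins j); split => //; split.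
  by move=> j; apply: insP; exact: mem_nth.
apply: ae_T_sub2 thB th'c => t -> ->; congr (_ * _).
by rewrite /B (big_nth 0) big_mkord.
Qed.

Lemma inner_rational_blaschke th p q : inner th -> q != 0 ->
  ae_T (fun t => th t * q.[eit t] = p.[eit t]) ->
  exists n, finite_blaschke n th.
Proof.
move=> thI q0 thq; pose g := gcdp p q.
have g0 : g != 0 by rewrite gcdp_eq0 (negbTE q0) andbF.
have pg : p %/ g * g = p by rewrite divpK// dvdp_gcdl.
have qg : q %/ g * g = q by rewrite divpK// dvdp_gcdr.
apply: (@inner_coprime_blaschke th (p %/ g) (q %/ g)) => //.
- by apply: contraNneq q0 => e; rewrite -qg e mul0r.
- by rewrite coprimep_div_gcd// q0 orbT.
apply: ae_T_sub2 thq (ae_poly_neq0 g0) => t; rewrite -{1}pg -{1}qg !hornerM.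
by rewrite mulrA => e h; exact: (mulIf h).
Qed.

End RationalInner.

(** * Elements of the kernel *)

Section ModelSpace.
Variable R : realType.
Local Notation C := R[i].
Implicit Types (f g th u : Cfun R) (c : C) (k : int) (p q : {poly C}).

(** The last hypotheses put K in the model space of [th ^+ n]. Then g K g_+ = g_- conj(theta^n) K is
    the conjugate of conj(g_-) D, which is analytic and vanishes at the origin. *)
Lemma model_mul_kerT g gm gp th (n : nat) (K D : Cfun R) :
  Linf g -> Hp 2 (fun t => cconj (gm t)) -> outer0 gp ->
  ae_T (fun t => cabs (th t) = 1) ->
  ae_T (fun t => g t = gm t * (th t ^+ n)^-1 * (gp t)^-1) ->
  Hinf K -> Linf D -> (forall k, k < 1 -> fourier D k = 0) ->
  ae_T (fun t => th t ^+ n * cconj (K t) = D t) ->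
  kerT g (fun t => K t * gp t).
Proof.
move=> gi gmH gpo th1 gE KH Di D0 KD; have [gpH _ _] := gpo.
have D2 := Linf_L2 Di.
have [w0 _] := fourier_mul_H2 gmH D2 D0.
apply: (@kerT_intro _ _ _ (fun t => cconj (gm t) * D t) gi) => //.
- exact: Hp2_mul_Hinf.
- have := L2M_Linf (Hp_L2 gmH) Di.
  by under eq_fun do rewrite mulrC.
have h := ae_T_sub2 (fun t x y => conj x y) gE KD.
apply: ae_T_sub3 th1 (outer0_neq0 gpo) h => t t1 g0 [-> <-].
rewrite !cconjM !cconjK cconjX (cconj_unit t1) exprVn; field.
by rewrite g0 expf_neq0// -cabs_gt0 t1.
Qed.

(** The j-fold backward shift: the first j Taylor coefficients are removed and the rest is divided
    by z^j. *)
Definition bshift th (j : nat) : Cfun R :=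
  fun t => eit t ^ (- j%:Z) * (th t - (\poly_(i < j) fourier th i).[eit t]).

Lemma Hinf_bshift th j : Hinf th -> Hinf (bshift th j).
Proof.
move=> thH; pose p := \poly_(i < j) fourier th i.
have dH : Hinf (fun t => th t - p.[eit t]) by apply: Hinf_sub => //; exact: Hinf_poly.
have [[md [M dM]] [/Lp1P d1 d0]] := dH.
have mb : cmeasurable (bshift th j).
  by apply: cmeasurableM => //; exact: cmeasurable_eitX.
split; first split => //.
  by exists M; apply: ae_T_sub dM => t h; rewrite cabsM cabs_eitX mul1r.
split; first by apply/Lp1P; exact: cL1_eitX.
move=> k k0; rewrite fourier_shift opprK.
have [kj|kj] := ltP (k + j%:Z) 0; first exact: d0.
rewrite fourierB; [|by apply/Lp1P; case: thH => _ []|exact/L2_cL1/L2_poly].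
rewrite fourier_poly; case: (k + _) kj (ltrD2r j%:Z k 0) => // i _.
by rewrite k0 add0r ltz_nat coef_poly => ->; rewrite subrr.
Qed.

(** With p the removed Taylor polynomial, |theta| = 1 gives D = z^j - theta r, where r = z^j conj(p)
    on the circle. As deg p < j and j > 0, both terms are analytic and vanish at 0. *)
Lemma bshift_reflect th j : Hinf th -> (0 < j)%N ->
  ae_T (fun t => cabs (th t) = 1) -> exists D : Cfun R, [/\ Hinf D,
    fourier D 0 = 0 & ae_T (fun t => th t * cconj (bshift th j t) = D t)].
Proof.
move=> thH j0 th1; pose p := \poly_(i < j) fourier th i.
pose r : {poly C} := \poly_(i < j.+1) (if i == 0%N then 0 else cconj p`_(j - i)).
have rE t : eit t ^+ j * cconj p.[eit t] = r.[eit t].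
  rewrite /r [RHS]horner_poly [RHS]big_ord_recl /= mul0r add0r.
  rewrite {1}/p horner_poly cconj_sum mulr_sumr (reindex_inj rev_ord_inj) /=.
  apply: eq_bigr => i _; rewrite cconjM cconjX cconj_eit eitN exprVn.
  rewrite coef_poly /bump /= add1n /= ltn_subrL j0 /=.
  rewrite mulrCA; congr (_ * _).
  have e0 : eit t ^+ (j - i.+1) != 0 by rewrite expf_neq0// eit_neq0.
  by apply: (mulIf e0); rewrite mulfVK// -exprD addnC subnK.
pose D : Cfun R := fun t => ('X^j : {poly C}).[eit t] - r.[eit t] * th t.
have rH := Hinf_poly r; have th2 := Hinf_H2 thH.
exists D; split.
- by apply: Hinf_sub; [exact: Hinf_poly|exact: Hinf_mul].
- have [_ h] := fourier_mul_H2 (Hinf_H2 rH) (Hp_L2 th2) th2.2.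
  rewrite fourierB; [|exact/L2_cL1/L2_poly|exact/L2_mul/Hp_L2/th2/L2_poly].
  rewrite h !fourier_poly /= coefXn coef_poly /= mul0r subr0.
  by case: j j0 {p r rE D rH h}.
apply: ae_T_sub th1 => t t1; rewrite /bshift cconjM cconjB -eit_int cconj_eit.
rewrite mulrNz mulNr opprK eit_int.
rewrite mulrCA mulrBr mulr_cconj t1 expr1n cR1 /D hornerXn -rE -/p.
by rewrite -exprnP; ring.
Qed.

Lemma bshift_kerT g gm gp th (n j : nat) :
  Linf g -> Hp 2 (fun t => cconj (gm t)) -> outer0 gp -> inner th ->
  ae_T (fun t => g t = gm t * (th t ^+ n.+1)^-1 * (gp t)^-1) -> (0 < j)%N ->
  kerT g (fun t => bshift th j t * gp t).
Proof.
move=> gi gmH gpo [thH th1] gE j0.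
have [D [DH D0 DE]] := bshift_reflect thH j0 th1.
have tnH := HinfX n thH.
have D1 k : k < 1 -> fourier D k = 0.
  rewrite -[1]add0r ltzD1 le_eqVlt => /orP[/eqP ->//|k0].
  by have [_ [_ ->]] := DH.
have [E0 _] := fourier_mul_H2 (Hinf_H2 tnH) (Linf_L2 DH.1) D1.
apply: (model_mul_kerT gi gmH gpo th1 gE (Hinf_bshift j thH) (Hinf_mul tnH DH).1 E0).
by apply: ae_T_sub DE => t <-; rewrite exprSr mulrA.
Qed.

(** Multiplying the relation by z^m clears the negative powers and leaves theta q = p. The
    coefficients of the relation sit at distinct powers in q, so q is not 0. *)
Lemma bshift_dependent_blaschke th (m : nat) (c : 'I_m -> C) (i0 : 'I_m) :
  inner th -> c i0 != 0 ->
  ae_T (fun t => \sum_(i < m) c i * bshift th i.+1 t = 0) ->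
  exists n, finite_blaschke n th.
Proof.
move=> thI ci0 h.
pose P (j : nat) := \poly_(i < j) fourier th i.
pose q : {poly C} := \sum_(i < m) c i *: 'X^(m - i.+1).
pose p : {poly C} := \sum_(i < m) c i *: ('X^(m - i.+1) * P i.+1).
apply: (@inner_rational_blaschke _ th p q) => //.
- apply/eqP => /polyP /(_ (m - i0.+1)%N); rewrite coef0 coef_sum.
  rewrite (bigD1 i0)//= coefZ coefXn eqxx mulr1 big1 ?addr0; first exact/eqP.
  move=> i ii0; rewrite coefZ coefXn; case: eqP => [e|]; last by rewrite mulr0.
  case/eqP: ii0; apply: val_inj; apply: succn_inj.
  by rewrite -(subKn (ltn_ord i)) -e subKn.
apply: ae_T_sub h => t h; apply/eqP; rewrite -subr_eq0; apply/eqP.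
rewrite -(mulr0 (eit t ^+ m)) -h !horner_sum mulr_sumr mulr_sumr -sumrB.
apply: eq_bigr => i _; rewrite !hornerZ hornerM !hornerXn /bshift -/(P i.+1).
have -> : eit t ^+ (m - i.+1) = eit t ^+ m * eit t ^ (- i.+1%:Z).
  have e0 : eit t ^+ i.+1 != 0 by rewrite expf_neq0// eit_neq0.
  by apply: (mulIf e0); rewrite -exprnN mulfVK// -exprD subnK.
ring.
Qed.

Lemma Hinf_div_prod (n : nat) (a : 'I_n -> C) f : (forall i, cabs (a i) < 1) ->
  Hinf f -> Hinf (fun t => f t / \prod_(i < n) (1 - cconj (a i) * eit t)).
Proof.
move=> a1; elim: (index_enum _) f => [|i r IH] f fH.
  by under eq_fun do rewrite big_nil divr1.
under eq_fun do rewrite big_cons invfM mulrA.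
apply: IH; have [[mf [M fM]] f1] := fH.
have mden : cmeasurable (fun t => 1 - cconj (a i) * eit t).
  have := cmeasurable_poly (1 - cconj (a i) *: 'X).
  by under eq_fun do rewrite !hornerE.
have Li : Linf (fun t => f t / (1 - cconj (a i) * eit t)).
  split; first by apply: cmeasurableM => //; exact: cmeasurableV.
  have d0 : 0 < 1 - cabs (a i) by rewrite subr_gt0.
  exists (M / (1 - cabs (a i))); apply: ae_T_sub fM => t h.
  rewrite cabsM cabsV; apply: ler_pM => //; rewrite ?invr_ge0 ?cabs_ge0//.
  have e : 1 - cabs (a i) <= cabs (1 - cconj (a i) * eit t).
    have := ler_cabsD (1 - cconj (a i) * eit t) (cconj (a i) * eit t).
    by rewrite subrK cabs1 cabsM cabs_conj cabs_eit mulr1; lra.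
  by rewrite lef_pV2// posrE (lt_le_trans d0).
split => //; have L2i := Linf_L2 Li.
split; first by apply/Lp1P; exact: L2_cL1.
apply: (fourier_div_linear (s := cconj (a i)) L2i); first by rewrite cabs_conj ltW.
move=> k k0; have [_ f0] := f1; rewrite -(f0 k k0).
by under eq_fun do rewrite mulrCA divff ?mulr1 ?blaschke_denom_neq0//.
Qed.

(** The coefficient of A Z at -(n - d + 1) expresses the coefficient of Z at -(n + 1), through the
    leading coefficient 1 of A, by the d preceding ones. Hence d zeros propagate to all negative
    indices. *)
Lemma analytic_of_monic_mul (A : {poly C}) (d : nat) (Z : Cfun R) :
  A \is monic -> size A = d.+1 -> cL1 Z ->
  (forall k, k < 0 -> fourier (fun t => A.[eit t] * Z t) k = 0) ->
  (forall j, (j < d)%N -> fourier Z (- j.+1%:Z) = 0) ->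
  forall k, k < 0 -> fourier Z k = 0.
Proof.
move=> Am sA Z1 AZ Z0.
suff H n : fourier Z (- n.+1%:Z) = 0 by case=> // n _; rewrite NegzE.
elim/ltn_ind: n => n IH; have [/Z0//|dn] := ltnP n d.
have k0 : - (n - d).+1%:Z < 0 by rewrite oppr_lt0.
have := AZ _ k0; rewrite fourier_polyM// sA big_ord_recr /=.
have -> : A`_d = 1 by move/monicP: Am; rewrite /lead_coef sA.
rewrite mul1r -opprD -PoszD addSn subnK// big1 ?add0r// => i _.
rewrite -opprD -PoszD addSn IH ?mulr0//.
by rewrite -ltn_subRL subKn.
Qed.

End ModelSpace.

(** * Finite Blaschke products *)

Section FiniteBlaschke.
Variable R : realType.
Local Notation C := R[i].
Implicit Types (f g th u : Cfun R) (c : C) (k : int) (p q : {poly C}).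

Definition blaschke_den (n : nat) (a : 'I_n -> C) : Cfun R :=
  fun t => \prod_(i < n) (1 - cconj (a i) * eit t).

Lemma blaschke_den_neq0 n (a : 'I_n -> C) t : (forall i, cabs (a i) < 1) ->
  blaschke_den a t != 0.
Proof.
by move=> a1; apply/prodf_neq0 => i _; exact: blaschke_denom_neq0.
Qed.

Lemma blaschke_num n (a : 'I_n -> C) t :
  \prod_(i < n) (eit t - a i) = eit t ^+ n * cconj (blaschke_den a t).
Proof.
elim: n a => [|n IH] a; first by rewrite /blaschke_den !big_ord0 cconj1 mulr1.
rewrite /blaschke_den !big_ord_recl IH exprS cconjM cconjB cconjM cconjK cconj1.
rewrite -/(blaschke_den (fun i => a (lift ord0 i)) t).
rewrite [in RHS]mulrACA; congr (_ * _).
by rewrite mulrBr mulr1 mulrCA mulr_cconj cabs_eit expr1n mulr1.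
Qed.

Lemma Hinf_div_denX n (a : 'I_n -> C) N f : (forall i, cabs (a i) < 1) ->
  Hinf f -> Hinf (fun t => f t / blaschke_den a t ^+ N).
Proof.
move=> a1 fH; elim: N => [|N IH].
  by under eq_fun do rewrite expr0 divr1.
under eq_fun do rewrite exprSr invfM mulrA.
exact: (Hinf_div_prod a1 IH).
Qed.

Lemma blaschke_kerT_dim_ge g gm gp th (n N : nat) :
  Linf g -> Hp 2 (fun t => cconj (gm t)) -> outer0 gp ->
  ae_T (fun t => cabs (th t) = 1) -> finite_blaschke n th ->
  ae_T (fun t => g t = gm t * (th t ^+ N)^-1 * (gp t)^-1) ->
  kerT_dim_ge g (n * N).
Proof.
move=> gi gmH gpo th1 [c [a [c1 [a1 thE]]]] gE.
pose K (j : nat) : Cfun R := fun t => ('X^j : {poly C}).[eit t] / blaschke_den a t ^+ N.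
have KH j : Hinf (K j) by apply: Hinf_div_denX => //; exact: Hinf_poly.
exists (fun i t => K i t * gp t); split.
  move=> i.
  (* By [blaschke_num], theta^N conj(K) = c^N z^(n N - i) / den^N on the circle; it vanishes at 0
     because i < n N. *)
  pose E : Cfun R := fun t => c ^+ N / blaschke_den a t ^+ N.
  have EH : Hinf E by apply: Hinf_div_denX => //; exact: Hinf_cst.
  have [[mE [M EM]] [_ E0]] := EH.
  pose D : Cfun R := fun t => eit t ^ (n * N - i)%:Z * E t.
  apply: (@model_mul_kerT _ g gm gp th N (K i) D) => //.
  - split; first by apply: cmeasurableM => //; exact: cmeasurable_eitX.
    by exists M; apply: ae_T_sub EM => t h; rewrite cabsM cabs_eitX mul1r.
  - move=> k k1; rewrite fourier_shift E0// subr_lt0.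
    by rewrite (lt_le_trans k1)// lez_nat subn_gt0.
  - apply: ae_T_sub thE => t ->; rewrite /D /E /K hornerXn.
    have d0 := blaschke_den_neq0 t a1.
    have cd0 : cconj (blaschke_den a t) != 0 by rewrite cconj_eq0.
    rewrite big_split /= prodfV -/(blaschke_den a t) blaschke_num.
    rewrite cconjM cconjV !cconjX cconj_eit eitN -exprnP expfB_cond; last first.
      by rewrite (negbTE (eit_neq0 t)) add0n ltnW.
    rewrite !exprMn !exprVn -exprM; field.
    by rewrite !expf_neq0// eit_neq0.
move=> x hx i.
(* Up to the factor g_+ / den^N a linear relation is this polynomial; [insub] turns the exponent
   back into an index of x. *)
pose p : {poly C} := \poly_(j < n * N) (oapp x 0 (insub j)).
have : p = 0.
  apply: ae_poly_eq0; apply: ae_T_sub2 (outer0_neq0 gpo) hx => t g0 h.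
  have d0 : blaschke_den a t ^+ N != 0 by rewrite expf_neq0// blaschke_den_neq0.
  apply: (mulIf (mulf_neq0 (invr_neq0 d0) g0)); rewrite mul0r -h horner_poly mulr_suml.
  apply: eq_bigr => j _; rewrite valK /= /K hornerXn; ring.
by move=> /polyP /(_ i); rewrite coef_poly ltn_ord valK /= coef0.
Qed.

Lemma kerT_sum g (m : nat) (fs : 'I_m -> Cfun R) (x : 'I_m -> C) : Linf g ->
  (forall i, kerT g (fs i)) -> kerT g (fun t => \sum_(i < m) x i * fs i t).
Proof.
move=> gi kf; have f2 i : Lp 2 (fs i) by have [[]] := kf i.
have mf i := L2_measurable (f2 i).
split.
  elim: (index_enum _) => [|i r IH].
    under eq_fun do rewrite big_nil; exact: Hinf_H2 (Hinf_cst 0).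
  under eq_fun do rewrite big_cons.
  by apply: Hp2D => //; apply: Hp2Z; have [] := kf i.
move=> h hH; have h2 := Hp_L2 hH.
have i1 i : cL1 (fun t => g t * fs i t * cconj (h t)).
  by apply: L2_mul; [exact: L2M_Linf|exact: L2_conj].
rewrite (@cint_eq _ _ (fun t => \sum_(i < m) x i * (g t * fs i t * cconj (h t)))).
  rewrite cint_sum; last by move=> i; exact: cL1Z.
  by apply: big1 => i _; rewrite cintZ//; have [_ ->] := kf i; rewrite ?mulr0.
move=> t _; rewrite mulr_sumr mulr_suml; apply: eq_bigr => i _; ring.
Qed.

Lemma exists_left_null (F : fieldType) (d : nat) (M : 'M[F]_(d.+1, d)) :
  exists2 v : 'rV[F]_d.+1, v != 0 & v *m M = 0.
Proof.
have : kermx M != 0.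
  rewrite -mxrank_eq0 mxrank_ker subn_eq0 -ltnNge ltnS; exact: rank_leq_col.
by move=> /rowV0Pn[v /sub_kermxP vM v0]; exists v.
Qed.

Lemma blaschke_kerT_dim_le g gm gp th (n N : nat) :
  Linf g -> outer 2 (fun t => cconj (gm t)) -> outer 2 gp ->
  rigid (fun t => gp t ^+ 2) -> inner th -> finite_blaschke n th ->
  ae_T (fun t => g t = gm t * (th t ^+ N)^-1 * (gp t)^-1) ->
  ~ kerT_dim_ge g (n * N).+1.
Proof.
move=> gi gmo gpo rig [thH th1] [c [a [c1 [a1 thE]]]] gE [fs [kf ind]].
set d := (n * N)%N in fs kf ind.
have thm : cmeasurable th by case: thH => -[].
have tcL : Linf (fun t => cconj (th t) ^+ N).
  split; first by apply: cmeasurableX; exact: cmeasurable_conj.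
  exists 1; apply: ae_T_sub th1 => t t1.
  by rewrite cabsX cabs_conj t1 expr1n.
have f2 i : Lp 2 (fs i) by have [[]] := kf i.
(* Row i lists the first d negative coefficients of [f_i / theta^N]. There is one row more than
   columns, so some nonzero combination annihilates them all. *)
pose M : 'M[C]_(d.+1, d) :=
  \matrix_(i, j) fourier (fun t => cconj (th t) ^+ N * fs i t) (- j.+1%:Z).
have [v v0 vM] := exists_left_null M.
pose x i := v 0 i; pose f : Cfun R := fun t => \sum_(i < d.+1) x i * fs i t.
have kff : kerT g f by exact: kerT_sum.
have [[ff2 ff0] _] := kff.
pose Z : Cfun R := fun t => cconj (th t) ^+ N * f t.
have Z2 : Lp 2 Z by exact: L2M_Linf.
have Zc j : (j < d)%N -> fourier Z (- j.+1%:Z) = 0.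
  move=> jd; have := congr1 (fun m : 'rV[C]_d => m 0 (Ordinal jd)) vM.
  rewrite !mxE => <-.
  rewrite (_ : Z = fun t => \sum_(i < d.+1) x i * (cconj (th t) ^+ N * fs i t)).
    rewrite fourier_sum; last by move=> i; apply/cL1Z/L2_cL1; exact: L2M_Linf.
    apply: eq_bigr => i _; rewrite fourierZ ?mxE//.
    by apply: L2_cL1; exact: L2M_Linf.
  apply/funext => t; rewrite /Z mulr_sumr; apply: eq_bigr => i _.
  by rewrite mulrCA.
(* The numerator of theta^N. On the circle its product with conj(theta)^N is c^(-N) den^N, so A Z is
   a polynomial times f and therefore analytic. *)
pose A : {poly C} := (\prod_(i < n) ('X - (a i)%:P)) ^+ N.
have Am0 : \prod_(i < n) ('X - (a i)%:P) \is monic by exact: monic_prod_XsubC.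
have Am : A \is monic by exact: monic_exp.
have sA : size A = d.+1.
  have sp : size (\prod_(i < n) ('X - (a i)%:P)) = n.+1.
    by rewrite size_prod_XsubC /index_enum -enumT size_enum_ord.
  have := size_exp (\prod_(i < n) ('X - (a i)%:P)) N.
  rewrite sp /= -/d -/A => <-.
  by rewrite prednK ?size_poly_gt0 ?monic_neq0.
pose Dp : {poly C} := c^-1 ^+ N *: (\prod_(i < n) (1 - cconj (a i) *: 'X)) ^+ N.
have c0 : c != 0 by rewrite -cabs_gt0 c1.
have Af : ae_T (fun t => A.[eit t] * Z t = Dp.[eit t] * f t).
  apply: ae_T_sub2 th1 thE => t t1 tE.
  rewrite /Z mulrA; congr (_ * _); rewrite /A /Dp hornerZ !horner_exp !horner_prod.
  have -> : \prod_(i < n) (1 - cconj (a i) *: 'X).[eit t] = blaschke_den a t.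
    by apply: eq_bigr => i _; rewrite !hornerE.
  have d0 := blaschke_den_neq0 t a1.
  have -> : \prod_(i < n) ('X - (a i)%:P).[eit t] = th t * blaschke_den a t / c.
    rewrite tE big_split /= prodfV -/(blaschke_den a t).
    rewrite mulrA divfK// [c * _]mulrC mulfK//.
    by apply: eq_bigr => i _; rewrite !hornerE.
  rewrite -!exprMn; congr (_ ^+ N).
  by rewrite mulrAC [X in X / c]mulrAC mulr_cconj t1 expr1n cR1 mul1r mulrC.
have AZ k : k < 0 -> fourier (fun t => A.[eit t] * Z t) k = 0.
  move=> k0; have DfH := Hp2_mul_Hinf (Hinf_poly Dp) kff.1.
  rewrite (fourier_ae k _ _ Af); first by have [_ ->] := DfH.
  - by apply: cmeasurableM; [exact: cmeasurable_poly|exact: L2_measurable].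
  - exact: L2_measurable (Hp_L2 DfH).
have ZH : Hp 2 Z.
  by split => //; exact: (analytic_of_monic_mul Am sA (L2_cL1 Z2) AZ Zc).
have [h2 h0] := kerT_antianalytic gi kff.
have Zz : ae_zero Z.
  apply: (rigid_kernel_trivial gmo gpo rig ZH h2 h0).
  apply: ae_T_sub2 th1 gE => t t1 ->; rewrite cconjK /Z (cconj_unit t1) exprVn.
  by ring.
have fz : ae_T (fun t => \sum_(i < d.+1) x i * fs i t = 0).
  apply: ae_T_sub2 th1 Zz => t t1 /eqP; rewrite /Z mulf_eq0 expf_eq0 cconj_eq0.
  by rewrite -cabs_eq0 t1 oner_eq0 andbF => /eqP.
case/eqP: v0; apply/rowP => i; rewrite mxE; exact: (ind x fz i).
Qed.

End FiniteBlaschke.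

Theorem theorem2 (R : realType) (g gm gp th : Cfun R) (N : int) :
  Linf g ->
  outer 2 (fun t => cconj (gm t)) ->
  outer 2 gp ->
  rigid (fun t => gp t ^+ 2) ->
  inner th -> nonconstant th ->
  ae_T (fun t => g t = gm t * th t ^ (- N) * (gp t)^-1) ->
  (kerT_nontrivial g <-> (0 < N)%R) /\
  ((0 < N)%R -> forall n : nat, finite_blaschke n th ->
      kerT_dim_eq g (n * `|N|%N)) /\
  ((0 < N)%R -> ~ (exists n : nat, finite_blaschke n th) ->
      kerT_dim_infinite g).
Proof.
move=> gi gmo gpo rig thI thn gE.
have [gmH _ _] := outer_outer0 gmo; have gpo0 := outer_outer0 gpo.
have gp0 := outer0_neq0 gpo0; have [thH th1] := thI.
have gEp (n : nat) : N = n.+1%:Z ->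
    ae_T (fun t => g t = gm t * (th t ^+ n.+1)^-1 * (gp t)^-1).
  by move=> Nn; apply: ae_T_sub gE => t ->; rewrite Nn -exprnN.
have posN : (0 < N)%R -> exists n, N = n.+1%:Z.
  by case: N {gE gEp} => [[|n]|n] // _; exists n.
split; last split.
- split=> [[f [kf f0]]|/posN[n Nn]].
    rewrite ltNge; apply/negP => N0; apply: f0.
    have [n Nn] : exists n : nat, - N = n%:Z.
      by exists `|N|%N; rewrite abszE ler0_norm.
    have [h2 h0] := kerT_antianalytic gi kf.
    have uH := Hp2_mul_Hinf (HinfX n thH) kf.1.
    have u0 : ae_zero (fun t => th t ^+ n * f t).
      apply: (rigid_kernel_trivial gmo gpo rig uH h2 h0).
      by apply: ae_T_sub gE => t ->; rewrite cconjK Nn -exprnP; ring.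
    apply: ae_T_sub2 th1 u0 => t t1 /eqP; rewrite mulf_eq0 expf_eq0.
    by rewrite -cabs_eq0 t1 oner_eq0 andbF => /eqP.
  exists (fun t => bshift th 1 t * gp t); split.
    exact: (bshift_kerT gi gmH gpo0 thI (gEp n Nn)).
  (* If this kernel element were 0, theta would equal its Taylor coefficient of order 0 and so be
     constant. *)
  move=> z; apply: thn; exists (fourier th 0).
  apply: ae_T_sub2 gp0 z => t g0 /eqP; rewrite !mulf_eq0 (negbTE g0) orbF.
  rewrite expfz_eq0 (negbTE (eit_neq0 t)) andbF /= subr_eq0 => /eqP ->.
  by rewrite horner_poly big_ord1 expr0 mulr1.
- move=> /posN[n Nn] m mB; rewrite Nn /=; split.
    exact: (blaschke_kerT_dim_ge gi gmH gpo0 th1 mB (gEp n Nn)).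
  exact: (blaschke_kerT_dim_le gi gmo gpo rig thI mB (gEp n Nn)).
- move=> /posN[n Nn] nB m.
  exists (fun i t => bshift th i.+1 t * gp t); split.
    by move=> i; exact: (bshift_kerT gi gmH gpo0 thI (gEp n Nn)).
  move=> c hc i; apply/eqP; apply: contrapT => /negP ci; apply: nB.
  apply: (@bshift_dependent_blaschke _ th m c i) => //.
  apply: ae_T_sub2 gp0 hc => t g0 h; apply: (mulIf g0).
  rewrite mul0r -[RHS]h mulr_suml; apply: eq_bigr => j _.
  by rewrite mulrA.
Qed.
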